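(* Let $X$ be a projective toric variety of dimension $n$, let $F_0,\dots,F_n$ be the generic homogeneous polynomials of ample degrees $\alpha_0,\dots,\alpha_n$ in its homogeneous coordinate ring $S$, let $\rho=\sum_i\alpha_i-\beta_0$ be the critical degree, let $\bar\sigma$ be a complete flag of cones of the fan of $X$, and let $\Delta_{\bar\sigma}\in S_\rho$ be an associated determinant (all as defined in the context). Let $\mathbb{M}$ be the matrix, in the monomial bases, of the $\mathbb{A}$-linear map $$\phi: S_{\rho-\alpha_0}\oplus\dots\oplus S_{\rho-\alpha_n}\oplus\mathbb{A}\to S_\rho,\qquad (G_0,\dots,G_n,c)\mapsto \sum_{i=0}^n G_iF_i+c\,\Delta_{\bar\sigma},$$ with rows indexed by the monomial basis of the domain and columns indexed by the monomials of degree $\rho$. Let $h\in S_\rho$ be a monomial, let $\tilde{\mathbb{M}}$ be any square maximal submatrix of $\mathbb{M}$ with nonvanishing determinant, and let $\tilde{\mathbb{M}}_h$ be the square submatrix of $\tilde{\mathbb{M}}$ obtained by deleting the row indexed by $(0,\dots,0,1)$ and the column indexed by $h$. Then $$\mathrm{Residue}_F(h)=\pm\frac{\det(\tilde{\mathbb{M}}_h)}{\det(\tilde{\mathbb{M}})}.$$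
   Context: Setting. $X$ is a projective (not necessarily simplicial) toric variety of dimension $n$ with fan $\Sigma\subset\mathbb{R}^n$ (lattice $\mathbb{Z}^n$). Let $\eta_0,\dots,\eta_{s-1}$ be the primitive generators of the $1$-dimensional cones of $\Sigma$ and $D_0,\dots,D_{s-1}$ the corresponding torus-invariant divisors. Let $\alpha_0,\dots,\alpha_n\in A_{n-1}(X)$ (the Chow group) be ample classes, and $\beta_0=[\sum_i D_i]$. A monomial $x^a=\prod x_i^{a_i}$ has degree $\deg(a)=[\sum a_iD_i]\in A_{n-1}(X)$. Put $\mathcal{A}_i=\{a\in\mathbb{N}^s:\deg(a)=\alpha_i\}$, $\mathbb{A}=\mathbb{Q}[u_{ia};\ i=0,\dots,n,\ a\in\mathcal{A}_i]$ with fraction field $Q(\mathbb{A})$, and $S=\mathbb{A}[x_0,\dots,x_{s-1}]$, graded by $A_{n-1}(X)$; $S_\gamma$ is the free $\mathbb{A}$-module spanned by the monomials of degree $\gamma$. The generic polynomials are $F_i=\sum_{a\in\mathcal{A}_i}u_{ia}x^a\in S_{\alpha_i}$, $i=0,\dots,n$. The critical degree is $\rho=\sum_i\alpha_i-\beta_0$. Toric residue. For an $n$-element subset $I=\{i_1,\dots,i_n\}$ of $\{0,\dots,s-1\}$ put $\det(\eta_I)=\det(\langle e_l,\eta_{i_j}\rangle)_{1\le l,j\le n}$ ($e_l$ the standard basis), $dx_I=dx_{i_1}\wedge\cdots\wedge dx_{i_n}$, $\hat x_I=\prod_{j\notin I}x_j$, and $\Omega=\sum_{|I|=n}\det(\eta_I)\,\hat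 x_I\,dx_I$. Working over the field $Q(\mathbb{A})$, the generic $F_i$ have no common zero on $X$, so the sets $U_i=\{x\in X: F_i(x)\ne0\}$ form an open cover of $X$. For $g\in S_\rho$, the form $\omega_g=\frac{g\,\Omega}{F_0\cdots F_n}$ is a Čech $n$-cocycle for this cover and defines a class $[\omega_g]\in H^n(X,\Omega_X^n)$, where $\Omega_X^n\cong\mathcal{O}(-\beta_0)$ is the canonical sheaf. Define $\mathrm{Residue}_F(g)=\mathrm{Tr}_X([\omega_g])\in Q(\mathbb{A})$, with $\mathrm{Tr}_X$ the trace map of duality theory. The element $\Delta_{\bar\sigma}$. A complete flag is $\bar\sigma=(\{0\}=\sigma_0\subset\sigma_1\subset\cdots\subset\sigma_n)$ with $\sigma_i\in\Sigma$ a cone of dimension $i$. For $i=1,\dots,n$ let $z_i$ be the product of all variables $x_j$ with $\eta_j\in\sigma_i$, $\eta_j\notin\sigma_{i-1}$, and let $z_{n+1}=\prod_{\eta_j\notin\sigma_n}x_j$. Each $F_j$ can be written (non-uniquely) as $F_j=\sum_{i=1}^{n+1}A_{ij}z_i$ with $A_{ij}\in S$ homogeneous of degree $\alpha_j-\deg(z_i)$; fix such expressions and put $\Delta_{\bar\sigma}=\det(A_{ij})\in S_\rho$. The monomial basis of the domain of $\phi$ consists of the monomials of each $S_{\rho-\alpha_i}$ together with the generator $(0,\dots,0,1)$ of the last summand $\mathbb{A}$. A square maximal submatrix of $\mathbb{M}$ is a square submatrix using all columns (i.e. of size $\operatorname{rank}S_\rho$); any such submatrix with nonzero determinant necessarily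 contains the row indexed by $(0,\dots,0,1)$. *)

(* Defs.v *)
From HB Require Import structures.
From mathcomp Require Import all_boot all_order all_fingroup all_algebra.
From mathcomp.multinomials Require Export mpoly.

Set Implicit Arguments.
Unset Strict Implicit.
Unset Printing Implicit Defensive.

Import Order.TTheory GRing.Theory Num.Theory.
Local Open Scope ring_scope.

Notation "x %:F" := (@FracField.tofrac _ x) : ring_scope.

Definition enumerates (N : nat) (T : Type) (e : 'I_N -> T) (P : T -> Prop) : Prop :=
  injective e /\ forall x, P x <-> exists k, e k = x.

(** Fans in R^n.  Row j of [eta] is the primitive generator of the j-th ray, and
    a cone of the fan is encoded by the set of indices of the rays it contains. *)

Section Fan.
Variables (n s : nat) (eta : 'M[int]_(s, n)) (Sigma : {set {set 'I_s}}).

Definition in_cone (R : realFieldType) (A : {set 'I_s}) (v : 'rV[R]_n) : Prop :=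
  exists c : 'I_s -> R,
    (forall j, j \in A -> 0 <= c j) /\
    v = \sum_(j in A) c j *: map_mx intr (row j eta).

(* [m] is a lattice functional; [(eta *m m) j 0] is <m, eta_j>.  The faces of a
   rational cone are cut out by lattice functionals. *)
Definition is_face (A B : {set 'I_s}) : Prop :=
  exists m : 'cV[int]_n,
    (forall j, j \in A -> 0 <= (eta *m m) j 0) /\
    B = [set j in A | (eta *m m) j 0 == 0].

Definition cone_dim (A : {set 'I_s}) : nat :=
  \rank (\matrix_(j < s, l < n) if j \in A then (eta j l)%:~R else 0 : rat).

Record is_fan (R : realFieldType) : Prop := IsFan {
  fan_primitive : forall j, \big[gcdn/0%N]_(l < n) `|eta j l|%N = 1%N;
  fan_ray : forall j, [set j] \in Sigma;
  fan_saturated : forall A, A \in Sigma -> forall j,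
    in_cone A (map_mx intr (row j eta) : 'rV[R]_n) -> j \in A;
  fan_strongly_convex : forall A, A \in Sigma -> forall v : 'rV[R]_n,
    in_cone A v -> in_cone A (- v) -> v = 0;
  fan_face : forall A B, A \in Sigma -> is_face A B -> B \in Sigma;
  fan_inter : forall A B, A \in Sigma -> B \in Sigma ->
    [/\ is_face A (A :&: B), is_face B (A :&: B) &
      forall v : 'rV[R]_n, in_cone A v -> in_cone B v -> in_cone (A :&: B) v]
}.

Definition complete_fan (R : realFieldType) : Prop :=
  forall v : 'rV[R]_n, exists2 A, A \in Sigma & in_cone A v.

(** The divisor sum_j D_j * D_(j) is the column vector [D]; the divisor of the
    character m is [eta *m m], so that A_{n-1}(X) is the quotient of 'cV[int]_s
    by [lin_equiv].  Classes are given by representatives. *)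

Definition lin_equiv (D E : 'cV[int]_s) : Prop :=
  exists m : 'cV[int]_n, D = E + eta *m m.

(* D is Cartier, and its support function, given by m_A on the maximal cone A, is
   strictly convex. *)
Definition ample (D : 'cV[int]_s) : Prop :=
  forall A, A \in Sigma -> cone_dim A = n ->
  exists m : 'cV[int]_n, forall j,
    if j \in A then (eta *m m) j 0 = - D j 0 else - D j 0 < (eta *m m) j 0.

Definition projective_fan (R : realFieldType) : Prop :=
  [/\ is_fan R, complete_fan R & exists D, ample D].

Definition beta0 : 'cV[int]_s := const_mx 1.

Definition mdiv (a : 'X_{1..s}) : 'cV[int]_s := \col_j (a j)%:Z.

Definition homogeneous (R : nzRingType) (D : 'cV[int]_s) (p : {mpoly R[s]}) : Prop :=
  forall a, a \in msupp p -> lin_equiv (mdiv a) D.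

Record complete_flag (sigma : nat -> {set 'I_s}) : Prop := CompleteFlag {
  flag_cone : forall i, (i <= n)%N -> sigma i \in Sigma;
  flag_dim : forall i, (i <= n)%N -> cone_dim (sigma i) = i;
  flag_sub : forall i, (i < n)%N -> sigma i \subset sigma i.+1
}.

(* Exponent of z_{k+1}; only the values sigma 0, ..., sigma n are used. *)
Definition zexp (sigma : nat -> {set 'I_s}) (k : 'I_n.+1) : 'X_{1..s} :=
  [multinom nat_of_bool (j \in (if (k < n)%N then sigma k.+1 else setT) :\: sigma k)
    | j < s].

End Fan.

(** Differential n-forms in x_0, ..., x_{s-1} and the canonical sheaf of X. *)

Section Cech.
Variables (n s : nat) (eta : 'M[int]_(s, n)) (Sigma : {set {set 'I_s}}).
Variable K : fieldType.
Local Notation S := {mpoly K[s]}.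
Local Notation L := {fraction S}.

(* [w I] is the coefficient of dx_I (zero unless #|I| = n). *)
Definition nform := {ffun {set 'I_s} -> L^o}.

(* Wedge product of the 1-forms sum_j theta l j dx_j, for l = 0, ..., n-1. *)
Definition wedge (theta : 'I_n -> 'I_s -> L) : nform :=
  [ffun I : {set 'I_s} => if #|I| == n
    then \det (\matrix_(l < n, k < n) [seq theta l j | j <- enum I]`_k) else 0].

Definition Omega : nform :=
  [ffun I : {set 'I_s} =>
    wedge (fun l j => (eta j l)%:~R) I * \prod_(j in ~: I) ('X_j : S)%:F].

(* The sections of the canonical sheaf on {f <> 0}, for f homogeneous and
   nonzero: h Omega with h of degree - beta0 in the localization S_f. *)
Definition canonical_section (f : S) (w : nform) : Prop :=
  exists D k (p : S),
    [/\ homogeneous eta D f, homogeneous eta (D *+ k - beta0 s) p &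
        w = (p%:F / f%:F ^+ k) *: Omega].

(* Open covers of X by finitely many affine open sets {f_j <> 0}, with f_j of
   ample degree.  A point of X over an extension field L' of K has homogeneous
   coordinates x such that x_j <> 0 for all rays j outside some cone. *)
Definition no_common_zero (m : nat) (f : 'I_m -> S) : Prop :=
  forall (L' : fieldType) (phi : {rmorphism K -> L'}) (x : 'I_s -> L'),
    (exists2 A, A \in Sigma & forall j, j \notin A -> x j != 0) ->
    exists j, mmap phi x (f j) != 0.

Definition open_cover (m : nat) (f : 'I_m -> S) : Prop :=
  (forall j, f j != 0 /\ exists2 D, ample eta Sigma D & homogeneous eta D (f j)) /\
  no_common_zero f.

(* Alternating Cech cochains with values in the canonical sheaf; the Cech degree
   is k - 1. *)
Definition precochain (k m : nat) := {ffun {ffun 'I_k -> 'I_m} -> nform}.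

Definition cochain (k m : nat) (f : 'I_m -> S) (c : precochain k m) : Prop :=
  [/\ forall (t : {ffun 'I_k -> 'I_m}) (p : 'S_k),
        c [ffun i => t (p i)] = (-1) ^+ p *: c t,
      forall t : {ffun 'I_k -> 'I_m}, ~~ injectiveb t -> c t = 0 &
      forall t : {ffun 'I_k -> 'I_m}, canonical_section (\prod_i f (t i)) (c t)].

Definition coboundary (k m : nat) (c : precochain k m) : precochain k.+1 m :=
  [ffun t : {ffun 'I_k.+1 -> 'I_m} =>
    \sum_(i < k.+1) (-1) ^+ i *: c [ffun j => t (lift i j)]].

Definition cocycle (k m : nat) (f : 'I_m -> S) (c : precochain k m) : Prop :=
  cochain f c /\ coboundary c = 0.

(* {f' j <> 0} is contained in {f (tau j) <> 0}. *)
Definition refinement (m m' : nat) (tau : 'I_m' -> 'I_m)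
    (f : 'I_m -> S) (f' : 'I_m' -> S) : Prop :=
  forall j, exists e (q : S), f' j ^+ e = q * f (tau j).

Definition pullback (k m m' : nat) (tau : 'I_m' -> 'I_m)
    (c : precochain k m) : precochain k m' :=
  [ffun t : {ffun 'I_k -> 'I_m'} => c [ffun i => tau (t i)]].

(* The l-th coordinate function of the torus and the coefficients of its
   differential: d chi_l = sum_j dchi l j dx_j. *)
Definition chi (l : 'I_n) : L := \prod_j ('X_j : S)%:F ^ eta j l.
Definition dchi (l : 'I_n) (j : 'I_s) : L :=
  chi l * (eta j l)%:~R / ('X_j : S)%:F.

(* The cocycle [c] on the cover [f] represents the image in H^n(X, Omega^n) of
   the local cohomology class [dt_1 ... dt_n / t_1, ..., t_n] at the identity P
   of the torus T, where t_l = chi_l - 1.  The open set of index kappa 0 is T;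
   no other member of the cover contains P, so that the cocycles vanishing away
   from kappa 0 are the cocycles with support in P; and the open set of index
   kappa (l + 1) is {t_l <> 0} in T. *)
Definition unit_point_class (m : nat) (f : 'I_m -> S) (c : precochain n.+1 m) : Prop :=
  cocycle f c /\
  exists kappa : {ffun 'I_n.+1 -> 'I_m},
    [/\ exists2 a : 'X_{1..s}, (forall j, 0 < a j)%N & f (kappa ord0) = 'X_[a],
        forall l : 'I_n, exists2 a : 'X_{1..s}, (forall j, 0 < a j)%N &
          (f (kappa (lift ord0 l)))%:F = ('X_[a] : S)%:F * (chi l - 1),
        forall j, j != kappa ord0 -> (f j).@[fun=> 1] = 0,
        forall t : {ffun 'I_n.+1 -> 'I_m},
          kappa ord0 \notin codom t -> c t = 0 &
        c kappa = (\prod_l (chi l - 1))^-1 *: wedge dchi].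

(* The trace map H^n(X, Omega^n) -> K, where H^n is the direct limit of Cech
   cohomology over the covers above.  It is normalized as in duality theory, by
   requiring that it induces the Grothendieck residue (here at the identity of
   the torus, a smooth rational point), up to the choice of a global sign.
   Degree-n coboundaries only exist for n > 0. *)
Record is_trace (Tr : forall m, ('I_m -> S) -> precochain n.+1 m -> K) : Prop := IsTrace {
  trace_linear : forall m (f : 'I_m -> S) a c c',
    open_cover f -> cocycle f c -> cocycle f c' ->
    Tr m f ([ffun t => (a%:MP : S)%:F *: c t] + c') = a * Tr m f c + Tr m f c';
  trace_coboundary : forall m (f : 'I_m -> S) (b : precochain n m),
    (0 < n)%N -> open_cover f -> cochain f b -> Tr m f (coboundary b) = 0;
  trace_refinement : forall m m' (tau : 'I_m' -> 'I_m) f f' c,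
    open_cover f -> open_cover f' -> refinement tau f f' -> cocycle f c ->
    Tr m' f' (pullback tau c) = Tr m f c;
  trace_residue : forall m (f : 'I_m -> S) c,
    open_cover f -> unit_point_class f c -> Tr m f c = 1
}.

(* The alternating cocycle g Omega / (F_0 ... F_n) on the cover {F_i <> 0}: the
   determinant is the sign of t if t is a permutation, and 0 otherwise. *)
Definition omega (F : 'I_n.+1 -> S) (g : S) : precochain n.+1 n.+1 :=
  [ffun t : {ffun 'I_n.+1 -> 'I_n.+1} =>
    (\det (\matrix_(i, j) (t i == j)%:R) * (g%:F / (\prod_i F i)%:F)) *: Omega].

Definition toric_residue (Tr : forall m, ('I_m -> S) -> precochain n.+1 m -> K)
    (F : 'I_n.+1 -> S) (g : S) : K := Tr n.+1 F (omega F g).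

End Cech.

(** The generic polynomials and the matrix of phi. *)

Section Generic.
Variables (n s : nat) (eta : 'M[int]_(s, n)) (alpha : 'I_n.+1 -> 'cV[int]_s).

(* [u] enumerates the pairs (i, a) with a in A_i; the k-th variable of
   {mpoly rat[N]} is u_{ia} for (i, a) = u k. *)
Definition generic (N : nat) (u : 'I_N -> 'I_n.+1 * 'X_{1..s}) (i : 'I_n.+1) :
    {mpoly {mpoly rat[N]}[s]} :=
  \sum_(k < N | (u k).1 == i) ('X_k : {mpoly rat[N]}) *: 'X_[(u k).2].

Definition critical_degree : 'cV[int]_s := \sum_i alpha i - beta0 s.

Variable A : comNzRingType.

Definition phi (F : 'I_n.+1 -> {mpoly A[s]}) (Delta : {mpoly A[s]})
    (Gc : ('I_n.+1 -> {mpoly A[s]}) * A) : {mpoly A[s]} :=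
  \sum_i Gc.1 i * F i + Gc.2 *: Delta.

(* Labels for the monomial basis of the domain of [phi]: [Some (i, b)] is the
   monomial x^b of the i-th summand, [None] is the generator (0, ..., 0, 1). *)
Definition domain_label (r : option ('I_n.+1 * 'X_{1..s})) : Prop :=
  if r is Some (i, b) then lin_equiv eta (mdiv b) (critical_degree - alpha i)
  else True.

Definition domain_basis (r : option ('I_n.+1 * 'X_{1..s})) :
    ('I_n.+1 -> {mpoly A[s]}) * A :=
  if r is Some (i, b) then (fun i' => if i' == i then 'X_[b] else 0, 0)
  else (fun=> 0, 1).

Definition phi_matrix (F : 'I_n.+1 -> {mpoly A[s]}) (Delta : {mpoly A[s]})
    (p q : nat) (rows : 'I_p -> option ('I_n.+1 * 'X_{1..s}))
    (cols : 'I_q -> 'X_{1..s}) : 'M[A]_(p, q) :=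
  \matrix_(k, l) (phi F Delta (domain_basis (rows k)))@_(cols l).

End Generic.

(* Main.v *)
(** Let V assign to each member v of a cover functions V_(v,k), k = 0, ..., n, with
    sum_k s_k V_(v,k) = 1.  Then t |-> g det(V_(t_i,k)) Omega / prod_j x_j is a
    cocycle, provided that it has no poles, and its class does not depend on the
    cover, since two covers can be merged.  The (n x n) minors of V give cochains
    whose coboundary is the same cocycle multiplied by s_k.

    With s = 1 and V_(j,k) = z_k A_kj / F_j this cocycle is Delta Omega / prod F, and
    it is compared with the cover by the toric charts, where V is a coordinate
    vector for each cone.  The toric class twisted by a nontrivial character nu has
    trace 0: along a walk in the set of flags, each step of which changes one cone of
    the flag and the sign of the trace, one reaches a flag for which a minor
    multiplied by chi^nu has no poles.  Replacing then successively the coefficients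
    s_k = 1 by s_k = 1 - chi^(m_k), for a basis m_k of characters adapted to the
    flag, leads to the class of the identity of the torus, whose trace is 1.  Hence
    the residue of Delta is 1 or -1.

    For n > 0 the residue vanishes on the ideal of the F_i, again by a coboundary of
    a minor, so that the residues of the monomials are the solution of a linear
    system with matrix M, to which Cramer's rule applies.  That the generic F_i have
    no common zero follows by counting: at a common zero the N variables u would be
    rational functions of N - 1 quantities. *)

Require Import Defs.
From HB Require Import structures.
From mathcomp Require Import all_boot all_order all_fingroup all_algebra.
From mathcomp.multinomials Require Import mpoly.
From mathcomp Require Import zify ring lra.
From Stdlib Require Import Classical_Prop.

Set Implicit Arguments.
Unset Strict Implicit.
Unset Printing Implicit Defensive.

Import Order.TTheory GRing.Theory Num.Theory.
Local Open Scope ring_scope.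

(** * Farkas' lemma *)

(** Besides linearity and invariance, the axioms of the trace prescribe a single value, so every
    other comparison must come from an explicit coboundary. The task is each time to find a twist by
    a character under which a given minor has no poles. Twists are forced by the passage from s_k =
    1 to s_k = 1 - chi^(m_k): a quotient by 1 - chi^(m_k) appears, and its geometric expansion
    contains the class twisted by many characters. Because nontrivial twists have trace 0, at most
    one term survives, and it contributes the sign -1. All cones, not only the maximal ones, serve
    as charts. A chart then has to contain only the orbit of its cone, so the zeros of a binomial 1
    - chi^mu can be removed from it and 1 - chi^mu becomes invertible. The cones need not be
    simplicial. What replaces a basis of rays is the grouping of the rays by the first cone of the
    flag that contains them: modulo the preceding cone, the rays of a group inside the last cone are
    positive multiples of one another. The walk behaves like the simplex method; strict convexity of
    an ample divisor makes it stop. *)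

Lemma farkas (F : realFieldType) n k (v : 'I_k -> 'rV[F]_n) (b : 'rV[F]_n) :
  (exists c : 'I_k -> F, (forall i, 0 <= c i) /\ b = \sum_i c i *: v i) \/
  (exists m : 'cV[F]_n, (forall i, 0 <= (v i *m m) 0 0) /\ (b *m m) 0 0 < 0).
Proof.
elim: k v b => [|k IH] v b.
  have [->|nb] := eqVneq b 0; first by left; exists (fun=> 0); rewrite big_ord0; split.
  right; exists (- b^T); split=> [[]//|].
  rewrite mulmxN mxE oppr_lt0 mxE.
  have [j nj] : exists j, b 0 j != 0.
    apply/existsP; apply: contraNT nb => /existsPn h; apply/eqP/rowP => j.
    by rewrite mxE; apply/eqP; move: (h j); rewrite negbK.
  rewrite (bigD1 j) //= mxE ltr_pwDl // -?expr2 ?exprn_even_gt0 //.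
  by apply: sumr_ge0 => i _; rewrite mxE -expr2 sqr_ge0.
have [[c [c0 cb]]|[m [m0 mb]]] := IH (fun i => v (lift ord0 i)) b.
  left; exists (fun i => if unlift ord0 i is Some i' then c i' else 0); split.
    by move=> i; case: (unlift ord0 i).
  rewrite big_ord_recl unlift_none scale0r add0r cb.
  by apply: eq_bigr => i _; rewrite liftK.
have [m1|m1] := leP 0 ((v ord0 *m m) 0 0).
  by right; exists m; split=> // i; case: (unliftP ord0 i) => [j ->|->].
set a := (v ord0 *m m) 0 0 in m1 *.
have a0 : a != 0 by rewrite lt_eqF.
have linm (x y : 'rV[F]_n) t (m' : 'cV[F]_n) :
    ((x - t *: y) *m m') 0 0 = (x *m m') 0 0 - t * (y *m m') 0 0.
  by rewrite mulmxBl -scalemxAl !mxE.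
(* Projection along [v ord0] onto the kernel of [m]. A solution of the projected problem lifts by
   adding a multiple of [v ord0]; this multiple is nonnegative since [m] is negative on [b] and
   [v ord0] and nonnegative on the other generators. *)
pose pr x : 'rV[F]_n := x - ((x *m m) 0 0 / a) *: v ord0.
have [[c [c0 cb]]|[m' [m'0 m'b]]] := IH (fun i => pr (v (lift ord0 i))) (pr b).
  left; exists (fun i => if unlift ord0 i is Some i' then c i' else
    (b *m m) 0 0 / a - \sum_i c i * ((v (lift ord0 i) *m m) 0 0 / a)); split.
    move=> i; case: (unlift ord0 i) => [j|] //.
    rewrite subr_ge0; apply: (@le_trans _ _ 0).
      apply: sumr_le0 => j _; apply: mulr_ge0_le0 => //.
      by rewrite ler_ndivrMr // mul0r.
    by rewrite ltW // ltr_ndivlMr // mul0r.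
  rewrite big_ord_recl unlift_none.
  rewrite (eq_bigr (fun i => c i *: v (lift ord0 i))); last by move=> i _; rewrite liftK.
  have E : \sum_i c i *: pr (v (lift ord0 i)) = \sum_i c i *: v (lift ord0 i) -
      (\sum_i c i * ((v (lift ord0 i) *m m) 0 0 / a)) *: v ord0.
    by rewrite scaler_suml -sumrB; apply: eq_bigr => i _; rewrite scalerBr scalerA.
  have -> : b = pr b + ((b *m m) 0 0 / a) *: v ord0 by rewrite subrK.
  rewrite {1}cb E [pr b]/pr subrK scalerBl.
  by rewrite addrC [RHS]addrAC addrA.
right; exists (m' - ((v ord0 *m m') 0 0 / a) *: m).
have lin2 (x : 'rV[F]_n) t : (x *m (m' - t *: m)) 0 0 = (x *m m') 0 0 - t * (x *m m) 0 0.
  by rewrite mulmxBr -scalemxAr !mxE.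
have key (x : 'rV[F]_n) :
    (x *m (m' - ((v ord0 *m m') 0 0 / a) *: m)) 0 0 = (pr x *m m') 0 0.
  by rewrite lin2 linm; field.
split=> [i|]; last by rewrite key.
rewrite key; case: (unliftP ord0 i) => [j ->//|->].
by rewrite /pr -/a divff // scale1r subrr mul0mx mxE.
Qed.

Lemma clear_denominators n (m : 'cV[rat]_n) :
  exists d (z : 'cV[int]_n), (0 < d)%N /\ map_mx intr z = d%:R *: m.
Proof.
pose d := (\prod_i `|denq (m i 0%R)|)%N.
have d0 : (0 < d)%N by apply: prodn_gt0 => i; rewrite absz_gt0 denq_neq0.
have h i : exists z : int, z%:~R = d%:R * m i 0 :> rat.
  rewrite /d (bigD1 i) //=; set e := (\prod_(_ | _) _)%N.
  exists (numq (m i 0) * e%:Z).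
  rewrite natrM rmorphM /= numqE -!pmulrn.
  have -> : (`|denq (m i 0%R)|%N)%:R = (denq (m i 0))%:~R :> rat.
    by rewrite -{2}[denq _]gez0_abs ?denq_ge0.
  by ring.
have [z zP] := fin_all_exists h.
by exists d, (\col_i z i); split=> //; apply/colP => i; rewrite !mxE zP.
Qed.

(** * Cones of the fan *)

Section Polyhedral.
Variables (R : realFieldType) (n s : nat) (eta : 'M[int]_(s, n)).
Variable Sigma : {set {set 'I_s}}.

Definition etaQ : 'M[rat]_(s, n) := map_mx intr eta.
Definition ev (m : 'cV[int]_n) (j : 'I_s) : int := (eta *m m) j 0.

Definition supported (A : {set 'I_s}) (c : 'rV[rat]_s) : Prop :=
  forall j, j \notin A -> c 0 j = 0.
(** Points of a cone are handled through rational coefficients on its rays; [c *m etaQ] is the point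
    itself. One point may have several coefficient vectors, since the cones need not be
    simplicial. *)
Definition conic (A : {set 'I_s}) (c : 'rV[rat]_s) : Prop :=
  (forall j, 0 <= c 0 j) /\ supported A c.
(** Its image under [etaQ], the sum of the rays of A, lies in the relative interior of the cone. *)
Definition indic (A : {set 'I_s}) : 'rV[rat]_s := \row_j (j \in A)%:R.

Local Notation ray j := (delta_mx 0 j : 'rV[rat]_s).

Lemma evD m m' j : ev (m + m') j = ev m j + ev m' j.
Proof. by rewrite /ev mulmxDr mxE. Qed.
Lemma evN m j : ev (- m) j = - ev m j.
Proof. by rewrite /ev mulmxN mxE. Qed.
Lemma evZ a m j : ev (a *: m) j = a * ev m j.
Proof. by rewrite /ev -scalemxAr mxE. Qed.
Lemma evMn m k j : ev (m *+ k) j = ev m j *+ k.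
Proof. by elim: k => [|k IH]; rewrite ?mulr0n ?mulrS ?evD ?IH // /ev mulmx0 mxE. Qed.

Lemma pairing (c : 'rV[rat]_s) m :
  (c *m etaQ *m map_mx intr m) 0 0 = \sum_j c 0 j * (ev m j)%:~R.
Proof.
rewrite -mulmxA -map_mxM mxE; apply: eq_bigr => j _.
by rewrite mxE.
Qed.

Lemma supportedD A c d : supported A c -> supported A d -> supported A (c + d).
Proof. by move=> h h' j jA; rewrite mxE h ?h' ?addr0. Qed.
Lemma supportedZ A a c : supported A c -> supported A (a *: c).
Proof. by move=> h j jA; rewrite mxE h ?mulr0. Qed.
Lemma supportedS (A B : {set 'I_s}) c : A \subset B -> supported A c -> supported B c.
Proof. by move=> sAB h j jB; apply: h; apply: contra jB; apply: subsetP. Qed.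
Lemma supported_indic A : supported A (indic A).
Proof. by move=> j jA; rewrite mxE (negbTE jA). Qed.
Lemma supported_delta (A : {set 'I_s}) j : j \in A -> supported A (ray j).
Proof. by move=> jA r rA; rewrite mxE eqxx /=; case: eqP rA => // ->; rewrite jA. Qed.
Lemma conicD A c d : conic A c -> conic A d -> conic A (c + d).
Proof.
move=> [c0 cA] [d0 dA]; split; last exact: supportedD.
by move=> j; rewrite mxE addr_ge0.
Qed.
Lemma conicZ A a c : 0 <= a -> conic A c -> conic A (a *: c).
Proof.
by move=> a0 [c0 cA]; split; [move=> j; rewrite mxE mulr_ge0|exact: supportedZ].
Qed.
Lemma conicS (A B : {set 'I_s}) c : A \subset B -> conic A c -> conic B c.
Proof. by move=> sAB [c0 cA]; split=> //; apply: supportedS cA. Qed.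
Lemma conic_indic A : conic A (indic A).
Proof. by split; [move=> j; rewrite mxE ler0n|exact: supported_indic]. Qed.
Lemma conic_delta (A : {set 'I_s}) j : j \in A -> conic A (ray j).
Proof. by split; [move=> r; rewrite mxE ler0n|exact: supported_delta]. Qed.

Lemma pairing_supported A c m : supported A c -> (forall j, j \in A -> ev m j = 0) ->
  (c *m etaQ *m map_mx intr m) 0 0 = 0.
Proof.
move=> cA mA; rewrite pairing big1 // => j _.
by have [jA|jA] := boolP (j \in A); [rewrite mA // mulr0|rewrite cA // mul0r].
Qed.

Lemma pairing_delta j m : (ray j *m etaQ *m map_mx intr m) 0 0 = (ev m j)%:~R.
Proof.
rewrite pairing (bigD1 j) //= big1 ?addr0 => [|i ij]; rewrite mxE !eqxx /= ?mul1r //.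
by rewrite (negbTE ij) mul0r.
Qed.

Lemma supported_shift A e : supported A e ->
  exists2 L : rat, 0 < L & forall L', L <= L' -> conic A (e + L' *: indic A).
Proof.
move=> eA; exists (1 + \sum_j `|e 0 j|); first by rewrite ltr_wpDr ?sumr_ge0.
move=> L' LL'; split; last by apply: supportedD => //; apply/supportedZ/supported_indic.
move=> j; rewrite !mxE; have [jA|jA] := boolP (j \in A); last first.
  by rewrite eA // mulr0 addr0.
rewrite mulr1 -lerBlDl sub0r (le_trans _ LL') // (bigD1 j) //=.
have h : 0 <= \sum_(i | i != j) `|e 0 i| by rewrite sumr_ge0.
by have := ler_norm (- e 0 j); rewrite normrN; lra.
Qed.

Definition spanmx (A : {set 'I_s}) : 'M[rat]_(s, n) :=
  \matrix_(j < s, l < n) if j \in A then (eta j l)%:~R else 0.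

Lemma spanP A (x : 'rV[rat]_n) :
  (x <= spanmx A)%MS <-> exists2 e, supported A e & x = e *m etaQ.
Proof.
split=> [/submxP[u ->]|[e eA ->]].
  exists (\row_j if j \in A then u 0 j else 0).
    by move=> j jA; rewrite mxE (negbTE jA).
  apply/rowP => l; rewrite !mxE; apply: eq_bigr => j _; rewrite !mxE.
  by case: ifP => _; rewrite ?mulr0 ?mul0r.
apply/submxP; exists e; apply/rowP => l; rewrite !mxE; apply: eq_bigr => j _.
by rewrite !mxE; case: ifPn => // jA; rewrite eA ?mul0r.
Qed.

Lemma spanmxS (A B : {set 'I_s}) : A \subset B -> (spanmx A <= spanmx B)%MS.
Proof.
move=> sAB; apply/row_subP => i; apply/spanP.
exists (if i \in A then ray i else 0).
  by case: ifP => iA j jB; rewrite mxE // eqxx /=; case: eqP jB iA => // -> /negP jB /(subsetP sAB).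
apply/rowP => l; rewrite !mxE; case: ifP => iA; last first.
  by rewrite big1 // => j _; rewrite mxE mul0r.
rewrite (bigD1 i) //= big1 ?addr0 => [|j ji]; rewrite !mxE ?eqxx ?mul1r //=.
by rewrite (negbTE ji) mul0r.
Qed.

Hypothesis hfan : is_fan eta Sigma R.
Hypothesis hcomp : complete_fan eta Sigma R.

Let ratvec (c : 'rV[rat]_s) : 'rV[R]_n := map_mx ratr (c *m etaQ).

Lemma ratvecE c : ratvec c = \sum_j ratr (c 0 j) *: map_mx intr (row j eta).
Proof.
apply/rowP => l; rewrite !mxE rmorph_sum summxE; apply: eq_bigr => j _ /=.
by rewrite !mxE rmorphM /= ratr_int.
Qed.

Lemma conic_in_cone A c : conic A c -> in_cone eta A (ratvec c).
Proof.
move=> [c0 cA]; exists (fun j => ratr (c 0 j)); split.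
  by move=> j _; rewrite ler0q.
rewrite ratvecE [RHS]big_mkcond /=; apply: eq_bigr => j _.
by case: ifPn => // jA; rewrite cA // rmorph0 scale0r.
Qed.

Lemma in_cone_pairing (A : {set 'I_s}) (v : 'rV[R]_n) (m : 'cV[int]_n) : in_cone eta A v ->
  exists2 c : 'I_s -> R, (forall j, j \in A -> 0 <= c j) &
    (v *m map_mx intr m) 0 0 = \sum_(j in A) c j * (ev m j)%:~R.
Proof.
move=> [c [c0 ->]]; exists c => //.
rewrite mulmx_suml summxE; apply: eq_bigr => j _.
rewrite -scalemxAl mxE -map_mxM mxE; congr (_ * _%:~R).
by rewrite -row_mul mxE.
Qed.

Lemma face_functional A C : A \in Sigma -> C \in Sigma -> exists2 m : 'cV[int]_n,
  (forall j, j \in A -> 0 <= ev m j) & (forall j, j \in A -> (ev m j == 0) = (j \in C)).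
Proof.
move=> hA hC; have [[m [m0 mE]] _ _] := fan_inter hfan hA hC.
exists m => // j jA; have := congr1 (fun B : {set 'I_s} => j \in B) mE.
by rewrite !inE jA /= => ->.
Qed.

(** By [fan_inter] a common point lies in the cone of [A :&: C], so the functional that cuts out
    this face of A vanishes there. Its value is a sum of nonnegative terms, hence each ray with
    positive coefficient belongs to the face. *)
Lemma cone_meet A C c d : A \in Sigma -> C \in Sigma -> conic A c -> conic C d ->
  c *m etaQ = d *m etaQ -> forall j, 0 < c 0 j -> j \in C.
Proof.
move=> hA hC hc hd cd j cj.
have [_ _ /(_ (ratvec c) (conic_in_cone hc))] := fan_inter hfan hA hC.
have -> : ratvec c = ratvec d by rewrite /ratvec cd.
move=> /(_ (conic_in_cone hd)) hAC.
have [m m0 mE] := face_functional hA hC.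
have [c' _] := in_cone_pairing m hAC.
rewrite [in RHS]big1 => [|i /setIP[iA iC]]; last first.
  by move/eqP: (mE i iA); rewrite iC => /eqP/eqP ->; rewrite mulr0.
have -> : ratvec d = ratvec c by rewrite /ratvec cd.
have [c0 cA] := hc.
have jA : j \in A by apply: contraTT cj => jA; rewrite cA // ltxx.
rewrite ratvecE mulmx_suml summxE.
under eq_bigr => i _.
  rewrite -scalemxAl mxE -map_mxM mxE.
  have -> : (row i eta *m m) 0 0 = ev m i by rewrite -row_mul mxE.
  over.
move=> h0; have pos i : 0 <= ratr (c 0 i) * (ev m i)%:~R :> R.
  have [iA|iA] := boolP (i \in A); last by rewrite cA // rmorph0 mul0r.
  by rewrite mulr_ge0 ?ler0q ?ler0z ?m0.
move/psumr_eq0P: h0 => /(_ (fun i _ => pos i)) /(_ j isT) /eqP.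
rewrite mulf_eq0 fmorph_eq0 gt_eqF //= intr_eq0 mE //.
Qed.

(** [cone_meet] modulo the span of a common part E: a large multiple of [indic E], added on both
    sides, makes all coefficients nonnegative. *)
Lemma cone_meet_mod (A C E : {set 'I_s}) j e d : A \in Sigma -> C \in Sigma -> E \subset A -> E \subset C ->
  j \in A -> supported E e -> conic C d -> row j etaQ = (e + d) *m etaQ ->
  j \in C /\ forall r, 0 < d 0 r -> r \in A.
Proof.
move=> hA hC EA EC jA eE hd rowj.
have [L L0 /(_ L (lexx _)) hL] := supported_shift eE.
have hcA : conic A (ray j + L *: indic E).
  by apply/conicD/conicZ/(conicS EA)/conic_indic; [exact: conic_delta|exact: ltW].
have hdC : conic C (d + (e + L *: indic E)) by apply/conicD/(conicS EC).
have eq1 : (ray j + L *: indic E) *m etaQ = (d + (e + L *: indic E)) *m etaQ.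
  by rewrite mulmxDl -rowE rowj addrA [d + e]addrC [in RHS]mulmxDl.
split.
  apply: (cone_meet hA hC hcA hdC eq1); rewrite !mxE !eqxx /=.
  by case: (j \in E); rewrite /= ?mulr1 ?mulr0; lra.
move=> r dr; apply: (cone_meet hC hA hdC hcA (esym eq1)).
by have [h _] := hL; move: (h r); rewrite !mxE; lra.
Qed.

(** Completeness is assumed over R, whereas rational coefficients are wanted. If there were none,
    Farkas' lemma over the rationals would give an integral functional, which separates v from the
    cone over R as well. *)
Lemma complete_conic (v : 'rV[rat]_n) : exists2 A, A \in Sigma &
  exists2 c, conic A c & v = c *m etaQ.
Proof.
have [A hA hv] := hcomp (map_mx ratr v); exists A => //.
have [[c [c0 cv]]|[m [m0 mv]]] := farkas (fun i => if i \in A then row i etaQ else 0) v.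
  exists (\row_i if i \in A then c i else 0).
    by split=> i; rewrite mxE; case: ifP.
  rewrite cv; apply/rowP => l; rewrite mxE summxE; apply: eq_bigr => i _; rewrite !mxE.
  by case: ifP => _; rewrite !mxE ?mulr0 ?mul0r.
have [d [z [d0 zE]]] := clear_denominators m.
have [c c0] := in_cone_pairing z hv.
have -> : map_mx ratr v *m map_mx intr z = map_mx ratr (v *m map_mx intr z) :> 'M[R]_1.
  rewrite [RHS]map_mxM; congr (_ *m _). apply/colP => i; rewrite !mxE /=.
  by symmetry; apply: ratr_int.
rewrite mxE zE -scalemxAr mxE => h.
have : 0 <= \sum_(j in A) c j * (ev z j)%:~R :> R.
  apply: sumr_ge0 => j jA; rewrite mulr_ge0 ?c0 // ler0z -(ler0z rat) -pairing_delta zE.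
  by rewrite -rowE -scalemxAr mxE mulr_ge0 ?ler0n //; move: (m0 j); rewrite jA.
by rewrite -h ler0q pmulr_rge0 ?ltr0n // leNgt mv.
Qed.

(** Cones are closed: one that misses the interior point of E misses a short segment starting there.
    A cone that meets the segment close enough to its origin therefore contains the origin, and then
    E by [cone_meet]. *)
Lemma cone_near (E : {set 'I_s}) (w : 'rV[rat]_n) : E \in Sigma ->
  exists B, [/\ B \in Sigma, E \subset B & exists2 eps, 0 < eps &
    exists2 c, conic B c & indic E *m etaQ + eps *: w = c *m etaQ].
Proof.
move=> hE; set p := indic E *m etaQ.
have hA (A : {set 'I_s}) : exists eps : rat, 0 < eps /\
    ((exists2 c, conic A c & p = c *m etaQ) \/
     (forall t, 0 < t -> t <= eps -> ~ exists2 c, conic A c & p + t *: w = c *m etaQ)).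
  have [[c [c0 cv]]|[m [m0 mv]]] := farkas (fun i => if i \in A then row i etaQ else 0) p.
    exists 1; split=> //; left; exists (\row_i if i \in A then c i else 0).
      by split=> i; rewrite mxE; case: ifP.
    rewrite cv; apply/rowP => l; rewrite mxE summxE; apply: eq_bigr => i _; rewrite !mxE.
    by case: ifP => _; rewrite !mxE ?mulr0 ?mul0r.
  set a := (p *m m) 0 0 in mv; set b := (w *m m) 0 0.
  exists (- a / (1 + `|b|) / 2%:R); split.
    by rewrite !divr_gt0 ?oppr_gt0 // ltr_wpDr.
  right=> t t0 te [c [c0 cA] cE].
  have : 0 <= (c *m etaQ *m m) 0 0.
    rewrite -mulmxA mxE; apply: sumr_ge0 => j _.
    have [jA|jA] := boolP (j \in A); last by rewrite cA ?mul0r.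
    by rewrite mulr_ge0 //; move: (m0 j); rewrite jA -row_mul mxE.
  rewrite -cE mulmxDl -scalemxAl mxE [X in _ + X]mxE -/a -/b.
  have b1 : 0 < 1 + `|b| by rewrite ltr_wpDr.
  move: te; rewrite -mulrA -invfM ler_pdivlMr ?mulr_gt0 //.
  have := ler_norm b; nra.
have [eps epsP] := fin_all_exists hA.
(* At most every [eps A], because its inverse dominates each [(eps A)^-1]. *)
pose t := (1 + \sum_A (eps A)^-1)^-1.
have S0 (P : pred {set 'I_s}) : 0 <= \sum_(A | P A) (eps A)^-1.
  by apply: sumr_ge0 => A _; rewrite invr_ge0 ltW // (epsP A).1.
have t0 : 0 < t by rewrite invr_gt0 ltr_pwDl.
have te A : t <= eps A.
  rewrite -[eps A]invrK lef_pV2 ?posrE ?invr_gt0 ?(epsP A).1 ?ltr_pwDl //.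
  by rewrite (bigD1 A) //= addrCA lerDl addr_ge0 // S0.
have [B hB [c hc cE]] := complete_conic (p + t *: w).
exists B; split=> //; last by exists t => //; exists c.
case: (epsP B).2 => [[d hd dE]|/(_ t t0 (te B))]; last by case; exists c.
apply/subsetP => j jE; apply: (cone_meet hE hB (conic_indic E) hd dE).
by rewrite mxE jE ltr01.
Qed.

End Polyhedral.

Lemma exists_min_card (T : finType) (P : {set T} -> Prop) : (exists A, P A) ->
  exists2 A, P A & forall B, P B -> (#|A| <= #|B|)%N.
Proof.
move=> [A0 PA0].
have [k Ak] : exists k, (#|A0| <= k)%N by exists #|A0|.
elim: k A0 PA0 Ak => [|k IH] A PA Ak.
  by exists A => // B _; apply: leq_trans Ak _.
have [[B [PB BA]]|nB] := classic (exists B, P B /\ (#|B| < #|A|)%N).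
  by apply: (IH B PB); rewrite -ltnS (leq_trans BA).
exists A => // B PB; rewrite leqNgt; apply/negP => BA.
by apply: nB; exists B.
Qed.

(** * Pairs of consecutive cones and the star of a cone *)

Section FanGeometry.
Variables (R : realFieldType) (n s : nat) (eta : 'M[int]_(s, n)).
Variable Sigma : {set {set 'I_s}}.
Hypothesis hfan : is_fan eta Sigma R.
Hypothesis hcomp : complete_fan eta Sigma R.

Local Notation ray j := (delta_mx 0 j : 'rV[rat]_s).
Local Notation etaQ := (etaQ eta).
Local Notation ev := (ev eta).
Local Notation spanmx := (spanmx eta).
Local Notation cdim := (cone_dim eta).

Lemma cone_dimE A : cdim A = \rank (spanmx A). Proof. by []. Qed.

Lemma row_spanmx (A : {set 'I_s}) j : j \in A -> (row j etaQ <= spanmx A)%MS.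
Proof.
by move=> jA; apply/spanP; exists (ray j); [exact: supported_delta|rewrite -rowE].
Qed.

Lemma pairing_row j m : (row j etaQ *m map_mx intr m) 0 0 = (ev m j)%:~R.
Proof. by rewrite -pairing_delta -rowE. Qed.

Lemma pairingDZ c (x y : 'rV[rat]_n) (m : 'cV[int]_n) :
  ((c *: x + y) *m map_mx intr m) 0 0 = c * (x *m map_mx intr m) 0 0 + (y *m map_mx intr m) 0 0.
Proof. by rewrite mulmxDl -scalemxAl [LHS]mxE [X in X + _]mxE. Qed.

Lemma pairing_span (A : {set 'I_s}) (x : 'rV[rat]_n) m : (x <= spanmx A)%MS ->
  (forall j, j \in A -> ev m j = 0) -> (x *m map_mx intr m) 0 0 = 0.
Proof. by move=> /spanP[e eA ->] mA; apply: pairing_supported eA mA. Qed.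

Lemma row_notin_span (A : {set 'I_s}) m j : (forall j, j \in A -> ev m j = 0) -> ev m j != 0 ->
  ~~ (row j etaQ <= spanmx A)%MS.
Proof.
move=> mA mj; apply: contra mj => /pairing_span/(_ mA)/eqP.
by rewrite pairing_row intr_eq0.
Qed.

Lemma full_functional0 (A : {set 'I_s}) m : cdim A = n -> (forall j, j \in A -> ev m j = 0) -> m = 0.
Proof.
move=> dA mA; have : row_full (spanmx A) by rewrite /row_full -cone_dimE dA.
move=> /row_fullP[B BA]; have h : spanmx A *m map_mx intr m = 0 :> 'cV[rat]_s.
  apply/row_matrixP => i; rewrite row_mul row0.
  apply/rowP => k; rewrite (ord1 k) (pairing_span (row_sub _ _) mA) mxE //.
have : map_mx intr m = 0 :> 'cV[rat]_n by rewrite -[LHS]mul1mx -BA -mulmxA h mulmx0.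
by move/colP => h'; apply/colP => i; move: (h' i); rewrite !mxE => /eqP; rewrite intr_eq0 => /eqP.
Qed.

Section Pair.
Variables E C : {set 'I_s}.
Hypotheses (hE : E \in Sigma) (hC : C \in Sigma) (EC : E \subset C).
Hypothesis dEC : cdim C = (cdim E).+1.

Lemma pair_functional : exists2 m : 'cV[int]_n,
  (forall j, j \in C -> 0 <= ev m j) & (forall j, j \in C -> (ev m j == 0) = (j \in E)).
Proof. exact: (face_functional hfan hC hE). Qed.

Lemma pair_nonempty : exists2 r, r \in C & r \notin E.
Proof.
case/boolP: [exists r, (r \in C) && (r \notin E)]; first by case/existsP=> r /andP[? ?]; exists r.
move/existsPn => h; suff CE : C \subset E.
  by have := mxrankS (spanmxS eta CE); rewrite -!cone_dimE dEC ltnn.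
by apply/subsetP => r rC; move: (h r); rewrite rC negbK.
Qed.

Lemma span_step r' (x : 'rV[rat]_n) : r' \in C -> r' \notin E -> (x <= spanmx C)%MS ->
  exists c e, supported E e /\ x = c *: row r' etaQ + e *m etaQ.
Proof.
move=> r'C r'E xC; have [m m0 mE] := pair_functional.
have nr : ~~ (row r' etaQ <= spanmx E)%MS.
  apply: (@row_notin_span E m); last by rewrite mE.
  by move=> j jE; apply/eqP; rewrite mE // (subsetP EC).
have sub : (spanmx E + row r' etaQ <= spanmx C)%MS.
  by rewrite addsmx_sub spanmxS ?row_spanmx.
have lt : (spanmx E < spanmx E + row r' etaQ)%MS.
  by rewrite ltmxE addsmxSl /=; apply: contra nr; apply: submx_trans; exact: addsmxSr.
have rk : \rank (spanmx E + row r' etaQ)%MS = \rank (spanmx C).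
  apply/eqP; rewrite eqn_leq mxrankS //= -[\rank (spanmx C)]cone_dimE dEC.
  by move: lt; rewrite ltmxErank => /andP[].
have sub2 : (spanmx C <= spanmx E + row r' etaQ)%MS.
  by rewrite -(mxrank_leqif_sup sub) rk.
have /sub_addsmxP[[u v] /= ->] := submx_trans xC sub2.
have /spanP[e eE ->] : (u *m spanmx E <= spanmx E)%MS by rewrite submxMl.
exists (v 0 0), e; split=> //; rewrite addrC; congr (_ + _).
by rewrite [v]mx11_scalar mul_scalar_mx mxE eqxx.
Qed.

(** Modulo the span of E, the cone C is a half-line. The sign of the coefficient is read off from
    the functional that cuts out E in C. *)
Lemma row_step r r' : r' \in C -> r' \notin E -> r \in C -> r \notin E ->
  exists c e, [/\ 0 < c, supported E e & row r etaQ = c *: row r' etaQ + e *m etaQ].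
Proof.
move=> r'C r'E rC rE; have [c [e [eE rc]]] := span_step r'C r'E (row_spanmx rC).
have [m m0 mE] := pair_functional.
have pos i : i \in C -> i \notin E -> 0 < ev m i.
  by move=> iC iE; rewrite lt_neqAle m0 // eq_sym mE // iE.
exists c, e; split=> //; have := congr1 (fun x : 'rV_n => (x *m map_mx intr m) 0 0) rc.
rewrite pairingDZ !pairing_row.
rewrite [X in _ + X](pairing_supported eE) ?addr0.
  move=> h; have : 0 < c * (ev m r')%:~R by rewrite -h ltr0z pos.
  by rewrite pmulr_lgt0 // ltr0z pos.
by move=> j jE; apply/eqP; rewrite mE // (subsetP EC).
Qed.

Lemma pair_sign m r r' : (forall j, j \in E -> ev m j = 0) -> r' \in C -> r' \notin E ->
  r \in C -> r \notin E ->
  exists2 c : rat, 0 < c & (ev m r)%:~R = c * (ev m r')%:~R.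
Proof.
move=> mE r'C r'E rC rE; have [c [e [c0 eE rc]]] := row_step r'C r'E rC rE.
exists c => //; have := congr1 (fun x : 'rV_n => (x *m map_mx intr m) 0 0) rc.
rewrite pairingDZ !pairing_row.
by rewrite [X in _ + X](pairing_supported eE) ?addr0.
Qed.

(** Modulo E, the ray j is a positive multiple of any ray r of C outside E. This writes a point of A
    with a positive coefficient on r, and [cone_meet_mod] puts r in A. *)
Lemma cone_contains (A : {set 'I_s}) j : A \in Sigma -> E \subset A -> j \in A -> j \in C -> j \notin E ->
  C \subset A.
Proof.
move=> hA EA jA jC jE; apply/subsetP => r rC.
have [rE|rE] := boolP (r \in E); first exact: (subsetP EA).
have [c [e [c0 eE rc]]] := row_step rC rE jC jE.
have eqj : row j etaQ = (e + c *: ray r) *m etaQ.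
  by rewrite rc addrC mulmxDl -scalemxAl -rowE.
have [_ /(_ r)] := cone_meet_mod hfan hA hC EA EC jA eE (conicZ (ltW c0) (conic_delta rC)) eqj.
by rewrite !mxE !eqxx mulr1 => ->.
Qed.

(** B is a smallest cone around E containing the direction opposite to C modulo the span of E, and
    [mu] cuts out E in B. Modulo this span, the line through C meets the relative interior of E, C
    and B only; any other cone around E is separated from the line by a functional. *)
Lemma opposite : exists B mu, [/\ B \in Sigma, E \subset B, B != E,
  (forall j, j \in B -> 0 <= ev mu j) &
  (forall j, j \in B -> (ev mu j == 0) = (j \in E))] /\
  (forall j, j \in C -> j \notin E -> ev mu j < 0) /\
  (forall A, A \in Sigma -> E \subset A -> A != E -> A != C -> A != B ->
   exists m, [/\ (forall j, j \in C -> ev m j = 0), (forall j, j \in A -> 0 <= ev m j) &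
     exists2 j, j \in A & 0 < ev m j]).
Proof.
have [w wC wE] := pair_nonempty.
pose P (B : {set 'I_s}) := [/\ B \in Sigma, E \subset B & exists (L : rat) c, conic B c /\
  (L *: indic E - ray w) *m etaQ = c *m etaQ].
have exP : exists B, P B.
  have [B [hB EB [eps eps0 [c hc cE]]]] := cone_near hfan hcomp (- row w etaQ) hE.
  exists B; split=> //; exists eps^-1, (eps^-1 *: c); split.
    by apply: conicZ hc; rewrite invr_ge0 ltW.
  rewrite -scalemxAl -cE scalerDr scalerA mulVf ?gt_eqF // scale1r.
  by rewrite mulmxBl -rowE scalemxAl.
have [B [hB EB [L [c [hc cE]]]] Bmin] := exists_min_card exP.
have [mu mu0 muE] := face_functional hfan hB hE.
have muE0 j : j \in E -> ev mu j = 0.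
  by move=> jE; apply/eqP; rewrite muE // (subsetP EB).
have [m m0 mE] := pair_functional.
have mE0 j : j \in E -> ev m j = 0.
  by move=> jE; apply/eqP; rewrite mE // (subsetP EC).
have mw : 0 < ev m w by rewrite lt_neqAle m0 // eq_sym mE // wE.
have pairB m' : (forall j, j \in E -> ev m' j = 0) ->
    ((c *m etaQ) *m map_mx intr m') 0 0 = - (ev m' w)%:~R.
  move=> h; rewrite -cE !mulmxBl mxE [X in _ + X]mxE pairing_delta.
  by rewrite (pairing_supported (supportedZ _ (@supported_indic _ _)) h) add0r.
have sum_ge0 : 0 <= ((c *m etaQ) *m map_mx intr mu) 0 0.
  have [c0 cB] := hc; rewrite pairing; apply: sumr_ge0 => j _.
  have [jB|jB] := boolP (j \in B); last by rewrite cB ?mul0r.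
  by rewrite mulr_ge0 ?ler0z ?mu0.
have muw : ev mu w < 0.
  rewrite lt_neqAle -oppr_ge0 -(ler0z rat) rmorphN -pairB // sum_ge0 andbT.
  apply/eqP => muw; have [c0 cB] := hc.
  have := pairB _ muE0; rewrite muw oppr0 pairing => /psumr_eq0P h.
  have cE' j : j \notin E -> c 0 j = 0.
    move=> jE; have [jB|/cB//] := boolP (j \in B).
    have /h/(_ j isT)/eqP : forall i, true -> 0 <= c 0 i * (ev mu i)%:~R.
      move=> i _; have [iB|/cB->] := boolP (i \in B); last by rewrite mul0r.
      by rewrite mulr_ge0 ?ler0z ?mu0.
    by rewrite mulf_eq0 intr_eq0 muE // (negbTE jE) orbF => /eqP.
  have := pairB _ mE0; rewrite (pairing_supported cE' mE0) => /eqP.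
  by rewrite eq_sym oppr_eq0 intr_eq0 gt_eqF.
exists B, mu; split; last split.
- split=> //.
    apply/eqP => BE; move: (pairB _ muE0); rewrite (pairing_supported (A := E)) //.
      by move/eqP; rewrite eq_sym oppr_eq0 intr_eq0 lt_eqF.
    by rewrite -BE; have [] := hc.
- move=> j jC jE; have [t t0 tE] := pair_sign muE0 wC wE jC jE.
  by rewrite -(ltrz0 rat) tE pmulr_rlt0 // ltrz0.
move=> A hA EA nAE nAC nAB.
(* Generators of the cone of A plus the span of C: the rays of A, those of C, and the negatives of
   the latter. By Farkas' lemma either minus the interior point of A is in this sum, or the wanted
   functional exists. *)
pose v := fun x : 'I_s + 'I_s => match x with
  | inl j => if j \in A then row j etaQ else 0
  | inr j => if j \in C then row j etaQ else 0 end.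
pose G := fun x : ('I_s + 'I_s) + 'I_s => match x with inl y => v y
  | inr j => - v (inr j) end.
have [[g [g0 gE]]|[m' [m'0 m'A]]] := farkas (fun i : 'I_#|{: ('I_s + 'I_s) + 'I_s}| => G (enum_val i)) (- (indic A *m etaQ)).
  exfalso.
  pose a : 'rV[rat]_s := \row_j (if j \in A then 1 + g (enum_rank (inl (inl j))) else 0).
  pose b : 'rV[rat]_s := \row_j (if j \in C then
    g (enum_rank (inr j)) - g (enum_rank (inl (inr j))) else 0).
  have ha : conic A a.
    by split=> j; rewrite mxE; case: ifP => // _; rewrite addr_ge0.
  have hb : supported C b by move=> j jC; rewrite mxE (negbTE jC).
  have ab : a *m etaQ = b *m etaQ.
    have gE' : - (indic A *m etaQ) = \sum_x g (enum_rank x) *: G x.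
      by rewrite gE (reindex enum_rank) /=; [apply: eq_bigr => x _; rewrite enum_rankK|exact: onW_bij (enum_rank_bij _)].
    have rowsum (x : 'rV[rat]_s) : x *m etaQ = \sum_j x 0 j *: row j etaQ.
      by rewrite mulmx_sum_row.
    move: gE'; rewrite big_sumType /= big_sumType /= => gE'.
    apply/eqP; rewrite -subr_eq0; apply/eqP.
    have <- : indic A *m etaQ + - (indic A *m etaQ) = 0 by rewrite subrr.
    rewrite gE' !rowsum -sumrB -!big_split /=; apply: eq_bigr => j _; rewrite !mxE.
    by case: (j \in A); case: (j \in C); apply/rowP => l; rewrite !mxE /=; ring.
  (* An interior point of A lies in the span of C; modulo E it is [t] times the ray w. For t >= 0
     this forces A to be E or C. For t < 0, A contains the opposite direction, so that A is
     contained in B and equal to it by minimality. *)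
  have /(span_step wC wE)[t [e [eE be]]] : (b *m etaQ <= spanmx C)%MS by apply/spanP; exists b.
  have apos j : j \in A -> 0 < a 0 j by move=> jA; rewrite mxE jA ltr_pwDl.
  have [t0|t0] := leP 0 t.
    have [L1 L10 /(_ L1 (lexx _)) hL] := supported_shift eE.
    have hc1 : conic A (a + L1 *: indic E).
      by apply: conicD => //; apply/conicZ/(conicS EA)/conic_indic; exact: ltW.
    have hd1 : conic C (t *: ray w + (e + L1 *: indic E)).
      by apply: conicD; [apply/conicZ/conic_delta|exact: conicS hL].
    have AC : A \subset C.
      apply/subsetP => j jA; apply: (cone_meet hfan hA hC hc1 hd1).
        by rewrite !mulmxDl ab be -!scalemxAl -rowE addrA.
      have [h _] := conicZ (ltW L10) (conic_indic E); move: (apos j jA) (h j).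
      by rewrite [(a + _) 0 j]mxE; lra.
    case/boolP: (A \subset E) => [AE|/subsetPn[j jA jE]].
      by case/negP: nAE; rewrite eqEsubset AE EA.
    case/negP: nAC; rewrite eqEsubset AC.
    exact: (cone_contains hA EA jA (subsetP AC _ jA) jE).
  pose T := (- t)^-1; have T0 : 0 < T by rewrite invr_gt0 oppr_gt0.
  have Tt : T * t = -1 by rewrite /T invrN mulNr mulVf // lt_eqF.
  have eq1 : T *: a *m etaQ = - row w etaQ + (T *: e) *m etaQ.
    by rewrite -scalemxAl ab be scalerDr scalerA Tt scaleN1r scalemxAl.
  have heA : supported E (- (T *: e)).
    by move=> j jE; rewrite !mxE eE // mulr0 oppr0.
  have heB : supported E (T *: e) by exact: supportedZ.
  have [La La0 hLa] := supported_shift heA.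
  have [Lb Lb0 hLb] := supported_shift heB.
  have AB : A \subset B.
    pose L2 := Lb + `|L|.
    have L20 : 0 <= L2 by rewrite addr_ge0 // ltW.
    apply/subsetP => j jA; apply: (cone_meet hfan hA hB (c := T *: a + L2 *: indic E)
      (d := c + (T *: e + (L2 - L) *: indic E))).
    - apply: conicD; first by apply: conicZ => //; exact: ltW.
      by apply/conicZ/(conicS EA)/conic_indic.
    - apply: conicD => //; apply: (conicS EB); apply: hLb.
      by rewrite /L2 -addrA lerDl subr_ge0 ler_norm.
    - rewrite !mulmxDl -cE mulmxBl -rowE eq1 -!scalemxAl scalerBl.
      move: (row w etaQ) (e *m etaQ) (indic E *m etaQ) => x y z.
      by apply/rowP => l; rewrite !mxE; ring.
    - have [h _] := conicZ L20 (conic_indic E); move: (mulr_gt0 T0 (apos j jA)) (h j).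
      by rewrite [(_ + _ : 'rV_s) 0 j]mxE [(T *: a) 0 j]mxE; lra.
  have PA : P A.
    split=> //; exists La, (T *: a + (- (T *: e) + La *: indic E)); split.
      by apply: conicD; [apply: conicZ => //; exact: ltW|apply: (conicS EA); exact: hLa].
    rewrite mulmxBl -rowE !mulmxDl eq1 mulNmx -!scalemxAl.
    move: (row w etaQ) (e *m etaQ) (indic E *m etaQ) => x y z.
    by apply/rowP => l; rewrite !mxE; ring.
  by case/negP: nAB; rewrite eqEcard AB Bmin.
have [d [z [d0 zE]]] := clear_denominators m'.
have evz i : (ev z i)%:~R = d%:R * (row i etaQ *m m') 0 0.
  by rewrite -pairing_row zE -scalemxAr mxE.
have m'j (x : ('I_s + 'I_s) + 'I_s) : 0 <= (G x *m m') 0 0.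
  by have := m'0 (enum_rank x); rewrite enum_rankK.
have zA j : j \in A -> 0 <= ev z j.
  move=> jA; rewrite -(ler0z rat) evz mulr_ge0 ?ler0n //.
  by have := m'j (inl (inl j)); rewrite /= jA.
exists z; split=> // [j jC|].
  apply/eqP; rewrite -(intr_eq0 rat) evz mulf_eq0; apply/orP; right.
  have := m'j (inl (inr j)); have := m'j (inr j); rewrite /= jC mulNmx mxE oppr_ge0 => h1 h2.
  by rewrite eq_le h1 h2.
case/boolP: [exists j, (j \in A) && (0 < ev z j)]; first by case/existsP=> j /andP[? ?]; exists j.
move=> /existsPn h; exfalso.
have zA0 j : j \in A -> ev z j = 0.
  by move=> jA; move: (h j); rewrite jA /= -leNgt => h1; apply/eqP; rewrite eq_le h1 zA.
have := pairing_supported (@supported_indic _ A) zA0.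
rewrite zE -scalemxAr mxE => /eqP; rewrite mulf_eq0 pnatr_eq0 -leqn0 leqNgt d0 /=.
by move: m'A; rewrite mulNmx mxE oppr_lt0 => /lt_eqF; rewrite eq_sym => ->.
Qed.

End Pair.

End FanGeometry.

(** * Walls, intermediate cones, and monomials attached to cones *)

Section FanGeometry2.
Variables (R : realFieldType) (n s : nat) (eta : 'M[int]_(s, n)).
Variable Sigma : {set {set 'I_s}}.
Hypothesis hfan : is_fan eta Sigma R.
Hypothesis hcomp : complete_fan eta Sigma R.

Local Notation ray j := (delta_mx 0 j : 'rV[rat]_s).
Local Notation etaQ := (etaQ eta).
Local Notation ev := (ev eta).
Local Notation spanmx := (spanmx eta).
Local Notation cdim := (cone_dim eta).

Lemma proper_dim (E B : {set 'I_s}) : E \in Sigma -> B \in Sigma -> E \subset B -> B != E ->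
  (cdim E < cdim B)%N.
Proof.
move=> hE hB EB nBE; have [m m0 mE] := face_functional hfan hB hE.
have /subsetPn[r rB rE] : ~~ (B \subset E) by apply: contra nBE; rewrite eqEsubset EB andbT.
have lt : (spanmx E < spanmx B)%MS.
  rewrite ltmxE spanmxS //=; apply: contraNN rE => BE.
  rewrite -mE //; apply: contraTT (submx_trans (row_spanmx eta rB) BE) => mr.
  apply: row_notin_span mr => j jE.
  by apply/eqP; rewrite mE // (subsetP EB).
by move: lt; rewrite ltmxErank => /andP[].
Qed.

Lemma cdim_le A : (cdim A <= n)%N.
Proof. by rewrite cone_dimE rank_leq_col. Qed.

Lemma full_cone_maximal (C A : {set 'I_s}) : C \in Sigma -> A \in Sigma -> cdim C = n ->
  C \subset A -> A = C.
Proof.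
move=> hC hA dC CA; apply/eqP/negPn/negP => nAC.
by have := leq_trans (proper_dim hC hA CA nAC) (cdim_le A); rewrite dC ltnn.
Qed.

(** A cone around A with the largest number of rays: if its span were not everything, a displacement
    out of the span would lead to a larger cone by [cone_near]. *)
Lemma exists_full_cone A : A \in Sigma -> exists B, [/\ B \in Sigma, A \subset B & cdim B = n].
Proof.
move=> hA; pose P (B : {set 'I_s}) := (B \in Sigma) && (A \subset B).
have PA : P A by rewrite /P hA /=.
case: (arg_maxnP (fun B : {set 'I_s} => #|B|) PA) => B /andP[hB AB] Bmax.
exists B; split=> //; apply/eqP; rewrite eqn_leq cdim_le /=.
rewrite leqNgt; apply/negP => dB.
have /row_subPn[i niB] : ~~ ((1%:M : 'M[rat]_n) <= spanmx B)%MS.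
  by rewrite sub1mx /row_full -cone_dimE neq_ltn dB.
have [B' [hB' BB' [eps eps0 [c hc cE]]]] := cone_near hfan hcomp (row i 1%:M) hB.
have BB'E : B' = B.
  apply/eqP; rewrite eq_sym eqEcard BB' /=; apply: Bmax.
  by rewrite /P hB' (subset_trans AB).
case/negP: niB; rewrite BB'E in hc.
have -> : row i 1%:M = (eps^-1 *: (c - indic B)) *m etaQ.
  rewrite -scalemxAl mulmxBl -cE addrAC subrr add0r scalerA mulVf ?scale1r //.
  by rewrite gt_eqF.
apply/spanP; eexists; last by [].
apply: supportedZ; have [_ cB] := hc => j jB.
by rewrite !mxE cB // (negbTE jB) subrr.
Qed.

Section Pair.
Variables E C : {set 'I_s}.
Hypotheses (hE : E \in Sigma) (hC : C \in Sigma) (EC : E \subset C).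
Hypothesis dEC : cdim C = (cdim E).+1.

(** Since C has full dimension, the quotient by the span of E is a line, and the cone of [opposite]
    is its other half. A ray of A is a multiple c of a ray of C modulo E: for c < 0 it lies in the
    opposite cone, for c > 0 in C and then in E by the assumption on A, for c = 0 in E. *)
Lemma wall : cdim C = n -> exists C', [/\ C' \in Sigma, E \subset C', cdim C' = n,
  (forall j, j \in C' -> j \in C -> j \in E) &
  (forall A, A \in Sigma -> E \subset A -> (forall j, j \in A -> j \in C -> j \in E) ->
    forall j, j \in A -> j \in C')] /\
  (forall m j j', (forall i, i \in E -> ev m i = 0) -> j \in C -> j \notin E ->
    j' \in C' -> j' \notin E -> ev m j < 0 -> 0 < ev m j').
Proof.
move=> dC; have [B [mu [[hB EB nBE mu0 muE] [muC _]]]] := opposite hfan hcomp hE hC EC dEC.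
have muE0 j : j \in E -> ev mu j = 0 by move=> jE; apply/eqP; rewrite muE // (subsetP EB).
have fullC (x : 'rV[rat]_n) : (x <= spanmx C)%MS.
  by apply: submx_full; rewrite /row_full -cone_dimE dC.
have neg r j : r \in C -> r \notin E -> j \in B -> j \notin E ->
    exists c e, [/\ c < 0, supported E e & row j etaQ = c *: row r etaQ + e *m etaQ].
  move=> rC rE jB jE; have [c [e [eE rc]]] := span_step hfan hE hC EC dEC rC rE (fullC (row j etaQ)).
  exists c, e; split=> //.
  have := congr1 (fun x : 'rV_n => (x *m map_mx intr mu) 0 0) rc.
  rewrite pairingDZ !pairing_row [X in _ + X](pairing_supported eE) // addr0 => h.
  have : 0 < c * (ev mu r)%:~R by rewrite -h ltr0z lt_neqAle mu0 // eq_sym muE // jE.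
  by rewrite nmulr_lgt0 // ltrz0 muC.
have [r rC rE] := pair_nonempty dEC.
have disj j : j \in B -> j \in C -> j \in E.
  move=> jB jC; apply/negPn/negP => jE.
  by have := muC _ jC jE; rewrite ltNge mu0.
exists B; split; first split=> //.
- apply/eqP; rewrite eqn_leq cdim_le /=; apply: leq_trans (proper_dim hE hB EB nBE).
  by rewrite -dEC dC.
- move=> A hA EA AC j jA; have [jE|jE] := boolP (j \in E); first exact: (subsetP EB).
  have [c [e [eE rc]]] := span_step hfan hE hC EC dEC rC rE (fullC (row j etaQ)).
  have [c0|c0|c0] := ltgtP c 0.
  + have /subsetPn[i iB iE] : ~~ (B \subset E) by apply: contra nBE; rewrite eqEsubset EB andbT.
    have [c' [e' [c'0 e'E rc']]] := neg r i rC rE iB iE.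
    have eqj : row j etaQ = ((e - (c / c') *: e') + (c / c') *: ray i) *m etaQ.
      rewrite rc !mulmxDl mulNmx -!scalemxAl -rowE rc' scalerDr scalerA divfK ?lt_eqF //.
      move: (c *: _) (e *m _) (_ *: (e' *m _)) => x y z.
      by rewrite [x + z]addrC addrA subrK addrC.
    have he : supported E (e - (c / c') *: e').
      by move=> l lE; rewrite !mxE eE // e'E // mulr0 subrr.
    have c1 : 0 <= c / c' by rewrite ltW // nmulr_rgt0 // invr_lt0.
    by have [] := cone_meet_mod hfan hA hB EA EB jA he (conicZ c1 (conic_delta iB)) eqj.
  + have eqj : row j etaQ = (e + c *: ray r) *m etaQ.
      by rewrite rc addrC mulmxDl -scalemxAl -rowE.
    have [jC _] := cone_meet_mod hfan hA hC EA EC jA eE (conicZ (ltW c0) (conic_delta rC)) eqj.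
    by rewrite (AC _ jA jC) in jE.
  + have eqj : row j etaQ = (e + 0 *: indic E) *m etaQ.
      by rewrite rc c0 !scale0r add0r addr0.
    have [jE' _] := cone_meet_mod hfan hA hE EA (subxx _) jA eE (conicZ (lexx _) (@conic_indic _ E)) eqj.
    by rewrite jE' in jE.
- move=> m j j' mE jC jE j'B j'E mj.
  have [c [e [c0 eE rc]]] := neg j j' jC jE j'B j'E.
  have := congr1 (fun x : 'rV_n => (x *m map_mx intr m) 0 0) rc.
  rewrite pairingDZ !pairing_row [X in _ + X](pairing_supported eE) // addr0 => h.
  by rewrite -(ltr0z rat) h nmulr_rgt0 // ltrz0.
Qed.

(** Modulo E, the cone D is a plane sector with C as one edge. The other edge is found by maximizing
    the ratio of the functional m of C to the functional g of E. A ray of D outside the other edge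
    is, modulo E, a combination of a ray r of C and a ray x of that edge in which r has positive
    coefficient; a cone around E containing it would contain r. *)
Lemma diamond D : D \in Sigma -> C \subset D -> cdim D = (cdim C).+1 ->
  exists C', [/\ C' \in Sigma, E \subset C', C' \subset D, cdim C' = (cdim E).+1 &
  (forall j, j \in C' -> j \in C -> j \in E)] /\
  (forall A, A \in Sigma -> E \subset A -> (forall j, j \in A -> j \in C -> j \in E) ->
    forall j, j \in A -> j \in D -> j \in C').
Proof.
move=> hD CD dCD; have ED := subset_trans EC CD.
have [m m0 mC] := face_functional hfan hD hC.
have [g g0 gE] := face_functional hfan hD hE.
have [r rC rE] := pair_nonempty dEC.
have [i iD iC] := pair_nonempty dCD.
have gpos j : j \in D -> j \notin E -> 0 < ev g j.
  by move=> jD jE; rewrite lt_neqAle g0 // eq_sym gE // jE.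
have iE : i \notin E by apply: contra iC; apply: subsetP.
have Pi : (fun j => (j \in D) && (j \notin E)) i by rewrite iD.
pose rt j : rat := (ev m j)%:~R / (ev g j)%:~R.
case: (@Order.TotalTheory.arg_maxP _ _ _ i (fun j => (j \in D) && (j \notin E)) rt Pi) => x /andP[xD xE] xmax.
have mx : 0 < ev m x.
  have := xmax i Pi; rewrite /rt; have mi : 0 < ev m i.
    by rewrite lt_neqAle m0 // eq_sym mC // iC.
  move=> h; have : (0 : rat) < (ev m i)%:~R / (ev g i)%:~R.
    by rewrite divr_gt0 ?ltr0z // gpos.
  by move/lt_le_trans => /(_ _ h); rewrite pmulr_lgt0 ?invr_gt0 ltr0z // gpos.
(* Zero at x and nonnegative on D because x maximizes the ratio: the functional that cuts out the
   other edge. *)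
pose m' := ev m x *: g - ev g x *: m.
have evm' j : ev m' j = ev m x * ev g j - ev g x * ev m j.
  by rewrite /m' evD evN !evZ.
have mE0 j : j \in E -> ev m j = 0.
  by move=> jE; apply/eqP; rewrite mC ?(subsetP ED) // (subsetP EC).
have gE0 j : j \in E -> ev g j = 0.
  by move=> jE; apply/eqP; rewrite gE ?(subsetP ED).
have m'E0 j : j \in E -> ev m' j = 0.
  by move=> jE; rewrite evm' (mE0 _ jE) (gE0 _ jE) !mulr0 subrr.
have m'0 j : j \in D -> 0 <= ev m' j.
  move=> jD; have [jE|jE] := boolP (j \in E); first by rewrite m'E0.
  have h : rt j <= rt x by apply: xmax; rewrite jD jE.
  move: h; rewrite /rt ler_pdivrMr ?ltr0z ?gpos // mulrAC ler_pdivlMr ?ltr0z ?gpos //.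
  by rewrite -!rmorphM ler_int evm' subr_ge0 [ev g x * _]mulrC.
have m'r : 0 < ev m' r.
  rewrite evm'; have -> : ev m r = 0 by apply/eqP; rewrite mC // (subsetP CD).
  by rewrite mulr0 subr0 mulr_gt0 // gpos // (subsetP CD).
have m'C j : j \in C -> j \notin E -> 0 < ev m' j.
  move=> jC jE; have [c c0 cE] := pair_sign hfan hE hC EC dEC m'E0 rC rE jC jE.
  by rewrite -(ltr0z rat) cE mulr_gt0 // ltr0z.
pose C' := [set j in D | ev m' j == 0].
have hC' : C' \in Sigma by apply: (fan_face hfan hD); exists m'.
have C'D : C' \subset D by apply/subsetP => j; rewrite inE => /andP[].
have EC' : E \subset C'.
  by apply/subsetP => j jE; rewrite inE (subsetP ED) //= m'E0.
have xC' : x \in C' by rewrite inE xD evm' mulrC subrr /=.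
have disj j : j \in C' -> j \in C -> j \in E.
  rewrite inE => /andP[_ /eqP h] jC; apply/negPn/negP => jE.
  by have := m'C _ jC jE; rewrite h ltxx.
exists C'; split; first split=> //.
- have lt1 : (cdim E < cdim C')%N.
    by apply: proper_dim => //; apply: contraNN xE => /eqP <-.
  have lt2 : (cdim C' < cdim D)%N.
    apply: proper_dim => //; apply/eqP => DC'; move: m'r.
    have : r \in C' by rewrite -DC' (subsetP CD).
    by rewrite inE => /andP[_ /eqP ->]; rewrite ltxx.
  by apply/eqP; rewrite eqn_leq lt1 andbT -ltnS -dEC -dCD.
move=> A hA EA AC j jA jD; rewrite inE jD /=.
have [//|h] := eqVneq (ev m' j) 0; exfalso.
have mj' : 0 < ev m' j by rewrite lt_neqAle m'0 // eq_sym h.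
have xC : x \notin C by rewrite -mC // gt_eqF.
have [be [e1 [e1C rb]]] := span_step hfan hC hD CD dCD xD xC (row_spanmx eta jD).
have [al [e [eE ra]]] : exists c e, supported E e /\ e1 *m etaQ = c *: row r etaQ + e *m etaQ.
  by apply: (span_step hfan hE hC EC dEC rC rE); apply/spanP; exists e1.
have pr m1 : (forall l, l \in E -> ev m1 l = 0) ->
    (ev m1 j)%:~R = be * (ev m1 x)%:~R + al * (ev m1 r)%:~R :> rat.
  move=> m1E; rewrite -pairing_row rb pairingDZ ra pairingDZ !pairing_row.
  by rewrite (pairing_supported eE m1E) addr0.
have m'x : ev m' x = 0 by move: xC'; rewrite inE => /andP[_ /eqP].
have mr : ev m r = 0 by apply/eqP; rewrite mC // (subsetP CD).
have be0 : 0 <= be.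
  have := pr m mE0; rewrite mr mulr0 addr0 => h1.
  have : 0 <= be * (ev m x)%:~R by rewrite -h1 ler0z m0.
  by rewrite pmulr_lge0 // ltr0z.
have al0 : 0 < al.
  have := pr m' m'E0; rewrite m'x mulr0 add0r => h1.
  have : 0 < al * (ev m' r)%:~R by rewrite -h1 ltr0z.
  by rewrite pmulr_lgt0 // ltr0z.
have eqj : row j etaQ = (e + (al *: ray r + be *: ray x)) *m etaQ.
  by rewrite rb ra !mulmxDl -!scalemxAl -!rowE addrC [in RHS]addrC -addrA [e *m _ + _]addrC addrA.
have hd : conic D (al *: ray r + be *: ray x).
  by apply: conicD; apply: conicZ; rewrite ?(ltW al0) //; apply: conic_delta => //; apply: (subsetP CD).
have [_ /(_ r)] := cone_meet_mod hfan hA hD EA ED jA eE hd eqj.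
rewrite !mxE !eqxx /= mulr1 ltr_pwDl ?mulr_ge0 ?ler0n // => /(_ isT) rA.
by rewrite (AC _ rA rC) in rE.
Qed.

End Pair.

Lemma ampleMn (D : 'cV[int]_s) k : (0 < k)%N -> ample eta Sigma D -> ample eta Sigma (D *+ k).
Proof.
move=> k0 hD A hA dA; have [m hm] := hD A hA dA; exists (m *+ k) => j.
have := hm j; have -> : (eta *m (m *+ k)) j 0 = (eta *m m) j 0 *+ k := evMn eta m k j.
by rewrite mulmxnE -mulNrn; case: ifP => _; [move=> ->|rewrite ltr_pMn2r].
Qed.

Lemma ample_lin_equiv (D E : 'cV[int]_s) : lin_equiv eta D E -> ample eta Sigma E -> ample eta Sigma D.
Proof.
move=> [m ->] hE A hA dA; have [m' hm] := hE A hA dA; exists (m' - m) => j.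
have := hm j; rewrite mulmxBr [(eta *m m' - _) j 0]mxE [(- (eta *m m)) j 0]mxE [(E + _) j 0]mxE opprD.
by case: ifP => _; [move=> ->|rewrite ltrD2r].
Qed.

(** On a full cone B around A, the local equation [mB] of D gives a monomial whose exponent is 0
    exactly on B. Adding the functional of the face A of B to a multiple of its exponents leaves
    zeros on A only. *)
Lemma exists_chart_monomial D A : ample eta Sigma D -> A \in Sigma ->
  exists2 b : 'X_{1..s}, ample eta Sigma (mdiv b) & forall j, (b j == 0%N) = (j \in A).
Proof.
move=> hD hA; have [B [hB AB dB]] := exists_full_cone hA.
have [mB hmB] := hD B hB dB; have [m m0 mA] := face_functional hfan hB hA.
pose b0 j := D j 0 + ev mB j.
have b0B j : j \in B -> b0 j = 0.
  move=> jB; have := hmB j; rewrite jB => h.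
  by have -> : b0 j = D j 0 - D j 0; [congr (_ + _); exact: h|rewrite subrr].
have b0n j : j \notin B -> 0 < b0 j.
  move=> jB; have := hmB j; rewrite (negbTE jB) /b0 => h.
  by rewrite -[X in _ < _ + X]/((eta *m mB) j 0) -ltrBlDl sub0r.
(* Outside B the exponent [b0 j] is at least 1, so this multiple dominates the functional. *)
pose k := (\sum_j `|ev m j|).+1%N.
have bpos j : (0 <= b0 j *+ k + ev m j) /\ ((b0 j *+ k + ev m j == 0) = (j \in A)).
  have [jB|jB] := boolP (j \in B).
    by rewrite b0B // mul0rn add0r m0 // mA.
  have h : 0 < b0 j *+ k + ev m j.
    have b1 : 1 <= b0 j by rewrite -gtz0_ge1 b0n.
    have h1 : k%:Z <= b0 j *+ k by rewrite -mulr_natr natz ler_peMl.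
    have h2 : `|ev m j|%:Z < k%:Z.
      by rewrite ltz_nat ltnS (bigD1 j) //= leq_addr.
    by lia.
  split; first exact: ltW.
  by rewrite gt_eqF //; apply/esym/negbTE; apply: contra jB; apply: (subsetP AB).
pose b : 'X_{1..s} := [multinom absz (b0 j *+ k + ev m j)%R | j < s].
exists b; last by move=> j; rewrite mnmE absz_eq0 (bpos j).2.
apply: (@ample_lin_equiv _ (D *+ k)); last exact: ampleMn.
exists (mB *+ k + m); apply/colP => j.
rewrite [mdiv b j 0]mxE mnmE gez0_abs ?(bpos j).1 // [RHS]mxE mulmxnE.
have -> : (eta *m (mB *+ k + m)) j 0 = ev mB j *+ k + ev m j by rewrite -evMn -evD.
by rewrite /b0 mulrnDl addrA.
Qed.

End FanGeometry2.

(** * Complete flags *)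

(** The Smith form of the first row provides a unimodular column operation that clears it after its
    first entry; the lower right block is treated by induction. *)
Lemma triangular_form n (W : 'M[int]_n) : exists2 U, U \in unitmx & is_trig_mx (W *m U).
Proof.
elim: n W => [|n IH] W; first by exists 1%:M; [exact: unitmx1|apply/is_trig_mxP => [[]]].
have [L _ [Q Qu [d _ WE]]] := int_Smith_normal_form (usubmx (W : 'M_(1 + n, _))).
pose W1 : 'M_(1 + n) := W *m invmx Q.
have ur0 : ursubmx W1 = 0.
  have : usubmx W1 = L *m (\matrix_(i, j) (d`_i *+ (i == j :> nat))).
    by rewrite /W1 -mul_usub_mx WE mulmxK.
  move=> h; apply/rowP => j; rewrite !mxE.
  move/matrixP: h => /(_ 0 (rshift 1 j)); rewrite !mxE => ->.
  by rewrite big_ord1 !mxE /= mulr0n mulr0.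
have [U' U'u tU'] := IH (drsubmx W1).
exists ((invmx Q : 'M_(1 + n)) *m (block_mx (1%:M : 'M_1) 0 0 U' : 'M_(1 + n))).
  rewrite unitmx_mul unitmx_inv Qu unitmxE /=.
  by rewrite (@det_ublock _ 1 n 1%:M 0 U') det1 mul1r -unitmxE.
have E : W1 *m (block_mx (1%:M : 'M_1) 0 0 U' : 'M_(1 + n)) =
    block_mx (ulsubmx W1) 0 (dlsubmx W1) (drsubmx W1 *m U').
  rewrite -{1}[W1]submxK ur0 (@mulmx_block _ 1 n 1 n 1 n).
  by rewrite !mulmx0 !mul0mx !mulmx1 !addr0 add0r.
rewrite mulmxA -[_ *m invmx Q]/W1 E (@is_trig_block_mx _ 1 n 1 n) // eqxx tU' andbT /=.
by apply/is_trig_mxP => i j; rewrite !ord1.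
Qed.

Section Flag.
Variables (R : realFieldType) (n s : nat) (eta : 'M[int]_(s, n)).
Variable Sigma : {set {set 'I_s}}.
Hypothesis hfan : is_fan eta Sigma R.
Hypothesis hcomp : complete_fan eta Sigma R.

Local Notation etaQ := (etaQ eta).
Local Notation ev := (ev eta).
Local Notation spanmx := (spanmx eta).
Local Notation cdim := (cone_dim eta).

(* The index k such that x_j divides z_{k+1}. *)
Definition lab (sigma : nat -> {set 'I_s}) (j : 'I_s) : nat :=
  find (fun k => j \in sigma k.+1) (iota 0 n).

Lemma lab_le sigma j : (lab sigma j <= n)%N.
Proof. by rewrite -[X in (_ <= X)%N](size_iota 0 n) find_size. Qed.

Section OneFlag.
Variable sigma : nat -> {set 'I_s}.
Hypothesis hflag : complete_flag eta Sigma sigma.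

Let lab := lab sigma.

Lemma flag_mono k l : (k <= l)%N -> (l <= n)%N -> sigma k \subset sigma l.
Proof.
move=> kl ln; elim: l kl ln => [|l IH]; first by rewrite leqn0 => /eqP ->.
rewrite leq_eqVlt => /orP[/eqP -> //|]; rewrite ltnS => kl ln.
exact: subset_trans (IH kl (ltnW ln)) (flag_sub hflag ln).
Qed.

Lemma flag0 : sigma 0 = set0.
Proof.
apply/setP => j; rewrite inE; apply/negP => jS.
have d0 := flag_dim hflag (leq0n n).
have : (row j etaQ <= (0 : 'M_n))%MS.
  apply: submx_trans (row_spanmx eta jS) _.
  by rewrite cone_dimE in d0; move/eqP: d0; rewrite mxrank_eq0 => /eqP ->; exact: sub0mx.
rewrite submx0 => /eqP/rowP h; have := fan_primitive hfan j.
by rewrite big1 // => l _; move: (h l); rewrite !mxE => /eqP; rewrite intr_eq0 => /eqP ->.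
Qed.

Lemma mem_flag k j : (k <= n)%N -> (j \in sigma k) = (lab j < k)%N.
Proof.
move=> kn; apply/idP/idP => [jk|lk].
  case: k kn jk => [|k] kn jk; first by rewrite flag0 inE in jk.
  rewrite ltnNge; apply/negP => kl.
  have := @before_find _ 0%N (fun k => j \in sigma k.+1) (iota 0 n) k kl.
  by rewrite nth_iota // add0n jk.
have ln : (lab j < n)%N by exact: leq_trans kn.
have : has (fun k => j \in sigma k.+1) (iota 0 n) by rewrite has_find size_iota.
move/(nth_find 0%N); rewrite nth_iota // add0n => h.
exact: subsetP (flag_mono lk kn) _ h.
Qed.

Lemma flag_pair k : (k < n)%N -> [/\ sigma k \in Sigma, sigma k.+1 \in Sigma,
  sigma k \subset sigma k.+1 & cdim (sigma k.+1) = (cdim (sigma k)).+1].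
Proof.
move=> kn; split; [exact: (flag_cone hflag (ltnW kn))|exact: (flag_cone hflag kn)| |].
  exact: flag_sub hflag _ kn.
by rewrite (flag_dim hflag kn) (flag_dim hflag (ltnW kn)).
Qed.

Lemma exists_lab k : (k < n)%N -> exists j, lab j = k.
Proof.
move=> kn; have [hE hC EC dEC] := flag_pair kn.
have [j jC jE] := pair_nonempty dEC; exists j; apply/eqP; rewrite eqn_leq.
by move: jC jE; rewrite !mem_flag // ?(ltnW kn) // ltnS -leqNgt => -> ->.
Qed.

Lemma lab_sign k (m : 'cV[int]_n) j j' : (k < n)%N ->
  (forall i, (lab i < k)%N -> ev m i = 0) -> lab j = k -> lab j' = k ->
  exists2 c : rat, 0 < c & (ev m j)%:~R = c * (ev m j')%:~R.
Proof.
move=> kn mk lj lj'; have [hE hC EC dEC] := flag_pair kn.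
apply: (pair_sign hfan hE hC EC dEC); rewrite ?mem_flag ?lj ?lj' ?ltnS ?ltnn ?(ltnW kn) //.
by move=> i; rewrite mem_flag ?(ltnW kn) //; exact: mk.
Qed.

Lemma flag_functional0 (m : 'cV[int]_n) : (forall j, (lab j < n)%N -> ev m j = 0) -> m = 0.
Proof.
move=> h; apply: (full_functional0 (flag_dim hflag (leqnn n))) => j.
by rewrite mem_flag // => /h.
Qed.

Lemma flag_vanish (m : 'cV[int]_n) k (w : nat -> 'I_s) : (k <= n)%N ->
  (forall i, (i < k)%N -> lab (w i) = i) -> (forall i, (i < k)%N -> ev m (w i) = 0) ->
  forall j, (lab j < k)%N -> ev m j = 0.
Proof.
move=> kn hw mw j; have [N] := ubnP (lab j); elim: N j => // N IH j; rewrite ltnS => jN jk.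
have [c _] : exists2 c : rat, 0 < c & (ev m j)%:~R = c * (ev m (w (lab j)))%:~R.
  apply: (@lab_sign (lab j)) => //; [exact: leq_trans kn| |exact: hw].
  by move=> i ij; apply: IH; [exact: leq_trans jN|exact: ltn_trans jk].
by rewrite mw // mulr0 => /eqP; rewrite intr_eq0 => /eqP.
Qed.

(** One ray is chosen for each label below n, and a unimodular column operation makes the matrix of
    these rays triangular. By [flag_vanish], column k is then zero on all rays of label less than k.
    The diagonal is nonzero because the chosen rays are independent, and a change of signs makes it
    positive. *)
Lemma flag_basis : exists U : 'M[int]_n, U \in unitmx /\
  (forall k : 'I_n, (forall j, (lab j < k)%N -> ev (col k U) j = 0) /\
                    (forall j, lab j = k -> 0 < ev (col k U) j)).
Proof.
have hw (k : 'I_n) : exists j, lab j = k := exists_lab (ltn_ord k).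
have [w wP] := fin_all_exists hw.
pose W : 'M[int]_n := rowsub w eta.
have [U Uu /is_trig_mxP trU] := triangular_form W.
have WU i k : (W *m U) i k = ev (col k U) (w i).
  by rewrite /ev !mxE; apply: eq_bigr => l _; rewrite !mxE.
have vanish (V : 'M[int]_n) (k : 'I_n) : (forall i : 'I_n, (i < k)%N -> ev (col k V) (w i) = 0) ->
    forall j, (lab j < k)%N -> ev (col k V) j = 0.
  move=> h; pose w' i : 'I_s := if insub i is Some i' then w i' else w k.
  have w'E (i : 'I_n) : w' i = w i by rewrite /w' valK.
  apply: (flag_vanish (w := w')); first exact: ltnW.
    by move=> i ik; rewrite -[i]/(val (Ordinal (ltn_trans ik (ltn_ord k)))) w'E wP.
  by move=> i ik; rewrite -[i]/(val (Ordinal (ltn_trans ik (ltn_ord k)))) w'E h.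
have diag (k : 'I_n) : ev (col k U) (w k) != 0.
  apply/negP => /eqP h0.
  have : \det (map_mx intr (W *m U) : 'M[rat]_n) = 0.
    rewrite det_map_mx det_trig; last exact/is_trig_mxP.
    by rewrite (bigD1 k) //= WU h0 mul0r.
  rewrite map_mxM det_mulmx => /eqP; rewrite mulf_eq0 => /orP[|]; last first.
    rewrite det_map_mx intr_eq0 => /eqP dU; move: Uu.
    by rewrite unitmxE dU unitr0.
  rewrite -det_tr => /det0P[v nv vW].
  have [d [z [d0 zE]]] := clear_denominators v^T.
  have z0 : z = 0.
    pose w' i : 'I_s := if insub i is Some i' then w i' else w k.
    have w'E (i : 'I_n) : w' i = w i by rewrite /w' valK.
    apply: flag_functional0; apply: (flag_vanish (w := w')) => // i ik.
      by rewrite -[i]/(val (Ordinal ik)) w'E wP.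
    rewrite -[i]/(val (Ordinal ik)) w'E; apply/eqP; rewrite -(intr_eq0 rat) -pairing_row zE.
    rewrite -scalemxAr mxE; apply/eqP.
    rewrite (_ : (row _ _ *m v^T) 0 0 = (v *m (map_mx intr W)^T) 0 (Ordinal ik)).
      by rewrite vW mxE mulr0.
    by rewrite [LHS]mxE [RHS]mxE; apply: eq_bigr => l _; rewrite !mxE mulrC.
  move: zE; rewrite z0 map_mx0 => /esym/eqP; rewrite scaler_eq0 pnatr_eq0 -leqn0 leqNgt d0 /=.
  by rewrite trmx_eq0 (negbTE nv).
pose D : 'M[int]_n := diag_mx (\row_k Num.sg (ev (col k U) (w k))).
exists (U *m D); split.
  rewrite unitmx_mul Uu /=; have DD : D *m D = 1%:M.
    rewrite mulmx_diag; apply/matrixP => i j; rewrite !mxE; case: eqP => // _.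
    by rewrite mulr1n -expr2 sqr_sg diag.
  by have [] := mulmx1_unit DD.
have colE (k : 'I_n) : col k (U *m D) = Num.sg (ev (col k U) (w k)) *: col k U.
  apply/colP => i; rewrite [LHS]mxE mul_mx_diag !mxE mulrC //.
move=> k; split=> [|j lj].
  by apply: vanish => i ik; rewrite colE evZ (_ : ev _ (w i) = 0) ?mulr0 // -WU trU.
have [c c0 cE] : exists2 c : rat, 0 < c & (ev (col k (U *m D)) j)%:~R = c * (ev (col k (U *m D)) (w k))%:~R.
  apply: (@lab_sign k) => //; apply: vanish => i ik.
  by rewrite colE evZ (_ : ev _ (w i) = 0) ?mulr0 // -WU trU.
rewrite -(ltr0z rat) cE mulr_gt0 // ltr0z colE evZ -normrEsg.
by rewrite normr_gt0 diag.
Qed.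

(** Evaluation on one ray of each label below k is a triangular system for the coefficients. *)
Lemma basis_expand (U : 'M[int]_n) : U \in unitmx ->
  (forall k : 'I_n, (forall j, (lab j < k)%N -> ev (col k U) j = 0) /\
                    (forall j, lab j = k -> 0 < ev (col k U) j)) ->
  forall k (mu : 'cV[int]_n), (k <= n)%N -> (forall j, (lab j < k)%N -> ev mu j = 0) ->
  exists2 a : 'I_n -> int, (forall l : 'I_n, (l < k)%N -> a l = 0) & mu = \sum_l a l *: col l U.
Proof.
move=> Uu hU k mu kn hmu; pose a l := (invmx U *m mu) l 0.
have muE : mu = \sum_l a l *: col l U.
  rewrite -[LHS](mulKVmx Uu); apply/colP => i; rewrite mxE summxE.
  by apply: eq_bigr => l _; rewrite [in RHS]mxE [in RHS]mxE mulrC.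
have evmu j : ev mu j = \sum_l a l * ev (col l U) j.
  rewrite {1}muE /ev mulmx_sumr summxE; apply: eq_bigr => l _.
  by rewrite -scalemxAr mxE.
exists a => // l; have [N] := ubnP (val l); elim: N l => // N IH l; rewrite ltnS => lN lk.
have [j lj] := exists_lab (ltn_ord l).
have := hmu j; rewrite lj => /(_ lk); rewrite evmu (bigD1 l) //= big1 ?addr0.
  move=> /eqP; rewrite mulf_eq0 => /orP[/eqP //|].
  by rewrite gt_eqF // (hU l).2.
move=> l' nl'; have [l'l|ll'|/val_inj e] := ltngtP (val l') (val l); last by rewrite e eqxx in nl'.
  by rewrite (IH l') ?mul0r //; [exact: leq_trans l'l lN|exact: ltn_trans l'l lk].
by rewrite (hU l').1 ?mulr0 // lj.
Qed.

Lemma flag_meets A k : A \in Sigma -> (k <= n)%N ->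
  (exists l, [/\ (l < k)%N, sigma l \subset A & forall j, j \in A -> lab j != l]) \/ sigma k \subset A.
Proof.
move=> hA; elim: k => [|k IH] kn; first by right; rewrite flag0 sub0set.
have [[l [lk lA hl]]|kA] := IH (ltnW kn).
  by left; exists l; split=> //; exact: ltnW.
case/boolP: [exists j, (j \in A) && (lab j == k)] => [/existsP[j /andP[jA /eqP lj]]|/existsPn h].
  right; have [hE hC EC dEC] := flag_pair kn.
  apply: (cone_contains hfan hE hC EC dEC hA kA jA); rewrite mem_flag ?lj ?ltnn //.
  exact: ltnW.
by left; exists k; split=> // j jA; have := h j; rewrite jA.
Qed.

(** For the largest l with [sigma l] in A, a ray of A with label l would bring [sigma l.+1] into A
    by [cone_contains]. The label l will be the coordinate of the chart of A: the product of the
    variables labelled l involves no ray of A and is invertible on this chart. *)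
Lemma flag_label A : A \in Sigma -> exists l, [/\ (l <= n)%N, sigma l \subset A &
  forall j, j \in A -> lab j != l].
Proof.
move=> hA; have [[l [ln lA hl]]|nA] := flag_meets hA (leqnn n).
  by exists l; split=> //; exact: ltnW.
have AE := full_cone_maximal hfan (flag_cone hflag (leqnn n)) hA (flag_dim hflag (leqnn n)) nA.
exists n; split=> // j; rewrite AE mem_flag // => h.
by rewrite neq_ltn h.
Qed.

End OneFlag.

Definition replace_flag (sigma : nat -> {set 'I_s}) k C : nat -> {set 'I_s} :=
  fun l => if l == k then C else sigma l.

Lemma replace_complete sigma k C : complete_flag eta Sigma sigma -> (0 < k <= n)%N ->
  C \in Sigma -> cdim C = k -> sigma k.-1 \subset C -> ((k < n)%N -> C \subset sigma k.+1) ->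
  complete_flag eta Sigma (replace_flag sigma k C).
Proof.
move=> hf /andP[k0 kn] hC dC EC CD; split=> i iN; rewrite /replace_flag.
- by case: eqP => // _; exact: (flag_cone hf).
- by case: eqP => [->|_] //; exact: (flag_dim hf).
- case: (eqVneq i k) => [ik|ik].
    by rewrite -ik in CD *; rewrite gtn_eqF // CD.
  case: (eqVneq i.+1 k) => [ik'|_]; last exact: flag_sub hf _ iN.
  by rewrite -ik' /= in EC.
Qed.

End Flag.

(** * Homogeneous polynomials and Laurent monomials *)

Section Grading.
Variables (n s : nat) (eta : 'M[int]_(s, n)).
Local Notation leq := (lin_equiv eta).
Local Notation hom := (homogeneous eta).

Lemma lin_refl D : leq D D.
Proof. by exists 0; rewrite mulmx0 addr0. Qed.
Lemma lin_sym D E : leq D E -> leq E D.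
Proof. by move=> [m ->]; exists (- m); rewrite mulmxN addrK. Qed.
Lemma lin_trans D E G : leq D E -> leq E G -> leq D G.
Proof. by move=> [m ->] [m' ->]; exists (m + m'); rewrite mulmxDr addrAC addrA addrAC. Qed.
Lemma linD D E D' E' : leq D E -> leq D' E' -> leq (D + D') (E + E').
Proof. by move=> [m ->] [m' ->]; exists (m + m'); rewrite mulmxDr addrACA. Qed.
Lemma linMn D E k : leq D E -> leq (D *+ k) (E *+ k).
Proof. by move=> h; elim: k => [|k IH]; rewrite ?mulr0n ?mulrS; [exact: lin_refl|exact: linD]. Qed.

Lemma mdivD (a b : 'X_{1..s}) : mdiv (a + b)%MM = mdiv a + mdiv b.
Proof. by apply/colP => j; rewrite !mxE mnmDE PoszD. Qed.
Lemma mdiv0 : mdiv (0%MM : 'X_{1..s}) = 0.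
Proof. by apply/colP => j; rewrite !mxE mnm0E. Qed.
Lemma mdivMn (a : 'X_{1..s}) k : mdiv (a *+ k)%MM = mdiv a *+ k.
Proof. by elim: k => [|k IH]; rewrite ?mulm0n ?mdiv0 // mulmS mdivD IH mulrS. Qed.

Section Ring.
Variable R : comNzRingType.
Implicit Types p q : {mpoly R[s]}.

Lemma hom_lin D E p : leq D E -> hom D p -> hom E p.
Proof. by move=> DE hp a /hp h; apply: lin_trans h DE. Qed.
Lemma hom0 D : hom D (0 : {mpoly R[s]}).
Proof. by move=> a; rewrite msupp0. Qed.
Lemma homX a : hom (mdiv a) ('X_[a] : {mpoly R[s]}).
Proof. by move=> b; rewrite msuppX inE => /eqP ->; exact: lin_refl. Qed.
Lemma homD D p q : hom D p -> hom D q -> hom D (p + q).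
Proof. by move=> hp hq a /msuppD_le; rewrite mem_cat => /orP[/hp|/hq]. Qed.
Lemma homN D p : hom D p -> hom D (- p).
Proof. by move=> hp a; rewrite (perm_mem (msuppN p)) => /hp. Qed.
Lemma homB D p q : hom D p -> hom D q -> hom D (p - q).
Proof. by move=> hp /homN; exact: homD. Qed.
Lemma homM D E p q : hom D p -> hom E q -> hom (D + E) (p * q).
Proof.
move=> hp hq a /msuppM_le /allpairsP[[b c] /= [/hp hb /hq hc ->]].
by rewrite mdivD; apply: linD.
Qed.
Lemma homC c : hom 0 (c%:MP : {mpoly R[s]}).
Proof.
move=> a; rewrite msuppC; case: ifP => // _; rewrite inE => /eqP ->.
by rewrite mdiv0; exact: lin_refl.
Qed.
Lemma hom1 : hom 0 (1 : {mpoly R[s]}).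
Proof. by rewrite -mpolyC1; exact: homC. Qed.
Lemma homZ D c p : hom D p -> hom D (c *: p).
Proof. by move=> hp a /msuppZ_le /hp. Qed.
Lemma homXn D p k : hom D p -> hom (D *+ k) (p ^+ k).
Proof.
move=> hp; elim: k => [|k IH]; first by rewrite expr0 mulr0n; exact: hom1.
by rewrite exprS mulrS; exact: homM.
Qed.
Lemma hom_sum (I : Type) (r : seq I) (P : pred I) D (F : I -> {mpoly R[s]}) :
  (forall i, P i -> hom D (F i)) -> hom D (\sum_(i <- r | P i) F i).
Proof. by move=> h; elim/big_rec: _ => [|i p Pi hp]; [exact: hom0|apply: homD; [exact: h|]]. Qed.
Lemma hom_prod (I : Type) (r : seq I) (P : pred I) (D : I -> 'cV_s) (F : I -> {mpoly R[s]}) :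
  (forall i, P i -> hom (D i) (F i)) -> hom (\sum_(i <- r | P i) D i) (\prod_(i <- r | P i) F i).
Proof. by move=> h; elim/big_rec2: _ => [|i p E Pi hp]; [exact: hom1|apply: homM; [exact: h|]]. Qed.
Lemma hom_det k (A : 'M[{mpoly R[s]}]_k) (D E : 'I_k -> 'cV[int]_s) :
  (forall i j, hom (D j - E i) (A i j)) -> hom (\sum_j D j - \sum_i E i) (\det A).
Proof.
move=> hA; rewrite /determinant; apply: hom_sum => sg _.
have -> : (-1) ^+ sg = ((-1) ^+ sg)%:MP :> {mpoly R[s]} by rewrite rmorphXn rmorphN rmorph1.
rewrite -[\sum_j _ - _]add0r; apply: homM; first exact: homC.
apply: (@hom_lin (\sum_i (D (sg i) - E i))); last by apply: hom_prod.
rewrite sumrB; have -> : \sum_i D (sg i) = \sum_j D j by rewrite [RHS](reindex_inj (@perm_inj _ sg)).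
exact: lin_refl.
Qed.
Lemma hom_uniq D E p : p != 0 -> hom D p -> hom E p -> leq D E.
Proof.
move=> np hD hE; have [a ha] : exists a, a \in msupp p.
  by move: np; rewrite -msupp_eq0; case: (msupp p) => // a r _; exists a; rewrite mem_head.
exact: lin_trans (lin_sym (hD a ha)) (hE a ha).
Qed.

Definition divisible_along (d : {set 'I_s}) (N : nat) q : Prop :=
  forall a, a \in msupp q -> forall j, j \in d -> (N <= a j)%N.

Lemma divisible_along0 d q : divisible_along d 0 q.
Proof. by []. Qed.
Lemma divisible_alongM d N1 N2 p q : divisible_along d N1 p -> divisible_along d N2 q ->
  divisible_along d (N1 + N2) (p * q).
Proof.
move=> hp hq a /msuppM_le /allpairsP[[b c] /= [hb hc ->]] j jd.
by rewrite mnmDE leq_add // ?hp ?hq.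
Qed.
Lemma divisible_alongX d N q k : divisible_along d N q -> divisible_along d (k * N) (q ^+ k).
Proof.
by move=> h; elim: k => [|k IH]; [rewrite mul0n|rewrite exprS mulSn; exact: divisible_alongM].
Qed.
End Ring.
End Grading.

Lemma frac_scale (F : fieldType) (p a b : F) : b != 0 -> p / a = p * b / (a * b).
Proof. by move=> b0; rewrite invfM mulrACA divff // mulr1. Qed.

Lemma frac_shuffle (F : fieldType) (c p a b x y : F) : a != 0 -> b != 0 -> x != 0 -> y != 0 ->
  c * (p / (a * x)) / y = c * (p * b) / (y * x) / (a * b).
Proof. by move=> a0 b0 x0 y0; field; rewrite a0 b0 x0 y0. Qed.

Section Laurent.
Variables (n s : nat) (eta : 'M[int]_(s, n)) (K : fieldType).
Local Notation S := {mpoly K[s]}.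
Local Notation L := {fraction S}.
Local Notation ev := (ev eta).
Local Notation leq := (lin_equiv eta).
Local Notation hom := (homogeneous eta).

Definition mnm1s : 'X_{1..s} := [multinom 1%N | j < s].
Definition allX : S := 'X_[mnm1s].

Lemma mdiv_mnm1s : mdiv mnm1s = beta0 s.
Proof. by apply/colP => j; rewrite !mxE mnmE. Qed.

Lemma hom_allX : hom (beta0 s) allX.
Proof. by rewrite -mdiv_mnm1s; exact: homX. Qed.

Lemma mpolyX_neq0 a : 'X_[a] != 0 :> S.
Proof.
by apply/eqP => h; have := mcoeffX K a a; rewrite h mcoeff0 eqxx => /eqP; rewrite eq_sym oner_eq0.
Qed.

Lemma allX_neq0 : allX != 0. Proof. exact: mpolyX_neq0. Qed.

Lemma tofracX_neq0 a : ('X_[a] : S)%:F != 0.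
Proof. by rewrite tofrac_eq0 mpolyX_neq0. Qed.

Definition var (j : 'I_s) : L := ('X_j : S)%:F.
Lemma var_neq0 j : var j != 0. Proof. exact: tofracX_neq0. Qed.

Definition chim (m : 'cV[int]_n) : L := \prod_j var j ^ ev m j.

Lemma chimD m m' : chim (m + m') = chim m * chim m'.
Proof.
by rewrite -big_split; apply: eq_bigr => j _ /=; rewrite evD expfzDr // var_neq0.
Qed.
Lemma chim0 : chim 0 = 1.
Proof. by rewrite /chim big1 // => j _; rewrite /ev mulmx0 mxE expr0z. Qed.
Lemma chim_neq0 m : chim m != 0.
Proof. by apply/prodf_neq0 => j _; rewrite expfz_neq0 // var_neq0. Qed.
Lemma chimN m : chim (- m) = (chim m)^-1.
Proof. by apply: (mulfI (chim_neq0 m)); rewrite -chimD subrr chim0 divff // chim_neq0. Qed.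

Lemma tofracXE a : ('X_[a] : S)%:F = \prod_j var j ^+ a j.
Proof. by rewrite mpolyXE_id rmorph_prod; apply: eq_bigr => j _; rewrite rmorphXn. Qed.

Lemma chim_mulX m (b c : 'X_{1..s}) : (forall j, (c j)%:Z = (b j)%:Z + ev m j) ->
  chim m * ('X_[b] : S)%:F = ('X_[c] : S)%:F.
Proof.
move=> h; rewrite !tofracXE -big_split; apply: eq_bigr => j _ /=.
by rewrite (exprnP _ (b j)) (exprnP _ (c j)) -expfzDr ?var_neq0 // h addrC.
Qed.

Lemma chi_chim l : chi eta K l = chim (delta_mx l 0).
Proof.
apply: eq_bigr => j _; congr (_ ^ _); rewrite /ev -colE mxE //.
Qed.

Lemma Laurent_shift (q : S) D k (nu : 'cV[int]_n) :
  hom D q -> (forall c, c \in msupp q -> forall j, k%:Z <= (c j)%:Z + ev nu j) ->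
  exists2 q' : S, hom (D - beta0 s *+ k) q' & q'%:F = chim nu * q%:F / allX%:F ^+ k.
Proof.
move=> hq hc; pose sh (c : 'X_{1..s}) : 'X_{1..s} := [multinom absz ((c j)%:Z + ev nu j - k%:Z)%R | j < s].
exists (\sum_(c <- msupp q) q@_c *: 'X_[sh c]).
  rewrite big_seq; apply: hom_sum => c cq; apply: homZ.
  apply: (@hom_lin _ _ _ _ (mdiv (sh c))); last exact: homX.
  have [m mE] := hq c cq; exists (m + nu); apply/colP => j.
  rewrite [LHS]mxE mnmE gez0_abs ?subr_ge0 ?hc //.
  have := congr1 (fun x : 'cV[int]_s => x j 0) mE; rewrite mxE => ->.
  rewrite mulmxDr [(D + eta *m m) j 0]mxE [RHS]mxE [(D - _) j 0]mxE [(- (beta0 s *+ k)) j 0]mxE mulmxnE.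
  rewrite [(eta *m m + _) j 0]mxE [beta0 s j 0]mxE -/(ev nu j) natz.
  by move: (ev nu j) (D j 0) ((eta *m m) j 0) => x y z; lia.
rewrite [in RHS](mpolyE q) !raddf_sum /= mulr_sumr mulr_suml.
rewrite !big_seq; apply: eq_bigr => c cq; rewrite -!mul_mpolyC !rmorphM /=.
rewrite -[RHS]mulrA [RHS]mulrCA -[in RHS]mulrA; congr (_ * _); rewrite mulrA [_ * chim nu]mulrC.
have XF : allX%:F != 0 by rewrite tofrac_eq0 allX_neq0.
apply: (canRL (mulfK (expf_neq0 k XF))); rewrite -rmorphXn /= /allX mpolyXn -rmorphM /= -mpolyXD; apply/esym/chim_mulX => j.
rewrite mnmDE mulmnE !mnmE mul1n PoszD gez0_abs ?subr_ge0 ?hc //.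
by rewrite subrK.
Qed.

(* Elements of degree 0 of the localization of S at f. *)
Definition regular (f : S) (g : L) : Prop :=
  exists D k p, [/\ hom D f, hom (D *+ k) p & g = p%:F / f%:F ^+ k].

Section Regular.
Variable f : S.
Hypothesis f0 : f != 0.

Let fF : f%:F != 0. Proof. by rewrite tofrac_eq0. Qed.

Lemma regular_deg D g : hom D f -> regular f g ->
  exists k p, hom (D *+ k) p /\ g = p%:F / f%:F ^+ k.
Proof.
move=> hD [E [k [p [hE hp ->]]]]; exists k, p; split=> //.
exact: (hom_lin (@linMn _ _ _ _ _ k (hom_uniq f0 hE hD)) hp).
Qed.

Lemma regularD g h : regular f g -> regular f h -> regular f (g + h).
Proof.
move=> rg rh; have [D [k [p [hD hp ->]]]] := rg.
have [k' [p' [hp' ->]]] := regular_deg hD rh.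
exists D, (k + k')%N, (p * f ^+ k' + p' * f ^+ k); split=> //.
  apply: homD; first by rewrite mulrnDr; apply/homM/homXn.
  by rewrite mulrnDr addrC; apply/homM/homXn.
rewrite rmorphD !rmorphM !rmorphXn /= exprD.
exact: (addf_div _ _ (expf_neq0 k fF) (expf_neq0 k' fF)).
Qed.

Lemma regularM g h : regular f g -> regular f h -> regular f (g * h).
Proof.
move=> rg rh; have [D [k [p [hD hp ->]]]] := rg.
have [k' [p' [hp' ->]]] := regular_deg hD rh.
exists D, (k + k')%N, (p * p'); split=> //.
  by rewrite mulrnDr; exact: homM.
by rewrite rmorphM exprD /= invfM mulrACA.
Qed.

Lemma regularC D c : hom D f -> regular f (c%:MP%:F).
Proof.
move=> hD; exists D, 0%N, c%:MP; split=> //; first by rewrite mulr0n; exact: homC.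
by rewrite expr0 divr1.
Qed.

Lemma regular1 D : hom D f -> regular f 1.
Proof. by move=> hD; rewrite -(rmorph1 (@FracField.tofrac S)) -mpolyC1; exact: regularC hD. Qed.

Lemma regular0 D : hom D f -> regular f 0.
Proof. by move=> hD; rewrite -(rmorph0 (@FracField.tofrac S)) -mpolyC0; exact: regularC hD. Qed.

Lemma regular_det k D (A : 'M[L]_k) : hom D f ->
  (forall i j, regular f (A i j)) -> regular f (\det A).
Proof.
move=> hD h; rewrite /determinant; apply: (big_ind (regular f)) => [||sg _]; [exact: regular0 hD|exact: regularD|apply: regularM].
  have -> : (-1) ^+ sg = (((-1) ^+ sg)%:MP : S)%:F.
    by rewrite !rmorphXn !rmorphN !rmorph1.
  exact: regularC hD.
by apply: (big_ind (regular f)) => [|g g'|i _]; [exact: regular1 hD|exact: regularM|].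
Qed.

Lemma regular_mulr D E h g : hom D f -> hom E h -> h != 0 -> regular f g -> regular (f * h) g.
Proof.
move=> hD hE h0 rg; have [k [p [hp ->]]] := regular_deg hD rg.
exists (D + E), k, (p * h ^+ k); split; first exact: homM.
  by rewrite mulrnDl; apply/homM/homXn.
have hF : h%:F != 0 by rewrite tofrac_eq0.
by rewrite !rmorphM !rmorphXn /= exprMn; exact: (frac_scale _ _ (expf_neq0 k hF)).
Qed.
End Regular.

Lemma regular_chim m : regular allX (chim m).
Proof.
pose k := \sum_j absz (ev m j).
have hk j : (absz (ev m j) <= k)%N by rewrite /k (bigD1 j) //= leq_addr.
pose c : 'X_{1..s} := [multinom absz (k%:Z + ev m j)%R | j < s].
have cE j : (c j)%:Z = k%:Z + ev m j by rewrite mnmE gez0_abs //; have := hk j; lia.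
exists (beta0 s), k, 'X_[c]; split; first exact: hom_allX.
  apply: (@hom_lin _ _ _ _ (mdiv c)); last exact: homX.
  exists m; apply/colP => j; rewrite [LHS]mxE cE mxE mulmxnE mxE -/(ev m j) natz; lia.
have XF : allX%:F != 0 by rewrite tofrac_eq0 allX_neq0.
have <- : chim m * allX%:F ^+ k = ('X_[c] : S)%:F.
  rewrite -rmorphXn /= /allX mpolyXn; apply: chim_mulX => j.
  by rewrite cE mulmnE mnmE mul1n.
by rewrite (mulfK (expf_neq0 k XF)).
Qed.

(** Poles along the divisors in d are absorbed by a power of f. Along the others the order is at
    most k + 1, namely k from the denominator of the function and 1 from the factor 1 / X, and
    chi^nu compensates it. *)
Lemma canonical_pole f D (d : {set 'I_s}) k p nu : hom D f -> f != 0 -> divisible_along d 1 f ->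
  hom ((D + beta0 s) *+ k) p -> (forall j, j \notin d -> k.+1%:Z <= ev nu j) ->
  canonical_section eta f
    ((chim nu * (p%:F / (f * allX)%:F ^+ k) / allX%:F) *: Omega eta K).
Proof.
move=> hf f0 df hp hnu.
(* The power of f must also make up for negative values of nu on d. *)
pose e := (k.+1 + \sum_j absz (ev nu j))%N.
have he j : k.+1%:Z <= e%:Z + ev nu j.
  have : (absz (ev nu j) <= \sum_j absz (ev nu j))%N by rewrite (bigD1 j) //= leq_addr.
  by rewrite /e; lia.
have hq : hom ((D + beta0 s) *+ k + D *+ e) (p * f ^+ e) by apply/homM/homXn.
have [|q' hq' q'E] := @Laurent_shift _ _ k.+1 nu hq.
  move=> c cq j; have [jd|jd] := boolP (j \in d).
    have dE : divisible_along d (0 + e * 1) (p * f ^+ e).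
      by apply: divisible_alongM; [exact: divisible_along0|exact: divisible_alongX].
    have := dE c cq j jd; rewrite add0n muln1 => ec.
    by apply: le_trans (he j) _; rewrite lerD2r lez_nat.
  by apply: le_trans (hnu j jd) _; rewrite lerDr.
exists D, (k + e)%N, q'; split; first exact: hf.
  have -> : D *+ (k + e) - beta0 s = (D + beta0 s) *+ k + D *+ e - beta0 s *+ k.+1.
    rewrite mulrnDl mulrnDr [beta0 s *+ k.+1]mulrSr opprD addrA; congr (_ - _).
    by rewrite [_ + beta0 s *+ k + _]addrAC addrK.
  exact: hq'.
congr (_ *: _); rewrite q'E !rmorphM !rmorphXn /= exprMn exprD exprS.
have h1 : f%:F != 0 :> L by rewrite tofrac_eq0.
have h2 : allX%:F != 0 :> L by rewrite tofrac_eq0 allX_neq0.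
exact: (frac_shuffle _ _ (expf_neq0 _ h1) (expf_neq0 _ h1) (expf_neq0 _ h2) h2).
Qed.

End Laurent.

(** * Cech cochains given by determinants *)

Lemma sign_shuffle (F : fieldType) (g k e d x : F) : k * k = 1 ->
  e * (g * d / x) = k * g * (e * k * d) / x.
Proof. by move=> kk; rewrite -[LHS]mul1r -kk; ring. Qed.

Section CechDet.
Variables (n s : nat) (eta : 'M[int]_(s, n)) (Sigma : {set {set 'I_s}}).
Variable K : fieldType.
Local Notation S := {mpoly K[s]}.
Local Notation L := {fraction S}.
Local Notation ev := (ev eta).
Local Notation hom := (homogeneous eta).
Local Notation X := (allX s K).
Local Notation chim := (chim eta K).

(** Omega / X is the invariant form of the torus, so that g and W are functions of degree 0 in the
    applications. *)
Definition dcoch (q m : nat) (g : L) (W : 'I_m -> 'I_q -> L) : precochain s K q m :=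
  [ffun t : {ffun 'I_q -> 'I_m} =>
    (g * \det (\matrix_(i, k) W (t i) k) / X%:F) *: Omega eta K].

(** If M is the matrix of V on a tuple, then M s is the vector of ones. Multiplying by the adjugate
    shows that the cofactors of column k add up to det M times s_k. *)
Lemma coboundary_dcoch q m g (V : 'I_m -> 'I_q.+1 -> L) (sL : 'I_q.+1 -> L) k :
  (forall v, \sum_i sL i * V v i = 1) ->
  coboundary (dcoch g (fun v i => V v (lift k i))) = dcoch ((-1) ^+ k * (g * sL k)) V.
Proof.
move=> hV; apply/ffunP => t; rewrite !ffunE.
set M := \matrix_(i, j) V (t i) j.
have E : \sum_i cofactor M i k = \det M * sL k.
  have h1 : M *m (\col_i sL i) = \col_i 1.
    apply/colP => i; rewrite !mxE -[RHS](hV (t i)); apply: eq_bigr => j _.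
    by rewrite !mxE mulrC.
  have := congr1 (fun A : 'cV_q.+1 => A k 0) (mulmxA (\adj M) M (\col_i sL i)).
  rewrite h1 mul_adj_mx mul_scalar_mx mxE [RHS]mxE [X in _ = _ * X]mxE => <-.
  by apply: eq_bigr => i _; rewrite [_ 0]mxE mulr1 mxE.
have -> : (-1) ^+ k * (g * sL k) * \det M / X%:F = \sum_i (-1) ^+ k * g * cofactor M i k / X%:F.
  by rewrite -mulr_suml -mulr_sumr E -!mulrA; do 2 congr (_ * _); rewrite mulrCA mulrA.
rewrite scaler_suml; apply: eq_bigr => i _; rewrite ffunE scalerA; congr (_ *: _).
have -> : \matrix_(i0, k0) V ([ffun j => t (lift i j)] i0) (lift k k0) = row' i (col' k M).
  by apply/matrixP => a b; rewrite !mxE ffunE.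
rewrite /cofactor exprD; apply: sign_shuffle.
by rewrite -signr_odd -signr_addb addbb.
Qed.

Lemma eq_dcochV q m g (V V' : 'I_m -> 'I_q -> L) :
  (forall v i, V v i = V' v i) -> dcoch g V = dcoch g V'.
Proof.
move=> h; apply/ffunP => t; rewrite !ffunE.
have -> : \matrix_(i, k) V (t i) k = \matrix_(i, k) V' (t i) k.
  by apply/matrixP => a b; rewrite !mxE h.
by [].
Qed.

(** A zero coordinate with coefficient 0 is added to V: the cochain becomes the minor omitting it,
    and [coboundary_dcoch] applies with s_k = 0. *)
Lemma coboundary_dcoch0 q m g (V : 'I_m -> 'I_q -> L) (sL : 'I_q -> L) :
  (forall v, \sum_i sL i * V v i = 1) -> coboundary (dcoch g V) = 0.
Proof.
move=> hV; pose ext (w : 'I_q -> L) (j : 'I_q.+1) := if unlift ord0 j is Some i then w i else 0.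
pose V' v := ext (V v); pose sL' := ext sL.
have [h0 hS] : (forall v, V' v ord0 = 0) /\ forall v i, V' v (lift ord0 i) = V v i.
  by split=> v *; rewrite /V' /ext ?unlift_none ?liftK.
have -> : dcoch g V = dcoch g (fun v i => V' v (lift ord0 i)).
  by apply: eq_dcochV => v i; rewrite hS.
rewrite (@coboundary_dcoch _ _ _ V' sL'); last first.
  move=> v; rewrite big_ord_recl h0 mulr0 add0r -[RHS](hV v); apply: eq_bigr => i _.
  by rewrite hS /sL' /ext liftK.
apply/ffunP => t; rewrite !ffunE /sL' /ext unlift_none mulr0 mulr0 mul0r mul0r.
exact: scale0r.
Qed.

Lemma dcoch_perm q m g (V : 'I_m -> 'I_q -> L) (t : {ffun 'I_q -> 'I_m}) (p : 'S_q) :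
  dcoch g V [ffun i => t (p i)] = (-1) ^+ p *: dcoch g V t.
Proof.
rewrite !ffunE scalerA; congr (_ *: _).
have -> : \matrix_(i, k) V ([ffun i => t (p i)] i) k = row_perm p (\matrix_(i, k) V (t i) k).
  by apply/matrixP => a b; rewrite !mxE ffunE.
by rewrite row_permE det_mulmx det_perm !mulrA; congr (_ * _ / _); rewrite mulrC.
Qed.

Lemma dcoch_ninj q m g (V : 'I_m -> 'I_q -> L) (t : {ffun 'I_q -> 'I_m}) :
  ~~ injectiveb t -> dcoch g V t = 0.
Proof.
move=> /injectivePn[i [i' ii' tt]]; rewrite ffunE (determinant_alternate ii').
  by rewrite mulr0 mul0r; exact: scale0r.
by move=> k; rewrite !mxE tt.
Qed.

Lemma dcochD q m g g' (V : 'I_m -> 'I_q -> L) : dcoch (g + g') V = dcoch g V + dcoch g' V.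
Proof. by apply/ffunP => t; rewrite !ffunE !mulrDl; exact: scalerDl. Qed.

Lemma dcochZ q m (a : K) g (V : 'I_m -> 'I_q -> L) :
  dcoch ((a%:MP : S)%:F * g) V = [ffun t => (a%:MP : S)%:F *: dcoch g V t].
Proof. by apply/ffunP => t; rewrite !ffunE -!mulrA; exact/esym/scalerA. Qed.

Lemma dcoch0 q m (V : 'I_m -> 'I_q -> L) : dcoch 0 V = 0.
Proof. by apply/ffunP => t; rewrite !ffunE !mul0r; exact: scale0r. Qed.

Lemma eq_dcoch q m g g' (V V' : 'I_m -> 'I_q -> L) :
  (forall t : {ffun 'I_q -> 'I_m},
    g * \det (\matrix_(i, k) V (t i) k) = g' * \det (\matrix_(i, k) V' (t i) k)) ->
  dcoch g V = dcoch g' V'.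
Proof. by move=> h; apply/ffunP => t; rewrite !ffunE h. Qed.

Lemma pullback_dcoch q m m' (tau : 'I_m' -> 'I_m) g (V : 'I_m -> 'I_q -> L) :
  pullback tau (dcoch g V) = dcoch g (fun v => V (tau v)).
Proof.
apply/ffunP => t; rewrite !ffunE.
have -> : \matrix_(i, k) V ([ffun i0 => tau (t i0)] i) k = \matrix_(i, k) V (tau (t i)) k.
  by apply/matrixP => a b; rewrite !mxE ffunE.
by [].
Qed.
End CechDet.

Lemma fin_choice (aT : finType) (rT : Type) (P : aT -> rT -> Prop) :
  (forall x, exists u, P x u) -> exists u : aT -> rT, forall x, P x (u x).
Proof. exact: (@fin_all_exists aT (fun=> rT) P). Qed.

(** * Cochains attached to charts and the control of their poles *)

Section Systems.
Variables (n s : nat) (eta : 'M[int]_(s, n)) (Sigma : {set {set 'I_s}}).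
Variable K : fieldType.
Local Notation S := {mpoly K[s]}.
Local Notation L := {fraction S}.
Local Notation ev := (ev eta).
Local Notation hom := (homogeneous eta).
Local Notation X := (allX s K).
Local Notation chim := (chim eta K).
Local Notation dcoch := (dcoch eta).
Local Notation cochain := (cochain eta).

Lemma canonical_section0 f D : hom D f -> canonical_section eta f (0 : nform s K).
Proof.
move=> hD; exists D, 0%N, 0; split; [exact: hD|exact: hom0|].
by rewrite rmorph0 mul0r; exact/esym/scale0r.
Qed.

Lemma regular_canonical f D (d : {set 'I_s}) g : hom D f -> f != 0 -> divisible_along d 1 f ->
  regular eta (f * X) g ->
  exists N : nat, forall nu, (forall j, j \notin d -> N%:Z <= ev nu j) ->
    canonical_section eta f ((chim nu * g / X%:F) *: Omega eta K).
Proof.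
move=> hf f0 df rg.
have fX0 : f * X != 0 by rewrite mulf_neq0 // allX_neq0.
have [k [p [hp ->]]] := regular_deg fX0 (homM hf (@hom_allX _ _ eta K)) rg.
by exists k.+1 => nu hnu; apply: canonical_pole hf f0 df hp hnu.
Qed.

Lemma scalar_canonical f D (d : {set 'I_s}) (c : K) nu : hom D f -> f != 0 ->
  divisible_along d 1 f -> (forall j, j \notin d -> 1 <= ev nu j) ->
  canonical_section eta f ((chim nu * (c%:MP : S)%:F / X%:F) *: Omega eta K).
Proof.
move=> hf f0 df hnu.
have hp : hom ((D + beta0 s) *+ 0) (c%:MP : S) by rewrite mulr0n; exact: homC.
have := canonical_pole hf f0 df hp hnu; rewrite expr0 divr1; exact.
Qed.

(* A member {f <> 0} of a cover, on which the variables outside A are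
   invertible, together with functions V whose coordinate iota j vanishes for
   every j in A. *)
Record vertex (q : nat) (iota : 'I_s -> 'I_q) (A : {set 'I_s}) (f : S) (V : 'I_q -> L) : Prop :=
  Vertex {
  vertex_deg : exists2 D, ample eta Sigma D & hom D f;
  vertex_neq0 : f != 0;
  vertex_div : divisible_along (~: A) 1 f;
  vertex_regular : forall k, regular eta (f * X) (V k);
  vertex_vanish : forall j, j \in A -> V (iota j) = 0
}.

Section Cocycle.
Variables (q : nat) (iota : 'I_s -> 'I_q) (m : nat) (A : 'I_m -> {set 'I_s}).
Variables (f : 'I_m -> S) (V : 'I_m -> 'I_q -> L).
Hypothesis hV : forall v, vertex iota (A v) (f v) (V v).

Lemma prod_neq0 k (t : 'I_k -> 'I_m) : \prod_i f (t i) != 0.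
Proof. by apply/prodf_neq0 => i _; exact: vertex_neq0 (hV _). Qed.

Lemma family_hom : exists D : 'I_m -> 'cV[int]_s, forall v, hom (D v) (f v).
Proof.
have h v : exists D, hom D (f v) by have [D _ hD] := vertex_deg (hV v); exists D.
exact: fin_choice h.
Qed.

Lemma prod_hom k (t : 'I_k -> 'I_m) : exists D, hom D (\prod_i f (t i)).
Proof.
have [D hD] := family_hom.
by exists (\sum_i D (t i)); apply: hom_prod => i _.
Qed.

Lemma prod_div k (t : 'I_k -> 'I_m) :
  divisible_along [set j | [exists i, j \notin A (t i)]] 1 (\prod_i f (t i)).
Proof.
move=> a + j; rewrite inE => + /existsP[i ji]; rewrite (bigD1 i) //= => ha.
suff h : divisible_along [set j] (1 + 0) (f (t i) * \prod_(l < k | l != i) f (t l)).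
  exact: h ha j (set11 j).
apply: divisible_alongM; last exact: divisible_along0.
by move=> b /(vertex_div (hV (t i))) h j'; rewrite inE => /eqP ->; apply: h; rewrite inE.
Qed.

Lemma prod_regular k (t : 'I_k -> 'I_m) i c :
  regular eta (f (t i) * X) c -> regular eta ((\prod_i f (t i)) * X) c.
Proof.
move=> rc; have [Di hDi] := prod_hom (fun l : 'I_1 => t i); rewrite big_ord1 in hDi.
have [D hD] : exists D, hom D (\prod_(l < k | l != i) f (t l)).
  have [D hD] := family_hom.
  by exists (\sum_(l < k | l != i) D (t l)); apply: hom_prod => l _.
rewrite (bigD1 i) //= mulrAC; apply: (regular_mulr _ (homM hDi (@hom_allX _ _ eta K)) hD) => //.
  by rewrite mulf_neq0 ?allX_neq0 //; exact: vertex_neq0 (hV _).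
by apply/prodf_neq0 => l _; exact: vertex_neq0 (hV _).
Qed.

Lemma dcoch_cochain k g (W : 'I_m -> 'I_k -> L) :
  (forall t : {ffun 'I_k -> 'I_m}, \det (\matrix_(i, l) W (t i) l) != 0 ->
     canonical_section eta (\prod_i f (t i)) (dcoch g W t)) ->
  cochain f (dcoch g W).
Proof.
move=> h; split=> [t p|t|t]; [exact: dcoch_perm|exact: dcoch_ninj|].
have [d0|/h//] := eqVneq (\det (\matrix_(i, l) W (t i) l)) 0.
have [D hD] := prod_hom t; rewrite ffunE d0 mulr0 mul0r.
rewrite (_ : 0 *: _ = 0); [exact: canonical_section0 hD|exact: scale0r].
Qed.

Lemma det_regular k (t : {ffun 'I_k -> 'I_m}) (u : 'I_k -> 'I_q) :
  regular eta ((\prod_i f (t i)) * X) (\det (\matrix_(i, l) V (t i) (u l))).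
Proof.
have [D hD] := prod_hom t.
apply: (regular_det _ (homM hD (@hom_allX _ _ eta K))).
  by rewrite mulf_neq0 ?allX_neq0 ?prod_neq0.
by move=> i l; rewrite mxE; apply: (prod_regular (i := i)); exact: vertex_regular (hV _) _.
Qed.

(* A minor of V is nonzero only where every variable whose coordinate belongs to
   the minor is invertible. *)
Lemma det_support k (t : {ffun 'I_k -> 'I_m}) (u : 'I_k -> 'I_q) :
  \det (\matrix_(i, l) V (t i) (u l)) != 0 ->
  forall j, j \notin [set j | [exists i, j \notin A (t i)]] -> iota j \notin codom u.
Proof.
move=> d0 j; rewrite inE => /existsPn h; apply: contra d0 => /codomP[l il].
rewrite (expand_det_col _ l) big1 // => i _; rewrite mxE -il.
by rewrite (vertex_vanish (hV _)) ?mul0r //; have := h i; rewrite negbK.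
Qed.

(** The full determinant involves every coordinate, so by [det_support] all variables are invertible
    wherever it is nonzero, and no twist can create a pole. *)
Lemma dcoch_cocycle_cochain g nu :
  (forall t : {ffun 'I_q -> 'I_m}, \det (\matrix_(i, l) V (t i) l) != 0 ->
     regular eta ((\prod_i f (t i)) * X) g) ->
  cochain f (dcoch (chim nu * g) V).
Proof.
move=> hg; apply: dcoch_cochain => t d0; have [D hD] := prod_hom t.
have fX : (\prod_i f (t i)) * X != 0 by rewrite mulf_neq0 ?allX_neq0 ?prod_neq0.
have rg := regularM fX (hg t d0) (det_regular t id).
have [N hN] := regular_canonical hD (prod_neq0 t) (@prod_div _ t) rg.
rewrite ffunE -[chim nu * g * _]mulrA; apply: hN => j /(det_support (u := id) d0).
by rewrite codom_f.
Qed.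

(** Only variables whose coordinate is omitted by u can give poles. Their orders are bounded by one
    N for the finitely many tuples, and a twist of at least N along these variables removes the
    poles. *)
Lemma minor_cochain k g (u : 'I_k -> 'I_q) :
  (forall t : {ffun 'I_k -> 'I_m}, \det (\matrix_(i, l) V (t i) (u l)) != 0 ->
     regular eta ((\prod_i f (t i)) * X) g) ->
  exists N : nat, forall nu,
    (forall t : {ffun 'I_k -> 'I_m}, \det (\matrix_(i, l) V (t i) (u l)) != 0 ->
       forall j, (forall i, j \in A (t i)) -> iota j \notin codom u -> N%:Z <= ev nu j) ->
    cochain f (dcoch (chim nu * g) (fun v i => V v (u i))).
Proof.
move=> hg.
have h (t : {ffun 'I_k -> 'I_m}) : exists N : nat, forall nu,
    \det (\matrix_(i, l) V (t i) (u l)) != 0 ->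
    (forall j, (forall i, j \in A (t i)) -> iota j \notin codom u -> N%:Z <= ev nu j) ->
    canonical_section eta (\prod_i f (t i)) (dcoch (chim nu * g) (fun v i => V v (u i)) t).
  have [D hD] := prod_hom t.
  have [d0|d0] := eqVneq (\det (\matrix_(i, l) V (t i) (u l))) 0; first by exists 0%N.
  have fX : (\prod_i f (t i)) * X != 0 by rewrite mulf_neq0 ?allX_neq0 ?prod_neq0.
  have rg := regularM fX (hg t d0) (det_regular t u).
  have [N hN] := regular_canonical hD (prod_neq0 t) (@prod_div _ t) rg.
  exists N => nu _ hnu; rewrite ffunE -[chim nu * g * _]mulrA; apply: hN => j jd.
  apply: hnu (det_support d0 jd) => i; move: jd; rewrite inE => /existsPn/(_ i).
  by rewrite negbK.
have [N hN] := fin_choice h.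
exists (\max_t N t) => nu hnu; apply: dcoch_cochain => t d0; apply: hN => // j jA ju.
by apply: le_trans (hnu t d0 j jA ju); rewrite lez_nat leq_bigmax.
Qed.

(** With constant coordinates only the simple poles of Omega / X are left, whence the explicit bound
    1. *)
Lemma scalar_minor_cochain k nu (u : 'I_k -> 'I_q) :
  (forall v l, exists c : K, V v l = (c%:MP : S)%:F) ->
  (forall j, iota j \notin codom u -> 1 <= ev nu j) ->
  cochain f (dcoch (chim nu) (fun v i => V v (u i))).
Proof.
move=> hc hnu; apply: dcoch_cochain => t d0; have [D hD] := prod_hom t.
have [c cE] : exists c : K, \det (\matrix_(i, l) V (t i) (u l)) = (c%:MP : S)%:F.
  have [b bE] : exists b : 'I_k -> 'I_k -> K, forall i l, V (t i) (u l) = ((b i l)%:MP : S)%:F.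
    have h i : exists b : 'I_k -> K, forall l, V (t i) (u l) = ((b l)%:MP : S)%:F.
      by have := fin_choice (fun l => hc (t i) (u l)).
    exact: fin_choice h.
  exists (\det (\matrix_(i, l) b i l)).
  pose h : {rmorphism K -> L} := (@FracField.tofrac S) \o (@mpolyC s K).
  rewrite -[RHS]/(h _) -det_map_mx; congr (\det _); apply/matrixP => i l.
  by rewrite !mxE bE.
rewrite ffunE cE; apply: (scalar_canonical _ hD (prod_neq0 t) (@prod_div _ t)) => j jd.
exact: hnu (det_support d0 jd).
Qed.
End Cocycle.
End Systems.

(** * Consequences of the axioms of the trace *)

Lemma zmod_cancel (V : zmodType) (x y : V) : x = 0 -> x + y = 0 -> y = 0.
Proof. by move=> ->; rewrite add0r. Qed.

Section Trace.
Variables (n s : nat) (eta : 'M[int]_(s, n)) (Sigma : {set {set 'I_s}}).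
Variable K : fieldType.
Local Notation S := {mpoly K[s]}.
Local Notation L := {fraction S}.
Local Notation ev := (ev eta).
Local Notation hom := (homogeneous eta).
Local Notation X := (allX s K).
Local Notation chim := (chim eta K).
Local Notation dcoch := (dcoch eta).
Local Notation vertex := (vertex eta Sigma).
Local Notation cover := (open_cover eta Sigma).
Variable Tr : forall m, ('I_m -> S) -> precochain s K n.+1 m -> K.
Hypothesis hTr : is_trace eta Sigma Tr.
Local Notation tr := (@Tr _).

Lemma coboundaryD k m (c c' : precochain s K k m) :
  coboundary (c + c') = coboundary c + coboundary c'.
Proof.
apply/ffunP => t; rewrite !ffunE -big_split; apply: eq_bigr => i _.
by rewrite ffunE; exact: scalerDr.
Qed.

Lemma tr0 m (f : 'I_m -> S) : cover f -> tr f 0 = 0.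
Proof.
move=> hf; have [D hD] : exists D, forall v, hom (D v) (f v).
  have h v : exists D, hom D (f v) by have [/(_ v)[_ [D _ hD]] _] := hf; exists D.
  exact: fin_choice h.
have c0 : cocycle eta f (0 : precochain s K n.+1 m).
  split; last first.
    by apply/ffunP => t; rewrite !ffunE big1 // => i _; rewrite ffunE; exact: scaler0.
  split=> [t p|t _|t]; rewrite ?ffunE //; first by symmetry; exact: scaler0.
  exact: canonical_section0 (@hom_prod _ _ _ _ _ _ _ (fun i => D (t i)) _ (fun i _ => hD (t i))).
have := trace_linear hTr 1 hf c0 c0; rewrite mul1r.
have -> : [ffun t => ((1%:MP : S)%:F : L) *: (0 : precochain s K n.+1 m) t] + 0 = 0 :> precochain s K n.+1 m.
  by rewrite addr0; apply/ffunP => t; rewrite !ffunE; exact: scaler0.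
by move=> /eqP; rewrite -subr_eq0 opprD addNKr oppr_eq0 => /eqP.
Qed.

Lemma trD m (f : 'I_m -> S) c c' : cover f -> cocycle eta f c -> cocycle eta f c' ->
  tr f (c + c') = tr f c + tr f c'.
Proof.
move=> hf hc hc'; have := trace_linear hTr 1 hf hc hc'; rewrite mul1r => <-; congr (tr f (_ + _)).
by apply/ffunP => t; rewrite ffunE !rmorph1; symmetry; exact: scale1r.
Qed.

Lemma coboundary0 k m : coboundary (0 : precochain s K k m) = 0.
Proof. by apply/ffunP => t; rewrite !ffunE big1 // => i _; rewrite ffunE; exact: scaler0. Qed.

Lemma canonical_sectionN f (w : nform s K) : canonical_section eta f w -> canonical_section eta f (- w).
Proof.
move=> [D [k [p [hD hp ->]]]]; exists D, k, (- p); split; [exact: hD|exact: homN|].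
by rewrite rmorphN mulNr; exact/esym/scaleNr.
Qed.

Lemma trN m (f : 'I_m -> S) c c' : cover f -> cocycle eta f c -> cocycle eta f c' ->
  c + c' = 0 -> tr f c' = - tr f c.
Proof.
move=> hf hc hc' h; have := trD hf hc hc'; rewrite h (tr0 hf) => /esym/eqP.
by rewrite addrC addr_eq0 => /eqP.
Qed.

Lemma cocycleN m (f : 'I_m -> S) g (V : 'I_m -> 'I_n.+1 -> L) :
  cocycle eta f (dcoch g V) -> cocycle eta f (dcoch (- g) V).
Proof.
case=> [[h1 h2 h3] h4]; split.
  split=> [t p|t ti|t]; [exact: dcoch_perm|exact: dcoch_ninj|].
  have -> : dcoch (- g) V t = - dcoch g V t by rewrite !ffunE !mulNr; exact: scaleNr.
  exact: canonical_sectionN.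
have := coboundaryD (dcoch g V) (dcoch (- g) V).
rewrite -dcochD addrN dcoch0 coboundary0 => /esym; exact: zmod_cancel h4.
Qed.

Lemma trNg m (f : 'I_m -> S) g (V : 'I_m -> 'I_n.+1 -> L) :
  cover f -> cocycle eta f (dcoch g V) -> tr f (dcoch (- g) V) = - tr f (dcoch g V).
Proof.
move=> hf hc; apply: (trN hf hc (cocycleN hc)).
by rewrite -dcochD addrN dcoch0.
Qed.

Lemma tr_dcochD m (f : 'I_m -> S) g g' (V : 'I_m -> 'I_n.+1 -> L) :
  cover f -> cocycle eta f (dcoch g V) -> cocycle eta f (dcoch g' V) ->
  tr f (dcoch (g + g') V) = tr f (dcoch g V) + tr f (dcoch g' V).
Proof. by move=> hf hc hc'; rewrite dcochD; exact: trD. Qed.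

Lemma tr_dcochB m (f : 'I_m -> S) g g' (V : 'I_m -> 'I_n.+1 -> L) :
  cover f -> cocycle eta f (dcoch g V) -> cocycle eta f (dcoch g' V) ->
  tr f (dcoch (g - g') V) = 0 -> tr f (dcoch g' V) = tr f (dcoch g V).
Proof.
move=> hf hc hc'; rewrite (tr_dcochD hf hc (cocycleN hc')) (trNg hf hc').
by move: (tr _ _) (tr _ _) => a b /eqP; rewrite subr_eq0 => /eqP.
Qed.

Lemma tr_sign m (f : 'I_m -> S) g (V : 'I_m -> 'I_n.+1 -> L) k :
  cover f -> cocycle eta f (dcoch g V) -> tr f (dcoch ((-1) ^+ k * g) V) = 0 -> tr f (dcoch g V) = 0.
Proof.
move=> hf hc; rewrite -signr_odd; case: (odd k) => /=; last by rewrite expr0 mul1r.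
by rewrite expr1 mulN1r (trNg hf hc) => /eqP; rewrite oppr_eq0 => /eqP.
Qed.

Definition system (q : nat) (iota : 'I_s -> 'I_q) (sL : 'I_q -> L) (m : nat)
    (A : 'I_m -> {set 'I_s}) (f : 'I_m -> S) (V : 'I_m -> 'I_q -> L) : Prop :=
  [/\ cover f, forall v, vertex iota (A v) (f v) (V v) & forall v, \sum_i sL i * V v i = 1].

Section One.
Variables (q : nat) (iota : 'I_s -> 'I_q) (sL : 'I_q -> L) (m : nat).
Variables (A : 'I_m -> {set 'I_s}) (f : 'I_m -> S) (V : 'I_m -> 'I_q -> L).
Hypothesis sys : system iota sL A f V.

Lemma system_cocycle_mul nu g :
  (forall t : {ffun 'I_q -> 'I_m}, \det (\matrix_(i, l) V (t i) l) != 0 ->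
     regular eta ((\prod_i f (t i)) * X) g) ->
  cocycle eta f (dcoch (chim nu * g) V).
Proof.
by have [hf hV hs] := sys; move=> hg; split; [exact: (dcoch_cocycle_cochain hV)|exact: coboundary_dcoch0 hs].
Qed.

Lemma regular_one (t : 'I_q -> 'I_m) : regular eta ((\prod_i f (t i)) * X) 1.
Proof.
by have [hf hV hs] := sys; have [D hD] := prod_hom hV t; exact: regular1 (homM hD (@hom_allX _ _ eta K)).
Qed.

Lemma system_cocycle nu : cocycle eta f (dcoch (chim nu) V).
Proof. by rewrite -[chim nu]mulr1; apply: system_cocycle_mul => t _; exact: regular_one. Qed.
End One.

Section Two.
Variables (iota : 'I_s -> 'I_n.+1) (sL : 'I_n.+1 -> L) (m : nat).
Variables (A : 'I_m -> {set 'I_s}) (f : 'I_m -> S) (V : 'I_m -> 'I_n.+1 -> L).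
Hypothesis sys : system iota sL A f V.
Hypothesis n0 : (0 < n)%N.

Lemma tr_coboundary g k : cocycle eta f (dcoch (g * sL k) V) ->
  cochain eta f (dcoch g (fun v i => V v (lift k i))) -> tr f (dcoch (g * sL k) V) = 0.
Proof.
have [hf hV hs] := sys; move=> hc hb; have := trace_coboundary hTr n0 hf hb.
by rewrite (coboundary_dcoch eta g k hs); exact: tr_sign.
Qed.
End Two.

Section Merge.
Variables (q : nat) (iota : 'I_s -> 'I_q) (sL : 'I_q -> L).
Variables (m m' : nat) (A : 'I_m -> {set 'I_s}) (f : 'I_m -> S) (V : 'I_m -> 'I_q -> L).
Variables (A' : 'I_m' -> {set 'I_s}) (f' : 'I_m' -> S) (V' : 'I_m' -> 'I_q -> L).
Hypotheses (sys : system iota sL A f V) (sys' : system iota sL A' f' V').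

Definition merge T (a : 'I_m -> T) (b : 'I_m' -> T) (v : 'I_(m + m')) : T :=
  match split v with inl i => a i | inr i => b i end.

Lemma mergel T (a : 'I_m -> T) (b : 'I_m' -> T) i : merge a b (lshift m' i) = a i.
Proof. by rewrite /merge (unsplitK (inl _ i)). Qed.
Lemma merger T (a : 'I_m -> T) (b : 'I_m' -> T) i : merge a b (rshift m i) = b i.
Proof. by rewrite /merge (unsplitK (inr _ i)). Qed.

Lemma system_merge : system iota sL (merge A A') (merge f f') (merge V V').
Proof.
have [[hf hz] hV hs] := sys; have [[hf' _] hV' hs'] := sys'; split; last first.
- by move=> v; rewrite /merge; case: (split v).
- by move=> v; rewrite /merge; case: (split v).
split=> [v|L' phi x hx]; first by rewrite /merge; case: (split v).
by have [i hi] := hz L' phi x hx; exists (lshift m' i); rewrite mergel.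
Qed.
End Merge.

Lemma cover_merge m m' (f : 'I_m -> S) (f' : 'I_m' -> S) : cover f -> cover f' -> cover (merge f f').
Proof.
move=> [hf hz] [hf' _]; split=> [v|L' phi x hx]; first by rewrite /merge; case: (split v).
by have [i hi] := hz L' phi x hx; exists (lshift m' i); rewrite mergel.
Qed.

Lemma tr_merge m m' (f : 'I_m -> S) (V : 'I_m -> 'I_n.+1 -> L)
  (f' : 'I_m' -> S) (V' : 'I_m' -> 'I_n.+1 -> L) g :
  cover f -> cover f' -> cocycle eta (merge f f') (dcoch g (merge V V')) ->
  tr f (dcoch g V) = tr f' (dcoch g V').
Proof.
move=> hf hf' hc; have hff := cover_merge hf hf'.
have rl : refinement (lshift m') (merge f f') f.
  by move=> j; exists 1%N, 1; rewrite mergel mul1r.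
have rr : refinement (@rshift m m') (merge f f') f'.
  by move=> j; exists 1%N, 1; rewrite merger mul1r.
have := trace_refinement hTr hff hf rl hc; have := trace_refinement hTr hff hf' rr hc.
have -> : pullback (lshift m') (dcoch g (merge V V')) = dcoch g V.
  by rewrite pullback_dcoch; apply: eq_dcochV => v i; rewrite mergel.
have -> : pullback (@rshift m m') (dcoch g (merge V V')) = dcoch g V'.
  by rewrite pullback_dcoch; apply: eq_dcochV => v i; rewrite merger.
by move=> -> ->.
Qed.

Lemma tr_indep iota sL m m' (A : 'I_m -> {set 'I_s}) (f : 'I_m -> S) (V : 'I_m -> 'I_n.+1 -> L)
  (A' : 'I_m' -> {set 'I_s}) (f' : 'I_m' -> S) (V' : 'I_m' -> 'I_n.+1 -> L) nu :
  system iota sL A f V -> system iota sL A' f' V' ->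
  tr f (dcoch (chim nu) V) = tr f' (dcoch (chim nu) V').
Proof.
move=> sys sys'; have [hf _ _] := sys; have [hf' _ _] := sys'; apply: (tr_merge hf hf').
exact: system_cocycle (system_merge sys sys') nu.
Qed.
End Trace.

(** * Toric charts *)

Section Charts.
Variables (R : realFieldType) (n s : nat) (eta : 'M[int]_(s, n)) (Sigma : {set {set 'I_s}}).
Hypothesis hfan : is_fan eta Sigma R.
Hypothesis hcomp : complete_fan eta Sigma R.
Variable D0 : 'cV[int]_s.
Hypothesis hD0 : ample eta Sigma D0.
Variable K : fieldType.
Local Notation S := {mpoly K[s]}.
Local Notation L := {fraction S}.
Local Notation ev := (ev eta).
Local Notation hom := (homogeneous eta).
Local Notation X := (allX s K).
Local Notation chim := (chim eta K).

(* The second condition on x expresses that A is the smallest cone outside of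
   which the coordinates of x do not vanish. *)
Definition nonvanishing (A : {set 'I_s}) (f : S) : Prop :=
  forall (L' : fieldType) (phi : {rmorphism K -> L'}) (x : 'I_s -> L'),
  (forall j, j \notin A -> x j != 0) ->
  (forall mu, (forall j, j \in A -> 0 <= ev mu j) -> (exists2 j, j \in A & 0 < ev mu j) ->
     exists j, [/\ j \in A, x j = 0 & 0 < ev mu j]) ->
  mmap phi x f != 0.

(** For a given point, let A be a smallest cone outside of which its coordinates are nonzero. If mu
    cuts out a proper face of A, minimality gives a vanishing coordinate of A outside the face: this
    is the second condition of [nonvanishing]. *)
Lemma nonvanishing_cover m (f : 'I_m -> S) :
  (forall A, A \in Sigma -> exists v, nonvanishing A (f v)) -> no_common_zero Sigma f.
Proof.
move=> hf L' phi x [A0 hA0 xA0].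
have [A [hA xA] Amin] := @exists_min_card _
  (fun A : {set 'I_s} => A \in Sigma /\ forall j, j \notin A -> x j != 0)
  (ex_intro _ A0 (conj hA0 xA0)).
have [v hv] := hf A hA; exists v; apply: hv => // mu muA [r rA mur].
pose B := [set j in A | ev mu j == 0].
have hB : B \in Sigma by apply: (fan_face hfan hA); exists mu.
apply: NNPP => hn; have : (#|A| <= #|B|)%N.
  apply: Amin; split=> // j jB; have [jA|/xA//] := boolP (j \in A).
  apply/eqP => xj; apply: hn; exists j; split=> //.
  by rewrite lt0r muA // andbT; move: jB; rewrite inE jA.
rewrite leqNgt proper_card //; apply/properP; split; first by apply/subsetP => j; rewrite inE => /andP[].
by exists r => //; rewrite inE rA /= gt_eqF.
Qed.

Lemma mmap_monomial (L' : fieldType) (phi : {rmorphism K -> L'}) (x : 'I_s -> L') a :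
  mmap phi x 'X_[a] = \prod_j x j ^+ a j.
Proof. by rewrite mmapX /mmap1. Qed.

Lemma mmap_monomial_neq0 (L' : fieldType) (phi : {rmorphism K -> L'}) (x : 'I_s -> L')
    (A : {set 'I_s}) (a : 'X_{1..s}) :
  (forall j, j \notin A -> x j != 0) -> (forall j, j \in A -> a j = 0%N) -> mmap phi x 'X_[a] != 0.
Proof.
move=> xA aA; rewrite mmap_monomial; apply/prodf_neq0 => j _.
by have [/aA ->|/xA h] := boolP (j \in A); rewrite ?expr0 ?oner_neq0 ?expf_neq0.
Qed.

Lemma divisible_monomial (A : {set 'I_s}) (a : 'X_{1..s}) : (forall j, j \notin A -> (0 < a j)%N) ->
  divisible_along (~: A) 1 ('X_[a] : S).
Proof. by move=> ha b; rewrite msuppX inE => /eqP -> j; rewrite inE => /ha. Qed.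

Record chart (A : {set 'I_s}) (f : S) : Prop := Chart {
  chart_deg : exists2 D, ample eta Sigma D & hom D f;
  chart_neq0 : f != 0;
  chart_div : divisible_along (~: A) 1 f;
  chart_nz : nonvanishing A f
}.

Lemma chart_monomial A : A \in Sigma ->
  exists b : 'X_{1..s}, chart A ('X_[b] : S).
Proof.
move=> hA; have [b hb bA] := exists_chart_monomial hfan hcomp hD0 hA.
exists b; split.
- by exists (mdiv b); last exact: homX.
- exact: mpolyX_neq0.
- by apply: divisible_monomial => j; rewrite -bA lt0n.
by move=> L' phi x xA _; apply: (mmap_monomial_neq0 phi xA) => j; rewrite -bA => /eqP.
Qed.

(** The binomial is x^b (1 - chi^mu), which makes 1 - chi^mu invertible where it does not vanish.
    For c = b + mu to be nonnegative, and positive outside A, b is a multiple of a chart monomial by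
    a factor N larger than all values of mu. *)
Lemma binomial A mu : A \in Sigma -> (forall j, j \in A -> 0 <= ev mu j) ->
  (exists j, ev mu j != 0) ->
  exists b c : 'X_{1..s}, [/\ forall j, j \in A -> b j = 0%N,
    forall j, (c j)%:Z = (b j)%:Z + ev mu j,
    divisible_along (~: A) 1 ('X_[b] - 'X_[c] : S),
    (exists2 D, ample eta Sigma D & hom D ('X_[b] - 'X_[c] : S)) /\
      (('X_[b] - 'X_[c] : S)%:F = ('X_[b] : S)%:F * (1 - chim mu) /\ 'X_[b] - 'X_[c] != 0 :> S) &
    1 - chim mu != 0 /\ regular eta ('X_[b] - 'X_[c] : S) (1 - chim mu)^-1].
Proof.
move=> hA muA [r mur]; have [a ha aA] := exists_chart_monomial hfan hcomp hD0 hA.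
pose N := (\sum_j absz (ev mu j)).+1.
have hN j : (absz (ev mu j) < N)%N by rewrite ltnS (bigD1 j) //= leq_addr.
pose b : 'X_{1..s} := (a *+ N)%MM.
have bE j : b j = (a j * N)%N by rewrite mulmnE.
have bA j : j \in A -> b j = 0%N by rewrite bE -aA => /eqP ->.
have bnA j : j \notin A -> (N <= b j)%N by rewrite bE -aA -lt0n => h; rewrite leq_pmull.
pose c : 'X_{1..s} := [multinom absz ((b j)%:Z + ev mu j)%R | j < s].
have cE j : (c j)%:Z = (b j)%:Z + ev mu j.
  rewrite mnmE gez0_abs //; have [jA|/bnA] := boolP (j \in A); first by rewrite bA // add0r muA.
  by have := hN j; move: (ev mu j) (b j) => x y; lia.
have hb : ample eta Sigma (mdiv b) by rewrite mdivMn; apply: ampleMn.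
have hhb : hom (mdiv b) ('X_[b] : S) by exact: homX.
have hc : hom (mdiv b) ('X_[c] : S).
  apply: (@hom_lin _ _ _ _ (mdiv c)); last exact: homX.
  by exists mu; apply/colP => j; rewrite !mxE cE /ev mxE.
have fE : ('X_[b] - 'X_[c] : S)%:F = ('X_[b] : S)%:F * (1 - chim mu).
  by rewrite rmorphB /= mulrBr mulr1 mulrC (@chim_mulX _ _ _ _ mu b c).
have bc : b != c.
  by apply/eqP => bc; have := cE r; rewrite -bc => /eqP; rewrite -subr_eq0 opprD addNKr oppr_eq0 (negPf mur).
have f0 : ('X_[b] - 'X_[c] : S) != 0.
  apply/eqP => /(congr1 (fun p : S => p@_b)); rewrite mcoeffB !mcoeffX eqxx eq_sym (negPf bc).
  by rewrite subr0 mcoeff0 => /eqP; rewrite oner_eq0.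
have g0 : 1 - chim mu != 0 by apply: contraNneq f0 => h; rewrite -tofrac_eq0 fE h mulr0.
exists b, c; split=> //; first last.
- split=> //; exists (mdiv b), 1%N, 'X_[b]; split; [exact: homB|by rewrite mulr1n|].
  by rewrite expr1 fE invfM mulrA divff ?tofracX_neq0 // mul1r.
- by split=> //; exists (mdiv b); last exact: homB.
move=> e /msuppB_le; rewrite mem_cat => /orP[]; last first.
  apply: divisible_monomial => j jA; have := cE j; have := bnA _ jA; have := hN j.
  by move: (ev mu j) (b j) (c j) => x y z; lia.
by apply: divisible_monomial => j /bnA; apply: leq_trans.
Qed.

Lemma binomial_at1 (b c : 'X_{1..s}) : ('X_[b] - 'X_[c] : S).@[fun=> 1] = 0.
Proof.
have h a : ('X_[a] : S).@[fun=> 1] = 1 by rewrite mevalX big1 // => i _; rewrite expr1n.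
by rewrite mevalB !h subrr.
Qed.

(* The chart {x^b (1 - chi^mu) <> 0}. *)
Lemma chart_binomial A mu : A \in Sigma -> (forall j, j \in A -> 0 <= ev mu j) ->
  (exists2 j, j \in A & 0 < ev mu j) ->
  exists f : S, [/\ chart A f, 1 - chim mu != 0, regular eta f (1 - chim mu)^-1 &
    f.@[fun=> 1] = 0].
Proof.
move=> hA muA [r rA mur].
have [|b [c [bA cE hdiv [hdeg [fE f0]] [g0 rg]]]] := binomial hA muA; first by exists r; rewrite gt_eqF.
exists ('X_[b] - 'X_[c]); split; [split=> //|exact: g0|exact: rg|exact: binomial_at1].
move=> L' phi x xA hmin; rewrite mmapB.
(* On the orbit of A the second monomial vanishes, mu being positive on a ray of A whose coordinate
   is 0. Removing the zeros of 1 - chi^mu thus does not touch this orbit. *)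
have -> : mmap phi x 'X_[c] = 0.
  have [j [jA xj muj]] := hmin mu muA (ex_intro2 _ _ r rA mur).
  rewrite mmap_monomial (bigD1 j) //= xj expr0n; have := cE j; rewrite bA // add0r => cj.
  by rewrite (_ : (c j == 0)%N = false) ?mul0r //; apply/eqP => cj0; move: muj; rewrite -cj cj0.
by rewrite subr0; apply: (mmap_monomial_neq0 phi xA).
Qed.
End Charts.

(** * The toric cover of a flag and the exchange of one cone *)

Section FlagSystems.
Variables (R : realFieldType) (n s : nat) (eta : 'M[int]_(s, n)) (Sigma : {set {set 'I_s}}).
Hypothesis hfan : is_fan eta Sigma R.
Hypothesis hcomp : complete_fan eta Sigma R.
Variable D0 : 'cV[int]_s.
Hypothesis hD0 : ample eta Sigma D0.
Variable K : fieldType.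
Local Notation S := {mpoly K[s]}.
Local Notation L := {fraction S}.
Local Notation ev := (ev eta).
Local Notation hom := (homogeneous eta).
Local Notation X := (allX s K).
Local Notation chim := (chim eta K).
Local Notation dcoch := (dcoch eta).
Local Notation vertex := (vertex eta Sigma).
Local Notation chart := (chart eta Sigma).
Local Notation cover := (open_cover eta Sigma).
Local Notation system := (@system n s eta Sigma K).

Lemma chart_vertex q (iota : 'I_s -> 'I_q) A (f : S) V : chart A f ->
  (forall k, regular eta (f * X) (V k)) -> (forall j, j \in A -> V (iota j) = 0) ->
  vertex iota A f V.
Proof. by case. Qed.

Lemma chart_regular A (f : S) g : chart A f -> regular eta f g -> regular eta (f * X) g.
Proof.
move=> [[D _ hD] f0 _ _] rg; apply: (regular_mulr f0 hD (@hom_allX _ _ eta K)) rg.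
exact: allX_neq0.
Qed.

Lemma chart_regularX A (f : S) g : chart A f -> regular eta X g -> regular eta (f * X) g.
Proof.
move=> [[D _ hD] f0 _ _] rg; rewrite mulrC.
by apply: (regular_mulr (allX_neq0 s K) (@hom_allX _ _ eta K) hD).
Qed.

Lemma chart_family q (Q : {set 'I_s} -> S -> ('I_q -> L) -> Prop) :
  (forall A, A \in Sigma -> exists f V, chart A f /\ Q A f V) ->
  exists (f : 'I_#|Sigma| -> S) (V : 'I_#|Sigma| -> 'I_q -> L), cover f /\
    forall v, [/\ enum_val v \in Sigma, chart (enum_val v) (f v) & Q (enum_val v) (f v) (V v)].
Proof.
move=> h; have h' (v : 'I_#|Sigma|) : exists fV : S * ('I_q -> L),
    chart (enum_val v) fV.1 /\ Q (enum_val v) fV.1 fV.2.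
  by have [f [V hfV]] := h _ (enum_valP v); exists (f, V).
have [fV hfV] := fin_choice h'.
exists (fun v => (fV v).1), (fun v => (fV v).2); split; last first.
  by move=> v; have [? ?] := hfV v; split=> //; exact: enum_valP.
split=> [v|]; first by have [[? ? ? ?] _] := hfV v; split.
apply: (nonvanishing_cover hfan) => A hA; exists (enum_rank_in hA A).
by have [[_ _ _ +] _] := hfV (enum_rank_in hA A); rewrite enum_rankK_in.
Qed.

Definition coord (sigma : nat -> {set 'I_s}) (j : 'I_s) : 'I_n.+1 := inord (lab n sigma j).

Lemma coordE sigma j : coord sigma j = lab n sigma j :> nat.
Proof. by rewrite inordK // ltnS lab_le. Qed.

Definition evec q (l : 'I_q) : 'I_q -> L := fun k => (k == l)%:R.

Lemma scalar_nat (b : bool) : exists c : K, (b%:R : L) = (c%:MP : S)%:F.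
Proof. by exists b%:R; case: b; rewrite ?rmorph0 ?rmorph1. Qed.

Lemma evec_sum q (l : 'I_q) (sL : 'I_q -> L) : \sum_i sL i * evec l i = sL l.
Proof.
rewrite (bigD1 l) //= /evec eqxx mulr1 big1 ?addr0 // => i /negPf ->.
exact: mulr0.
Qed.

Lemma regular_bool (f : S) D (b : bool) : hom D f -> regular eta f b%:R.
Proof. by move=> hD; case: b; [exact: regular1 hD|exact: regular0 hD]. Qed.

Lemma chart_evec q (A : {set 'I_s}) (f : S) (l k : 'I_q) : chart A f -> regular eta (f * X) (evec l k).
Proof.
move=> [[D _ hD] _ _ _]; apply: regular_bool; apply: homM; first exact: hD.
exact: hom_allX.
Qed.

Section OneFlag.
Variable sigma : nat -> {set 'I_s}.
Hypothesis hflag : complete_flag eta Sigma sigma.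

Lemma flag_system : exists (f : 'I_#|Sigma| -> S) (tau : 'I_#|Sigma| -> 'I_n.+1),
  system (coord sigma) (fun=> 1) enum_val f (fun v => evec (tau v)) /\
  forall v, [/\ enum_val v \in Sigma, chart (enum_val v) (f v), sigma (tau v) \subset enum_val v &
    forall j, j \in enum_val v -> coord sigma j != tau v].
Proof.
have [|f [V [hf hV]]] := @chart_family n.+1 (fun A f V => exists l : 'I_n.+1,
    [/\ V = evec l, sigma l \subset A & forall j, j \in A -> coord sigma j != l]).
  move=> A hA; have [b hb] := chart_monomial hfan hcomp hD0 K hA.
  have [l [ln sl hl]] := flag_label hfan hflag hA.
  have le : @inord n l = l :> nat by rewrite inordK.
  exists 'X_[b], (evec (inord l)); split=> //; exists (inord l); rewrite le; split=> // j jA.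
  by apply: contra (hl j jA) => /eqP h; rewrite -coordE h le.
have h v : exists l : 'I_n.+1, [/\ V v = evec l, sigma l \subset enum_val v &
  forall j, j \in enum_val v -> coord sigma j != l] by have [_ _ ?] := hV v.
have [tau htau] := fin_choice h; exists f, tau; split; last first.
  by move=> v; have [? ? _] := hV v; have [? ? ?] := htau v.
split=> [//|v|v]; last exact: evec_sum.
have [hA hc _] := hV v; have [_ _ ht] := htau v; apply: (chart_vertex hc) => [k|j jA].
  exact: chart_evec hc.
by rewrite /evec (negPf (ht j jA)).
Qed.
End OneFlag.

Variable Tr : forall m, ('I_m -> S) -> precochain s K n.+1 m -> K.
Hypothesis hTr : is_trace eta Sigma Tr.
Local Notation tr := (@Tr _).

(** By [tr_indep] the trace is the same for all systems of the flag; quantifying over them avoids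
    the choice of a cover. *)
Definition flag_value (sigma : nat -> {set 'I_s}) nu (x : K) : Prop :=
  forall m (A : 'I_m -> {set 'I_s}) (f : 'I_m -> S) V,
  system (coord sigma) (fun=> 1) A f V -> tr f (dcoch (chim nu) V) = x.

Lemma flag_valueP sigma nu : complete_flag eta Sigma sigma -> exists x, flag_value sigma nu x.
Proof.
move=> hflag; have [f [tau [sys _]]] := flag_system hflag.
exists (tr f (dcoch (chim nu) (fun v => evec (tau v)))) => m A f' V' sys'.
exact: (tr_indep hTr nu sys' sys).
Qed.

(* sigma' k is the other cone of dimension k between sigma (k - 1) and
   sigma (k + 1) or, for k = n, on the other side of the wall sigma (n - 1). *)
Definition adjacent k (sigma sigma' : nat -> {set 'I_s}) : Prop :=
  [/\ complete_flag eta Sigma sigma, complete_flag eta Sigma sigma', (0 < k <= n)%N,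
      forall i, (i <= n)%N -> i != k -> sigma' i = sigma i &
      (forall j, j \in sigma' k -> j \in sigma k -> j \in sigma k.-1) /\
      forall A, A \in Sigma -> sigma k.-1 \subset A ->
        (forall j, j \in A -> j \in sigma k -> j \in sigma k.-1) ->
        forall j, j \in A -> ((k < n)%N -> j \in sigma k.+1) -> j \in sigma' k].

Lemma in_flag sigma i j : complete_flag eta Sigma sigma -> (i <= n)%N ->
  (j \in sigma i) = (coord sigma j < i)%N.
Proof. by move=> hflag hi; rewrite (mem_flag hfan hflag) // coordE. Qed.

Lemma coord_eq sigma l j : complete_flag eta Sigma sigma -> (l <= n)%N ->
  (coord sigma j == l :> nat) = (j \notin sigma l) && ((l < n)%N ==> (j \in sigma l.+1)).
Proof.
move=> hflag ln; rewrite (in_flag _ hflag ln); case: (ltngtP l n) ln => // [ln _|-> _].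
  by rewrite (in_flag _ hflag ln) /= -leqNgt ltnS eqn_leq andbC.
by rewrite implyFb andbT -leqNgt eqn_leq -[(_ <= n)%N]ltnS ltn_ord.
Qed.

Lemma det_swap_coord (m : nat) (t : {ffun 'I_n.+1 -> 'I_m}) (W : 'I_m -> 'I_n.+1) (k k' : 'I_n.+1) :
  k != k' ->
  \det (\matrix_(i, l) evec (tperm k k' (W (t i))) l) = - \det (\matrix_(i, l) evec (W (t i)) l).
Proof.
move=> kk'; have -> : \matrix_(i, l) evec (tperm k k' (W (t i))) l =
    (\matrix_(i, l) evec (W (t i)) l) *m perm_mx (tperm k k').
  rewrite -[tperm k k' in RHS]tpermV -col_permE; apply/matrixP => i l; rewrite !mxE /evec.
  by rewrite -[in LHS](inj_eq (@perm_inj _ (tperm k k'))) tpermK.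
by rewrite det_mulmx det_perm odd_tperm kk' expr1 mulrN1.
Qed.

(** The charts of sigma, with the coordinates k - 1 and k exchanged, form a system for sigma': the
    two last conditions of [adjacent] say that no ray of a chart acquires the coordinate of this
    chart. The determinants change sign. *)
Lemma adjacent_value k sigma sigma' nu x : adjacent k sigma sigma' ->
  flag_value sigma nu x -> flag_value sigma' nu (- x).
Proof.
move=> [hs hs' /andP[k0 kn] same [disj c2]] hx.
have [f [tau [sys htau]]] := flag_system hs; have [hf hv _] := sys.
have k1n : (k.-1 <= n)%N by apply: leq_trans kn; exact: leq_pred.
have k1k : k.-1 != k by rewrite neq_ltn prednK ?leqnn.
pose k1 : 'I_n.+1 := inord k.-1; pose k2 : 'I_n.+1 := inord k.
have k1E : k1 = k.-1 :> nat by rewrite inordK.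
have k2E : k2 = k :> nat by rewrite inordK.
have kk : k1 != k2 by rewrite -val_eqE /= k1E k2E.
pose tau' v := tperm k1 k2 (tau v).
have hvan (v : 'I_#|Sigma|) (j : 'I_s) : j \in enum_val v -> coord sigma' j != tau' v.
  have [hA hc hst ht] := htau v; move=> jA; apply/negP => /eqP hj.
  have jt : (coord sigma' j == tau' v :> nat) by rewrite hj.
  have {}ht i : i \in enum_val v -> coord sigma i != tau v :> nat by move/ht; rewrite -val_eqE.
  have tn : (tau v <= n)%N by rewrite -ltnS.
  move: jt; rewrite /tau'; case: tpermP => [tk|tk|/eqP tk1 /eqP tk2].
  - rewrite k2E (coord_eq _ hs' kn) => /andP[/negP jnk jk]; apply: jnk.
    apply: (c2 (enum_val v)) => //; first by move: hst; rewrite tk k1E.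
      move=> i iA ik; have := ht i iA; rewrite tk k1E (coord_eq _ hs k1n) prednK // kn ik andbT.
      by rewrite negbK.
    by move=> kn'; move: jk; rewrite kn' /= same // neq_ltn ltnSn orbT.
  - rewrite k1E (coord_eq _ hs' k1n) prednK // kn /= same // => /andP[jk1 jk].
    have := ht j jA; rewrite tk k2E (coord_eq _ hs kn) => /negP; apply.
    apply/andP; split; first by apply: contra jk1; exact: disj.
    apply/implyP => kn'; rewrite -same // ?(neq_ltn, ltnSn, orbT) //.
    by move: jk; apply/subsetP; exact: flag_sub hs' _ kn'.
  have t1 : tau v != k.-1 :> nat by rewrite -k1E.
  have t2 : tau v != k :> nat by rewrite -k2E.
  move=> jt; have := ht j jA; rewrite (coord_eq _ hs tn); move: jt.
  rewrite (coord_eq _ hs' tn) same // => /andP[-> h]; apply/negP; rewrite negbK /=.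
  apply/implyP => tn'; move: h; rewrite tn' /= same //.
  by apply: contra t1 => /eqP <-.
move=> m A f' V' sys'.
have sys2 : system (coord sigma') (fun=> 1) enum_val f (fun v => evec (tau' v)).
  split=> [//|v|v]; last exact: evec_sum.
  have [hA hc _ _] := htau v; apply: (chart_vertex hc) => [i|j /hvan h]; first exact: chart_evec hc.
  by rewrite /evec (negPf h).
rewrite (tr_indep hTr nu sys' sys2) -(hx _ _ _ _ sys).
have -> : dcoch (chim nu) (fun v => evec (tau' v)) = dcoch (- chim nu) (fun v => evec (tau v)).
  by apply: eq_dcoch => t; rewrite (det_swap_coord _ _ kk) mulrN mulNr.
exact: (trNg hTr hf (system_cocycle sys nu)).
Qed.

(** The minor omitting coordinate k has at most simple poles, along the variables of this
    coordinate, and chi^nu cancels them. *)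
Lemma flag_value_coord sigma nu (k : 'I_n.+1) : (0 < n)%N -> complete_flag eta Sigma sigma ->
  (forall j, coord sigma j = k -> 1 <= ev nu j) -> flag_value sigma nu 0.
Proof.
move=> n0 hs hnu m A f' V' sys'; have [f [tau [sys htau]]] := flag_system hs.
rewrite (tr_indep hTr nu sys' sys); have [hf hv _] := sys.
rewrite -[chim nu]mulr1; apply: (tr_coboundary hTr sys n0 (k := k)).
  by rewrite mulr1; exact: system_cocycle sys nu.
apply: (scalar_minor_cochain hv (u := lift k)) => [v l|j hj].
  exact: scalar_nat.
apply: hnu; apply/eqP; apply: contraR hj; rewrite eq_sym => /unlift_some[l -> _].
exact: codom_f.
Qed.
End FlagSystems.

(** * Walks along adjacent flags *)

Lemma ratio_trans (a0 a1 a2 x0 x1 x2 : int) : 0 < a0 -> 0 < a1 -> 0 < a2 ->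
  x0 * a1 < x1 * a0 -> x1 * a2 < x2 * a1 -> x0 * a2 < x2 * a0.
Proof.
move=> h0 h1 h2 p q; rewrite -(ltr_pM2r h1).
have p' : x0 * a1 * a2 < x1 * a0 * a2 by rewrite ltr_pM2r.
have q' : x1 * a2 * a0 < x2 * a1 * a0 by rewrite ltr_pM2r.
move: p' q'; rewrite mulrAC [x1 * a0 * a2]mulrAC [x2 * a1 * a0]mulrAC; exact: lt_trans.
Qed.

Section Walk.
Variables (R : realFieldType) (n s : nat) (eta : 'M[int]_(s, n)) (Sigma : {set {set 'I_s}}).
Hypothesis hfan : is_fan eta Sigma R.
Hypothesis hcomp : complete_fan eta Sigma R.
Variable D0 : 'cV[int]_s.
Hypothesis hD0 : ample eta Sigma D0.
Local Notation ev := (ev eta).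
Local Notation lab := (@lab n s).
Local Notation adjacent := (adjacent eta Sigma).
Implicit Types g : nat -> {set 'I_s}.

(** The bound k keeps all cones of dimension less than k fixed, so that walks in higher dimensions
    can be inserted into those of lower dimension. *)
Inductive reach (k : nat) g : (nat -> {set 'I_s}) -> Prop :=
| reach_refl : reach k g g
| reach_step l g' g'' : reach k g g' -> (k <= l)%N -> adjacent l g' g'' -> reach k g g''.

Lemma reach_trans k g g' g'' : reach k g g' -> reach k g' g'' -> reach k g g''.
Proof. by move=> h; elim=> // l a b _ IH kl ab; exact: reach_step IH kl ab. Qed.

Lemma reach_weaken k k' g g' : (k <= k')%N -> reach k' g g' -> reach k g g'.
Proof.
move=> kk'; elim=> [|l a b _ IH kl ab]; first exact: reach_refl.
exact: reach_step IH (leq_trans kk' kl) ab.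
Qed.

Lemma reach_prefix k g g' i : reach k g g' -> (i < k)%N -> (i <= n)%N -> g' i = g i.
Proof.
move=> + ik iN; elim=> // l a b _ <- kl [_ _ _ same _]; apply: same => //.
by rewrite neq_ltn (leq_trans ik kl).
Qed.

Lemma reach_flag k g g' : complete_flag eta Sigma g -> reach k g g' -> complete_flag eta Sigma g'.
Proof. by move=> hg; case=> // l a b _ _ []. Qed.

Lemma replace_flag_eq g k C : replace_flag g k C k = C.
Proof. by rewrite /replace_flag eqxx. Qed.

Lemma replace_flag_neq g k C i : i != k -> replace_flag g k C i = g i.
Proof. by rewrite /replace_flag => /negPf ->. Qed.

Lemma adjacent_replace g k C : complete_flag eta Sigma g -> (k < n)%N ->
  C \in Sigma -> g k \subset C -> cone_dim eta C = k.+1 -> ((k.+1 < n)%N -> C \subset g k.+2) ->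
  (forall j, j \in C -> j \in g k.+1 -> j \in g k) ->
  (forall A, A \in Sigma -> g k \subset A -> (forall j, j \in A -> j \in g k.+1 -> j \in g k) ->
     forall j, j \in A -> ((k.+1 < n)%N -> j \in g k.+2) -> j \in C) ->
  adjacent k.+1 g (replace_flag g k.+1 C).
Proof.
move=> hg kn hC EC dC CD disj c2; split; [exact: hg| |exact: kn| |].
- exact: replace_complete.
- by move=> i _ ik; rewrite replace_flag_neq.
- by rewrite replace_flag_eq.
Qed.

Lemma adjacent_diamond g k : complete_flag eta Sigma g -> (k.+1 < n)%N ->
  exists C, adjacent k.+1 g (replace_flag g k.+1 C) /\
    forall j, j \in C -> j \notin g k -> j \in g k.+2 /\ j \notin g k.+1.
Proof.
move=> hg kn; have kn' : (k < n)%N by exact: ltnW.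
have [h1 h2 h3 h4] := flag_pair hg kn'; have [_ h5 h6 h7] := flag_pair hg kn.
have [C [[hC EC CD dC disj] c2]] := diamond hfan h1 h2 h3 h4 h5 h6 h7.
exists C; split.
  apply: adjacent_replace => //; first by rewrite dC (flag_dim hg) // ltnW.
  by move=> A hA EA hA' j jA /(_ kn) jD; exact: c2 hA EA hA' j jA jD.
move=> j jC jE; split; first exact: subsetP CD j jC.
by apply: contra jE; exact: disj.
Qed.

Lemma adjacent_wall g k : complete_flag eta Sigma g -> k.+1 = n ->
  exists C, [/\ adjacent k.+1 g (replace_flag g k.+1 C),
    forall j, j \in C -> j \notin g k -> j \notin g n &
    forall m j j', (forall i, i \in g k -> ev m i = 0) -> j \in g n -> j \notin g k ->
      j' \in C -> j' \notin g k -> ev m j < 0 -> 0 < ev m j'].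
Proof.
move=> hg kn; have kn' : (k < n)%N by rewrite -kn.
have [h1 h2 h3 h4] := flag_pair hg kn'.
have dC : cone_dim eta (g k.+1) = n by rewrite (flag_dim hg) kn.
have [C [[hC EC dC' disj c2] sgn]] := wall hfan hcomp h1 h2 h3 h4 dC.
have gn : g n = g k.+1 by rewrite kn.
exists C; split; last by move=> m j j'; rewrite gn; exact: sgn.
  apply: adjacent_replace => //; [by rewrite dC' kn|by rewrite kn ltnn|].
  by move=> A hA EA hA' j jA _; exact: c2 hA EA hA' j jA.
by move=> j jC jE; apply: contra jE; rewrite gn; exact: disj.
Qed.

Lemma lab_mem g k j : complete_flag eta Sigma g -> (k < n)%N ->
  (lab g j = k) <-> (j \in g k.+1 /\ j \notin g k).
Proof.
move=> hg kn; rewrite (mem_flag hfan hg j kn) (mem_flag hfan hg j (ltnW kn)) -leqNgt ltnS.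
by split=> [->|[h1 h2]]; [rewrite leqnn|apply/eqP; rewrite eqn_leq h1].
Qed.

Lemma evl (m m' : 'cV[int]_n) (x y : int) j : ev (x *: m + y *: m') j = x * ev m j + y * ev m' j.
Proof. by rewrite evD !evZ. Qed.

(* The quotient nu_j / a_j, where a is a monomial which vanishes exactly on the
   cone of dimension k, increases along the walk. *)
Lemma walk d : forall k g nu, (k + d).+1 = n -> complete_flag eta Sigma g -> nu != 0 ->
  (forall j, j \in g k -> ev nu j = 0) ->
  exists g', reach k.+1 g g' /\ forall j, j \in g' k.+1 -> j \notin g' k -> 0 < ev nu j.
Proof.
elim: d => [|d IH] k g nu kd hg nu0 nuE.
  rewrite addn0 in kd; have kn : (k < n)%N by rewrite -kd.
  case: (pickP (fun j => [&& j \in g k.+1, j \notin g k & ev nu j <= 0])) => [j0|hp]; last first.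
    exists g; split; [exact: reach_refl|move=> j h1 h2].
    by have := hp j; rewrite h1 h2 /= leNgt => /negbFE.
  move=> /and3P[jC jE jle]; have [C [hadj _ sgn]] := adjacent_wall hg kd.
  exists (replace_flag g k.+1 C); split.
    exact: reach_step (reach_refl _ _) (leqnn _) hadj.
  move=> j; rewrite replace_flag_eq replace_flag_neq ?neq_ltn ?ltnSn // => h1 h2.
  have gn : g n = g k.+1 by rewrite kd.
  have jC' : j0 \in g n by rewrite gn.
  apply: (sgn nu j0 j) => //; rewrite lt_neqAle jle andbT; apply: contra nu0 => /eqP nuj.
  apply/eqP; apply: (@full_functional0 n s eta (g n)); first exact: (flag_dim hg).
  move=> i; rewrite gn => hi; have [/nuE//|hiE] := boolP (i \in g k).
  have l0 : lab g j0 = k by apply/lab_mem.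
  have li : lab g i = k by apply/lab_mem.
  have nuE' r : (lab g r < k)%N -> ev nu r = 0.
    by move=> h; apply: nuE; rewrite (mem_flag hfan hg) // ltnW.
  have [c _] := lab_sign hfan hg kn nuE' li l0; rewrite nuj mulr0 => /eqP.
  by rewrite intr_eq0 => /eqP.
have kn : (k < n)%N by rewrite -kd !ltnS leq_addr.
have k2n : (k.+1 < n)%N by rewrite -kd addnS !ltnS leq_addr.
have kd' : (k.+1 + d).+1 = n by rewrite -kd addnS.
have hE : g k \in Sigma by apply: (flag_cone hg); exact: ltnW.
have [a ha aE] := exists_chart_monomial hfan hcomp hD0 hE.
pose a' j : int := (a j)%:Z.
have a'E j : j \in g k -> a' j = 0 by rewrite -aE /a' => /eqP ->.
have a'pos j : j \notin g k -> 0 < a' j by rewrite -aE /a' -lt0n.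
(* Strict convexity: on each full cone, a functional equal to -a on its rays and larger than -a on
   all others. *)
have hm h : complete_flag eta Sigma h -> exists m, (forall j, j \in h n -> ev m j = - a' j) /\
    forall j, j \notin h n -> - a' j < ev m j.
  move=> hh; have [m hm] := ha _ (flag_cone hh (leqnn n)) (flag_dim hh (leqnn n)).
  exists m; split=> j jA; have := hm j; first by rewrite jA [mdiv a j 0]mxE.
  by rewrite (negbTE jA) [mdiv a j 0]mxE.
(* The rays whose ratio nu_j / a_j is larger than that of [j0], with the denominators cleared; the
   inner induction is on their number. *)
pose B j0 := [set j | (j \notin g k) && (ev nu j0 * a' j < ev nu j * a' j0)].
suff inner N : forall h j0, complete_flag eta Sigma h -> h k = g k -> j0 \in h k.+1 ->
    j0 \notin g k -> ev nu j0 <= 0 -> (#|B j0| < N)%N ->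
    exists g', reach k.+1 h g' /\ forall j, j \in g' k.+1 -> j \notin g' k -> 0 < ev nu j.
  case: (pickP (fun j => [&& j \in g k.+1, j \notin g k & ev nu j <= 0])) => [j0|hp].
    by move=> /and3P[h1 h2 h3]; apply: (inner _ g j0) => //; exact: ltnSn.
  exists g; split; [exact: reach_refl|move=> j h1 h2].
  by have := hp j; rewrite h1 h2 /= leNgt => /negbFE.
elim: N => // N IHN h j0 hh hk j0C j0E nuj0 hB.
have vec_neq0 m : (forall j, j \in h n -> ev m j = - a' j) -> a' j0 *: nu + ev nu j0 *: m = 0 ->
    ev nu j0 != 0.
  move=> _ e0; apply: contra nu0 => /eqP z; apply/eqP/matrixP => i l.
  have := congr1 (fun v : 'cV[int]_n => v i l) e0; rewrite z scale0r addr0 !mxE => /eqP.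
  by rewrite mulf_eq0 gt_eqF ?a'pos //= => /eqP.
(* The functional a_j0 nu + nu_j0 m vanishes on the cone of dimension k + 1, but the outer induction
   needs it to be nonzero. Otherwise the last cone of the flag is moved across a wall; by strict
   convexity this changes m, and then the functional. *)
have [g1 [m [r1 f1 hm1 hm2 nz]]] : exists g1 m, [/\ reach k.+2 h g1, complete_flag eta Sigma g1,
    forall j, j \in g1 n -> ev m j = - a' j, forall j, j \notin g1 n -> - a' j < ev m j &
    a' j0 *: nu + ev nu j0 *: m != 0].
  have [m [m1 m2]] := hm h hh.
  have [e0|nz] := eqVneq (a' j0 *: nu + ev nu j0 *: m) 0; last first.
    by exists h, m; split=> //; exact: reach_refl.
  have pn : n.-1.+1 = n by rewrite prednK // (leq_trans _ kn).
  have [C [hadj dis _]] := adjacent_wall hh pn.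
  have fg1 : complete_flag eta Sigma (replace_flag h n.-1.+1 C) by case: hadj.
  have [m' [m1' m2']] := hm _ fg1.
  exists (replace_flag h n.-1.+1 C), m'; split=> //.
    by apply: reach_step (reach_refl _ _) _ hadj; rewrite pn.
  have nz := vec_neq0 m m1 e0; apply: contra nz => /eqP e1.
  have pn' : (n.-1 < n)%N by rewrite pn.
  have [j] := exists_lab hfan fg1 pn'; move/(lab_mem j fg1 pn').
  rewrite replace_flag_eq replace_flag_neq ?neq_ltn ?ltnSn // => -[jC jE].
  have jn := dis j jC jE; have := m1' j; rewrite {1}/replace_flag pn eqxx => /(_ jC) e2.
  have e3 := m2 j jn.
  have : ev nu j0 * (ev m j - ev m' j) = 0.
    have := congr1 (fun v : 'cV[int]_n => ev v j) e0; have := congr1 (fun v : 'cV[int]_n => ev v j) e1.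
    rewrite !evl /ev mulmx0 mxE -/(ev nu j) -/(ev m j) -/(ev m' j) => h1 h2.
    by rewrite mulrBr; lia.
  move=> /eqP; rewrite mulf_eq0 => /orP[//|]; rewrite subr_eq0 e2 => /eqP e4.
  by rewrite e4 ltxx in e3.
set nu' := a' j0 *: nu + ev nu j0 *: m in nz.
have nu'E j : ev nu' j = a' j0 * ev nu j + ev nu j0 * ev m j by rewrite evl.
have g1k : g1 k = g k by rewrite (reach_prefix r1) ?hk // ltnW.
have g1k1 : g1 k.+1 = h k.+1 by rewrite (reach_prefix r1).
have sub1 i : (i <= n)%N -> g1 i \subset g1 n by move=> hi; apply: (flag_mono f1 hi).
have nu'0 j : j \in g1 k -> ev nu' j = 0.
  move=> jE; rewrite nu'E hm1 ?(subsetP (sub1 k (ltnW kn))) //.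
  by rewrite g1k in jE; rewrite (nuE j jE) (a'E j jE) oppr0 !mulr0 addr0.
have nu'C j : j \in g1 k.+1 -> ev nu' j = 0.
  move=> jC; have [/nu'0//|jE] := boolP (j \in g1 k).
  have l0 : lab g1 j0 = k by apply/lab_mem => //; rewrite g1k g1k1.
  have lj : lab g1 j = k by apply/lab_mem.
  have nuE' r : (lab g1 r < k)%N -> ev nu' r = 0.
    by move=> hr; apply: nu'0; rewrite (mem_flag hfan f1) // ltnW.
  have [c _] := lab_sign hfan f1 kn nuE' lj l0.
  have -> : ev nu' j0 = 0.
    by rewrite nu'E hm1 ?(subsetP (sub1 k.+1 kn)) ?g1k1 // mulrN mulrC subrr.
  by rewrite mulr0 => /eqP; rewrite intr_eq0 => /eqP.
(* Outer induction in dimension k + 1: nu' becomes positive on the new rays of the next cone. The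
   exchange of the cone of dimension k + 1 that follows leads to a cone whose rays are among
   these. *)
have [g2 [r2 pos2]] := IH k.+1 g1 nu' kd' f1 nz nu'C.
have f2 := reach_flag f1 r2.
have g2k : g2 k = g k by rewrite (reach_prefix r2) // ltnW.
have [C [hadj hC]] := adjacent_diamond f2 k2n.
set g3 := replace_flag g2 k.+1 C in hadj.
have f3 : complete_flag eta Sigma g3 by case: hadj.
have r3 : reach k.+1 h g3.
  apply: (reach_step _ (leqnn _) hadj); apply: reach_weaken (leqnSn _) _.
  exact: reach_trans r1 r2.
have g3k : g3 k = g k by rewrite /g3 replace_flag_neq ?neq_ltn ?ltnSn.
have incr j : j \in g3 k.+1 -> j \notin g k -> j \in B j0.
  rewrite /g3 replace_flag_eq -{1}g2k => jC jE; have [jD jnC] := hC j jC jE.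
  have := pos2 j jD jnC; rewrite nu'E inE -g2k jE /= => p.
  (* As nu_j0 <= 0, this inequality turns nu'_j > 0 into a larger ratio for j than for j0. *)
  have mj : - a' j <= ev m j.
    by have [jn|/hm2/ltW//] := boolP (j \in g1 n); rewrite hm1.
  have : ev nu j0 * ev m j <= ev nu j0 * - a' j by apply: ler_wnM2l.
  by rewrite mulrN => le; rewrite -subr_gt0 [_ * a' j0]mulrC; apply: lt_le_trans p _; rewrite lerD2l.
case: (pickP (fun j => [&& j \in g3 k.+1, j \notin g k & ev nu j <= 0])) => [j1|hp]; last first.
  exists g3; split=> // j h1; rewrite g3k => h2.
  by have := hp j; rewrite h1 h2 /= leNgt => /negbFE.
move=> /and3P[h1 h2 h3]; have [g' [r' p']] : exists g', reach k.+1 g3 g' /\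
    forall j, j \in g' k.+1 -> j \notin g' k -> 0 < ev nu j.
  apply: (IHN g3 j1) => //; rewrite ltnS in hB; apply: leq_trans hB; apply/proper_card/properP; split.
    apply/subsetP => j; rewrite !inE => /andP[jE p]; rewrite jE /=.
    have := incr j1 h1 h2; rewrite inE h2 /= => p1.
    exact: ratio_trans (a'pos _ j0E) (a'pos _ h2) (a'pos _ jE) p1 p.
  exists j1; first exact: incr.
  by rewrite inE ltxx andbF.
exists g'; split=> //; apply: reach_trans r3 r'.
Qed.

Variable K : fieldType.
Variable Tr : forall m, ('I_m -> {mpoly K[s]}) -> precochain s K n.+1 m -> K.
Hypothesis hTr : is_trace eta Sigma Tr.

Lemma reach_value k g g' nu x : reach k g g' -> flag_value eta Sigma Tr g nu x ->
  flag_value eta Sigma Tr g' nu x \/ flag_value eta Sigma Tr g' nu (- x).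
Proof.
move=> h hx; elim: h => [|l a b _ IH _ hab]; first by left.
case: IH => h; [right|left; rewrite -[x]opprK]; exact: (adjacent_value hfan hcomp hD0 hTr hab h).
Qed.

(** [walk], started in dimension 0, reaches a flag on whose first cone nu is positive, where
    [flag_value_coord] gives 0. The signs picked up on the way do not affect the value 0. *)
Lemma flag_value0 g nu : complete_flag eta Sigma g -> nu != 0 -> flag_value eta Sigma Tr g nu 0.
Proof.
move=> hg nu0; have n0 : (0 < n)%N.
  rewrite lt0n; apply: contra nu0 => /eqP n0; apply/eqP/matrixP => i.
  by have := ltn_ord i; rewrite {2}n0.
have g0 : g 0%N = set0 := flag0 hfan hg.
have [|j|g' [r pos]] := @walk n.-1 0%N g nu _ hg nu0; rewrite ?add0n ?prednK //.
  by rewrite g0 inE.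
have fg' := reach_flag hg r; have [x hx] := flag_valueP hfan hcomp hD0 hTr nu hg.
have z : flag_value eta Sigma Tr g' nu 0.
  apply: (flag_value_coord hfan hcomp hD0 hTr (k := ord0) n0 fg') => j hj.
  have h0 : lab g' j = 0%N by rewrite -coordE hj.
  have /(lab_mem j fg' n0)[h1 h2] := h0; exact: pos.
have x0 : x = 0.
  have [f [tau [sys _]]] := flag_system hfan hcomp hD0 K fg'.
  have zz := z _ _ _ _ sys.
  case: (reach_value r hx) => h; have := h _ _ _ _ sys; rewrite zz => // /esym/eqP.
  by rewrite oppr_eq0 => /eqP.
by rewrite -x0.
Qed.
End Walk.

(** * Integral Laurent polynomials *)

Section LaurentPolynomials.
Variables (n s : nat) (eta : 'M[int]_(s, n)) (K : fieldType).
Local Notation S := {mpoly K[s]}.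
Local Notation L := {fraction S}.
Local Notation X := (allX s K).
Local Notation chim := (chim eta K).

(* g is an integral Laurent polynomial in the characters, with value c at the
   identity of the torus. *)
Definition laurent (g : L) (c : int) : Prop :=
  exists r : seq (int * 'cV[int]_n),
    g = \sum_(x <- r) x.1%:~R * chim x.2 /\ c = \sum_(x <- r) x.1.

Lemma laurentD g h c d : laurent g c -> laurent h d -> laurent (g + h) (c + d).
Proof. by move=> [r [-> ->]] [r' [-> ->]]; exists (r ++ r'); rewrite !big_cat. Qed.

Lemma laurent0 : laurent 0 0.
Proof. by exists [::]; rewrite !big_nil. Qed.

Lemma laurent_chim nu : laurent (chim nu) 1.
Proof. by exists [:: (1, nu)]; rewrite !big_cons !big_nil /= !addr0 mul1r. Qed.

Lemma laurent1 : laurent 1 1.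
Proof. by rewrite -(chim0 eta K); exact: laurent_chim. Qed.

Lemma laurentN g c : laurent g c -> laurent (- g) (- c).
Proof.
move=> [r [-> ->]]; exists [seq (- x.1, x.2) | x <- r]; rewrite !big_map /=.
split; last by rewrite sumrN.
by rewrite -sumrN; apply: eq_bigr => x _; rewrite rmorphN mulNr.
Qed.

Lemma laurentM g h c d : laurent g c -> laurent h d -> laurent (g * h) (c * d).
Proof.
move=> [r [-> ->]] hh; elim: r => [|x r IH].
  by rewrite !big_nil !mul0r; exact: laurent0.
rewrite !big_cons !mulrDl; apply: laurentD IH.
have [r' [-> ->]] := hh; exists [seq (x.1 * y.1, x.2 + y.2) | y <- r'].
rewrite !big_map /= !mulr_sumr; split=> //; apply: eq_bigr => y _.
by rewrite chimD rmorphM mulrACA.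
Qed.

Lemma laurent_sum (I : Type) (r : seq I) (P : pred I) (F : I -> L) (c : I -> int) :
  (forall i, P i -> laurent (F i) (c i)) ->
  laurent (\sum_(i <- r | P i) F i) (\sum_(i <- r | P i) c i).
Proof. by move=> h; elim/big_rec2: _ => [|i y x Pi IH]; [exact: laurent0|apply: laurentD => //; exact: h]. Qed.

Lemma laurent_prod (I : Type) (r : seq I) (P : pred I) (F : I -> L) (c : I -> int) :
  (forall i, P i -> laurent (F i) (c i)) ->
  laurent (\prod_(i <- r | P i) F i) (\prod_(i <- r | P i) c i).
Proof. by move=> h; elim/big_rec2: _ => [|i y x Pi IH]; [exact: laurent1|apply: laurentM => //; exact: h]. Qed.

Lemma laurent_det k (M : 'M[L]_k) (C : 'M[int]_k) :
  (forall i j, laurent (M i j) (C i j)) -> laurent (\det M) (\det C).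
Proof.
move=> h; rewrite /determinant; apply: laurent_sum => p _; apply: laurentM.
  by case: (odd_perm p); rewrite ?expr1 ?expr0; [exact/laurentN/laurent1|exact: laurent1].
by apply: laurent_prod => i _.
Qed.

Lemma laurent_regular g c : laurent g c -> regular eta X g.
Proof.
move=> [r [-> _]]; have hX := @hom_allX _ _ eta K; have X0 := allX_neq0 s K.
elim: r => [|x r IH]; first by rewrite big_nil; exact: (regular0 hX).
rewrite big_cons; apply: (regularD X0) IH; apply: (regularM X0); last exact: regular_chim.
have -> : x.1%:~R = ((x.1%:~R : K)%:MP : S)%:F by rewrite !rmorph_int.
exact: (regularC _ hX).
Qed.

Lemma geometric (m : 'cV[int]_n) (k : nat) :
  (\sum_(i < k) chim (m *+ i)) * (1 - chim m) = 1 - chim (m *+ k).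
Proof.
elim: k => [|k IH]; first by rewrite big_ord0 mul0r mulr0n chim0 subrr.
rewrite big_ord_recr mulrDl IH mulrBr mulr1 -chimD -mulrSr addrA subrK.
by [].
Qed.

(** A geometric sum; for negative a, the sum for -a multiplied by -chi^(a m). The clause for a = 0
    records which coordinates stay 0 after an expansion. *)
Lemma laurent_expand1 (m : 'cV[int]_n) (a : int) :
  exists Q, [/\ laurent Q a, a = 0 -> Q = 0 & 1 - chim (a *: m) = Q * (1 - chim m)].
Proof.
have pos (k : nat) : exists Q, [/\ laurent Q k%:Z, k%:Z = 0 -> Q = 0 & 1 - chim (k%:Z *: m) = Q * (1 - chim m)].
  exists (\sum_(i < k) chim (m *+ i)); split.
  - have -> : k%:Z = \sum_(i < k) 1 by rewrite sumr_const card_ord natz.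
    by apply: laurent_sum => i _; exact: laurent_chim.
  - by case: k => // _; rewrite big_ord0.
  by rewrite geometric -natz scaler_nat.
case: a => k; first exact: pos.
have [Q [hQ _ E]] := pos k.+1; exists (- chim (Negz k *: m) * Q); split=> //.
  have -> : Negz k = - 1 * k.+1%:Z by rewrite mulN1r NegzE.
  by apply: laurentM hQ; apply/laurentN/laurent_chim.
rewrite -mulrA -E mulNr mulrBr mulr1 -chimD -scalerDl NegzE addNr scale0r chim0 opprB.
by [].
Qed.

(** Iteration of 1 - x y = (1 - x) + x (1 - y); the extra factor x is a character, with value 1 at
    the identity. *)
Lemma laurent_expand (m : nat -> 'cV[int]_n) (a : nat -> int) N :
  exists Q : nat -> L, [/\ forall l, laurent (Q l) (a l), forall l, a l = 0 -> Q l = 0 &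
    1 - chim (\sum_(l < N) a l *: m l) = \sum_(l < N) Q l * (1 - chim (m l))].
Proof.
have h1 l : exists Q, [/\ laurent Q (a l), a l = 0 -> Q = 0 &
  1 - chim (a l *: m l) = Q * (1 - chim (m l))] by exact: laurent_expand1.
elim: N => [|N [Q [hQ Q0 E]]].
  have [Q hQ] : exists Q : nat -> L, forall l, laurent (Q l) (a l) /\ (a l = 0 -> Q l = 0).
    exists (fun l => if a l == 0 then 0 else (a l)%:~R) => l; case: eqP => [->|//].
      by split=> //; exact: laurent0.
    split=> //; exists [:: (a l, 0)]; rewrite !big_cons !big_nil /= chim0 mulr1 !addr0.
    by [].
  exists Q; split=> [l|l|]; [by case: (hQ l)|by case: (hQ l)|].
  by rewrite !big_ord0 chim0 subrr.
have [q [hq q0 Eq]] := h1 N; pose u := \sum_(l < N) a l *: m l.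
exists (fun l => if l == N then chim u * q else Q l); split=> [l|l|].
- case: eqP => [->|_]; last exact: hQ.
  by rewrite -[a N]mul1r; apply: laurentM hq; exact: laurent_chim.
- by case: eqP => [-> /q0 ->|_ /Q0//]; rewrite mulr0.
rewrite !big_ord_recr eqxx /= -mulrA -Eq.
have -> : \sum_(i < N) (if i == N :> nat then chim u * q else Q i) * (1 - chim (m i)) =
    1 - chim u.
  by rewrite E; apply: eq_bigr => i _; rewrite (ltn_eqF (ltn_ord i)).
by rewrite -/u chimD mulrBr mulr1 addrA subrK.
Qed.
End LaurentPolynomials.

(** * From the toric cover to the identity of the torus *)

(** In column T only rows equal to e can be nonzero. If the tuple meets both exceptional members, D
    e e has two equal rows, and D h e arises from D e h by exchanging two rows. Otherwise one term
    on the right has a zero column and the other one is D e e. *)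
Lemma det_exchange (F : fieldType) (q m : nat) (T : 'I_q) (pa po : pred 'I_m)
    (e h : 'I_q -> F) (r : 'I_m -> 'I_q -> F) (t : 'I_q -> 'I_m) :
  let W x y v := if pa v then x else if po v then y else r v in
  let D (x y : 'I_q -> F) := \det (\matrix_(i, l) W x y (t i) l) in
  (forall v v', pa v -> pa v' -> v = v') -> (forall v v', po v -> po v' -> v = v') ->
  h T = 0 -> (forall v, ~~ pa v -> ~~ po v -> r v T = 0) ->
  D e e = D e h + D h e.
Proof.
move=> W D ua uo hT rT.
have [inj|/injectivePn[i [i' ii' tt]]] := boolP (injectiveb t); last first.
  have z x y : D x y = 0.
    by apply: (determinant_alternate ii') => l; rewrite !mxE tt.
  by rewrite !z addr0.
have colz x y : (forall i, W x y (t i) T = 0) -> D x y = 0.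
  by move=> h0; rewrite /D (expand_det_col _ T) big1 // => i _; rewrite mxE h0 mul0r.
have eqD x y x' y' : (forall i, W x y (t i) =1 W x' y' (t i)) -> D x y = D x' y'.
  by move=> h0; congr (\det _); apply/matrixP => i l; rewrite !mxE h0.
case: (pickP (fun i => pa (t i))) => [i pi|na]; last first.
  rewrite (colz e h) ?add0r; first by apply: eqD => i l; rewrite /W na.
  move=> i; rewrite /W na; case: ifP => // npo; apply: rT; [by rewrite na|by rewrite npo].
case: (pickP (fun i => po (t i) && ~~ pa (t i))) => [i' /andP[pi' npi']|no]; last first.
  have no' j : pa (t j) = false -> po (t j) = false.
    by move=> h1; have := no j; rewrite h1 andbT.
  rewrite (colz h e) ?addr0.
    by apply: eqD => j l; rewrite /W; case: ifP => // /no' ->.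
  by move=> j; rewrite /W; case: ifP => // h1; rewrite no' //; apply: rT; rewrite ?h1 ?no'.
have ii' : i != i' by apply: contraNneq npi' => <-.
have -> : D e e = 0.
  by apply: (determinant_alternate ii') => l; rewrite !mxE /W pi (negPf npi') pi'.
suff -> : D h e = - D e h by rewrite subrr.
have -> : D h e = \det (row_perm (tperm i i') (\matrix_(i, l) W e h (t i) l)).
  congr (\det _); apply/matrixP => j l; rewrite !mxE.
  case: tpermP => [->|->|/eqP j1 /eqP j2]; rewrite /W.
  - by rewrite pi (negPf npi') pi'.
  - by rewrite pi (negPf npi') pi'.
  case: ifP => [pj|_]; first by move: j1; rewrite (injectiveP _ inj _ _ (ua _ _ pj pi)) eqxx.
  by case: ifP => // pj; move: j2; rewrite (injectiveP _ inj _ _ (uo _ _ pj pi')) eqxx.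
by rewrite row_permE det_mulmx det_perm odd_tperm ii' expr1 mulN1r.
Qed.

Lemma det_scale_col (F : fieldType) q (M : 'M[F]_q) (c : 'I_q) (G : F) :
  \det (\matrix_(i, l) ((if l == c then G else 1) * M i l)) = G * \det M.
Proof.
have -> : \matrix_(i, l) ((if l == c then G else 1) * M i l) =
    M *m diag_mx (\row_l (if l == c then G else 1)).
  apply/matrixP => i l; rewrite mul_mx_diag !mxE mulrC //.
rewrite det_mulmx det_diag mulrC; congr (_ * _).
by under eq_bigr do rewrite mxE; rewrite -big_mkcond big_pred1_eq.
Qed.

Definition shift_invariant (V : zmodType) (T : Type) (phi : V -> T) (m : V) : Prop :=
  forall nu, phi (nu + m) = phi nu.

Section ShiftInvariant.
Variables (V : zmodType) (T : Type) (phi : V -> T).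
Local Notation invariant := (shift_invariant phi).

Lemma shift_invariant0 : invariant 0.
Proof. by move=> nu; rewrite addr0. Qed.
Lemma shift_invariantD m m' : invariant m -> invariant m' -> invariant (m + m').
Proof. by move=> h h' nu; rewrite addrA h' h. Qed.
Lemma shift_invariantN m : invariant m -> invariant (- m).
Proof. by move=> h nu; rewrite -h subrK. Qed.
Lemma shift_invariantMn m i : invariant m -> invariant (m *+ i).
Proof.
move=> h; elim: i => [|i IH]; first exact: shift_invariant0.
by rewrite mulrS; exact: shift_invariantD.
Qed.
End ShiftInvariant.

Lemma shift_invariant_comb (n : nat) (T : Type) (phi : 'cV[int]_n -> T) (a : nat -> int)
    (m : nat -> 'cV[int]_n) N :
  (forall l, (l < N)%N -> a l != 0 -> shift_invariant phi (m l)) ->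
  shift_invariant phi (\sum_(l < N) a l *: m l).
Proof.
move=> h; elim/big_rec: _ => [|l u _ IH]; first exact: shift_invariant0.
apply: shift_invariantD IH; have [->|al] := eqVneq (a l) 0.
  by rewrite scale0r; exact: shift_invariant0.
have {}h := h l (ltn_ord l) al; case: (a l) => i.
  by rewrite -natz scaler_nat; exact: shift_invariantMn.
by rewrite NegzE scaleNr -natz scaler_nat; apply/shift_invariantN/shift_invariantMn.
Qed.

Lemma shift_bound (x y : int) (N b M : nat) : `|x| <= b%:Z -> 0 < y -> (N + b <= M)%N ->
  N%:Z <= x + M%:Z * y.
Proof.
move=> hx hy hM; have : M%:Z <= M%:Z * y by rewrite ler_peMr.
by move: (M%:Z * y) => z; lia.
Qed.

Lemma addr_opp (V : zmodType) (a b c d : V) : a = b + d -> a = 0 -> b = c -> c = - d.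
Proof. by move=> -> /eqP + <-; rewrite addr_eq0 => /eqP. Qed.

Section LaurentTrace.
Variables (n s : nat) (eta : 'M[int]_(s, n)) (Sigma : {set {set 'I_s}}).
Variable K : fieldType.
Local Notation S := {mpoly K[s]}.
Local Notation L := {fraction S}.
Local Notation chim := (chim eta K).
Local Notation dcoch := (dcoch eta).
Variable Tr : forall m, ('I_m -> S) -> precochain s K n.+1 m -> K.
Hypothesis hTr : is_trace eta Sigma Tr.
Variables (iota : 'I_s -> 'I_n.+1) (sL : 'I_n.+1 -> L) (m : nat).
Variables (A : 'I_m -> {set 'I_s}) (f : 'I_m -> S) (V : 'I_m -> 'I_n.+1 -> L).
Hypothesis sys : @system n s eta Sigma K n.+1 iota sL m A f V.

Lemma system_cocycle_laurent g c : laurent eta g c -> cocycle eta f (dcoch g V).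
Proof.
move=> hg; have [_ hv _] := sys; rewrite -[g]mul1r -(chim0 eta K).
apply: (system_cocycle_mul sys) => t _; have [D hD] := prod_hom hv t; rewrite mulrC.
apply: (regular_mulr (allX_neq0 s K) (@hom_allX _ _ eta K) hD (prod_neq0 hv t)).
exact: laurent_regular hg.
Qed.

Lemma system_cocycle_geometric nu mu M :
  cocycle eta f (dcoch (\sum_(i < M) chim (nu + mu *+ i)) V).
Proof.
apply: (@system_cocycle_laurent _ (\sum_(i < M) 1)); apply: laurent_sum => i _.
exact: laurent_chim.
Qed.

Lemma tr_geometric nu mu M :
  @Tr m f (dcoch (\sum_(i < M) chim (nu + mu *+ i)) V) =
  \sum_(i < M) @Tr m f (dcoch (chim (nu + mu *+ i)) V).
Proof.
have [hf _ _] := sys; elim: M => [|M IH].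
  by rewrite !big_ord0 dcoch0 (tr0 hTr hf).
rewrite !big_ord_recr -IH; apply: (tr_dcochD hTr hf); first exact: system_cocycle_geometric.
exact: system_cocycle sys _.
Qed.
End LaurentTrace.

(** * Replacing one coefficient 1 by 1 - chi^(m_k) *)

Section Step.
Variables (R : realFieldType) (n s : nat) (eta : 'M[int]_(s, n)) (Sigma : {set {set 'I_s}}).
Hypothesis hfan : is_fan eta Sigma R.
Hypothesis hcomp : complete_fan eta Sigma R.
Variable D0 : 'cV[int]_s.
Hypothesis hD0 : ample eta Sigma D0.
Variable K : fieldType.
Local Notation S := {mpoly K[s]}.
Local Notation L := {fraction S}.
Local Notation ev := (ev eta).
Local Notation hom := (homogeneous eta).
Local Notation X := (allX s K).
Local Notation chim := (chim eta K).
Local Notation dcoch := (dcoch eta).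
Local Notation chart := (chart eta Sigma).
Local Notation system := (@system n s eta Sigma K).
Variable Tr : forall m, ('I_m -> S) -> precochain s K n.+1 m -> K.
Hypothesis hTr : is_trace eta Sigma Tr.
Local Notation tr := (@Tr _).
Variable sigma : nat -> {set 'I_s}.
Hypothesis hflag : complete_flag eta Sigma sigma.
Local Notation lab := (@lab n s sigma).
Local Notation T := (@ord_max n).
Local Notation evec := (@evec s K _).

Variable mb : nat -> 'cV[int]_n.
Hypothesis mb0 : forall k, (k < n)%N -> forall j, (lab j < k)%N -> ev (mb k) j = 0.
Hypothesis mb1 : forall k, (k < n)%N -> forall j, lab j = k -> 0 < ev (mb k) j.
Hypothesis mbE : forall k mu, (k <= n)%N -> (forall j, (lab j < k)%N -> ev mu j = 0) ->
  exists2 a : nat -> int, forall l, (l < k)%N -> a l = 0 & mu = \sum_(l < n) a l *: mb l.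

Definition gap (l : nat) : L := 1 - chim (mb l).
Definition tcoord (i : nat) (j : 'I_s) : 'I_n.+1 :=
  if (lab j < i)%N then @coord n s sigma j else T.
Definition scal (i : nat) (l : 'I_n.+1) : L := if (l < i)%N || (l == T) then 1 else gap l.
Definition perp (i : nat) (nu : 'cV[int]_n) : bool :=
  [forall j, (lab j < i)%N ==> (ev nu j == 0)].

Lemma perpP i nu : reflect (forall j, (lab j < i)%N -> ev nu j = 0) (perp i nu).
Proof.
apply: (iffP forallP) => [h j hj|h j]; last by apply/implyP => /h ->.
by have := h j; rewrite hj => /eqP.
Qed.

(* For i = n the cocycles live on the toric cover of the flag; for i = 0 the
   coordinates other than T are relations among the equations gap l of the
   identity of the torus. *)
Definition claim (i : nat) (x : K) : Prop :=
  forall nu m (A : 'I_m -> {set 'I_s}) (f : 'I_m -> S) V,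
  system (tcoord i) (scal i) A f V ->
  tr f (dcoch (chim nu) V) = if perp i nu then (-1) ^+ (n - i) * x else 0.

(** The coefficients of 1 - chi^mu in terms of the gaps, divided by 1 - chi^mu on a chart where it
    is invertible. Those of index below k vanish because mu does on the labels below k, so that the
    sum is 1 at every stage i <= k. *)
Lemma fraction_vector k A mu : (k <= n)%N -> A \in Sigma ->
  (forall j, (lab j < k)%N -> ev mu j = 0) ->
  (forall j, j \in A -> 0 <= ev mu j) -> (exists2 j, j \in A & 0 < ev mu j) ->
  exists f r, [/\ chart A f /\ f.@[fun=> 1] = 0, forall l, regular eta (f * X) (r l), r T = 0,
    forall l : 'I_n.+1, (l < k)%N -> r l = 0 &
    forall i, (i <= k)%N -> \sum_l scal i l * r l = 1].
Proof.
move=> kn hA muk muA mupos.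
have [f [hc g0 rg f1]] := chart_binomial hfan hcomp hD0 K hA muA mupos.
have [a a0 muE] := mbE kn muk; have [Q [hQ Q0 QE]] := laurent_expand eta K mb a n.
rewrite -muE in QE.
exists f, (fun l => if (l < n)%N then Q l / (1 - chim mu) else 0).
have hD : exists D, hom D (f * X).
  by have [[D _ hD] _ _ _] := hc; exists (D + beta0 s); apply: homM hD (@hom_allX _ _ eta K).
have [D hfX] := hD.
split=> [//|l||l lk|i ik].
- case: ifP => _; last exact: regular0 hfX.
  apply: regularM; first by rewrite mulf_neq0 ?allX_neq0 //; case: hc.
    exact: chart_regularX hc (laurent_regular (hQ l)).
  exact: chart_regular hc rg.
- by rewrite ltnn.
- by rewrite (leq_trans lk kn) Q0 ?a0 // mul0r.
rewrite big_ord_recr /= ltnn mulr0 addr0.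
have -> : \sum_(l < n) scal i (widen_ord (leqnSn n) l) *
    (if (widen_ord (leqnSn n) l < n)%N then Q (widen_ord (leqnSn n) l) / (1 - chim mu) else 0) =
    \sum_(l < n) Q l * gap l / (1 - chim mu).
  apply: eq_bigr => l _; rewrite /= ltn_ord /scal -val_eqE /= (ltn_eqF (ltn_ord l)) orbF.
  case: ifP => li; last by rewrite mulrA [gap l * _]mulrC.
  by rewrite Q0 ?a0 ?(leq_trans li ik) // !mul0r mulr0.
by rewrite -mulr_suml -QE divff.
Qed.

Lemma tcoord_lt i j : (i <= n)%N -> (lab j < i)%N -> tcoord i j = lab j :> nat.
Proof. by move=> _ h; rewrite /tcoord h coordE. Qed.

Lemma tcoord_T i j : (i <= lab j)%N -> tcoord i j = T.
Proof. by rewrite /tcoord ltnNge => ->. Qed.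

Section OneStep.
Variable k : nat.
Hypothesis kn : (k < n)%N.
Let c : 'I_n.+1 := inord k.
Let cE : c = k :> nat. Proof. by rewrite inordK // ltnS ltnW. Qed.
Let cT : c != T. Proof. by rewrite -val_eqE /= cE neq_ltn kn. Qed.

Lemma mem_sub (j : 'I_s) i : (i <= n)%N -> (j \in sigma i) = (lab j < i)%N.
Proof. by move=> hi; rewrite (mem_flag hfan hflag). Qed.

Lemma gap_neq0 : gap k != 0.
Proof.
have [hE hC EC dC] := flag_pair hflag kn.
have [j hj] := exists_lab hfan hflag kn.
have [||f [_ g0 _ _]] // := @chart_binomial R n s eta Sigma hfan hcomp D0 hD0 K (sigma k.+1) (mb k) hC.
  move=> i; rewrite mem_sub // ltnS leq_eqVlt => /orP[/eqP/(mb1 kn)/ltW//|/(mb0 kn) -> //].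
by exists j; [rewrite mem_sub // hj|exact: mb1].
Qed.

(* Charts of the cover on which the claims for k and k + 1 are compared: all the
   cones through sigma k except sigma k itself are cut out by binomials, and B is
   the cone on the other side of sigma k in the direction of sigma (k + 1). *)
Record step_data (mu : 'cV[int]_n) (B : {set 'I_s}) (f : 'I_#|Sigma| -> S)
    (r : 'I_#|Sigma| -> 'I_n.+1 -> L) : Prop := StepData {
  step_cover : open_cover eta Sigma f;
  step_chart : forall v, chart (enum_val v) (f v);
  step_gap : forall v, enum_val v = sigma k.+1 -> regular eta (f v) (gap k)^-1;
  step_B : forall j, j \in B -> (k <= lab j)%N -> (k < lab j)%N /\ 0 < ev mu j;
  step_mu : forall j, lab j = k -> ev mu j < 0;
  step_mu0 : forall j, (lab j < k)%N -> ev mu j = 0;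
  step_regular : forall v l, regular eta (f v * X) (r v l);
  step_T : forall v, r v T = 0;
  step_vanish : forall v, enum_val v != sigma k -> enum_val v != sigma k.+1 ->
    forall j, j \in enum_val v -> r v (tcoord k.+1 j) = 0;
  step_sum : forall v, enum_val v != sigma k -> enum_val v != sigma k.+1 ->
    \sum_l scal k l * r v l = 1;
  step_c : forall v, enum_val v != sigma k -> enum_val v != sigma k.+1 -> r v c != 0 ->
    enum_val v = B
}.

(** A cone with a label l < k in the sense of [flag_meets] takes the vector e_l. The other cones
    contain sigma k: the opposite cone B takes the fraction vector of mu, which may have a
    coordinate k, and the rest those of functionals vanishing on [sigma k.+1]. The vectors at
    [sigma k] and [sigma k.+1] are chosen later, in [W]. *)
Lemma step_data_exists : exists mu B f r, step_data mu B f r.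
Proof.
have [hE hC EC dC] := flag_pair hflag kn.
have [B [mu [[hB EB BE muB muBE] [muC other]]]] := opposite hfan hcomp hE hC EC dC.
have muE j : (lab j < k)%N -> ev mu j = 0.
  move=> h; have jE : j \in sigma k by rewrite mem_sub // ltnW.
  by apply/eqP; rewrite muBE // (subsetP EB).
have muk j : lab j = k -> ev mu j < 0.
  by move=> h; apply: muC; rewrite mem_sub ?h ?ltnn // ltnW.
have Bk j : j \in B -> (k <= lab j)%N -> (k < lab j)%N /\ 0 < ev mu j.
  move=> jB hk; have p : 0 < ev mu j.
    by rewrite lt0r muB // andbT muBE // mem_sub ?(ltnW kn) // -leqNgt.
  by split=> //; rewrite ltn_neqAle hk andbT; apply: contraL p => /eqP e; rewrite -leNgt ltW ?muk.
have [j0 hj0] := exists_lab hfan hflag kn.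
pose Q (A : {set 'I_s}) (f : S) (r : 'I_n.+1 -> L) :=
  [/\ A = sigma k.+1 -> regular eta f (gap k)^-1, forall l, regular eta (f * X) (r l), r T = 0 &
   A != sigma k -> A != sigma k.+1 ->
   [/\ forall j, j \in A -> r (tcoord k.+1 j) = 0, \sum_l scal k l * r l = 1 &
     r c != 0 -> A = B]].
have [|f [r [hf hr]]] := @chart_family R n s eta Sigma hfan K n.+1 Q; last first.
  exists mu, B, f, r; split=> // v.
  - by case: (hr v).
  - by case: (hr v) => _ _ [].
  - by case: (hr v) => _ _ [].
  - by case: (hr v) => _ _ [].
  - by case: (hr v) => _ _ [_ _ _ +] h1 h2 => /(_ h1 h2)[].
  - by case: (hr v) => _ _ [_ _ _ +] h1 h2 => /(_ h1 h2)[].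
  by case: (hr v) => _ _ [_ _ _ +] h1 h2 => /(_ h1 h2)[].
move=> A hA; have zero f : chart A f -> forall l : 'I_n.+1, regular eta (f * X) ((fun=> 0) l).
  by case=> [[D _ hD] _ _ _] _; apply: regular0 (homM hD (@hom_allX _ _ eta K)).
have [AE|AE] := eqVneq A (sigma k).
  have [b hb] := chart_monomial hfan hcomp hD0 K hA.
  exists 'X_[b], (fun=> 0); split=> //; split=> //; last by rewrite AE eqxx.
    by move=> e; move: dC; rewrite -e AE => /n_Sn.
  exact: zero.
have [AC|AC] := eqVneq A (sigma k.+1).
  have [||f [hc _ rg _]] // := @chart_binomial R n s eta Sigma hfan hcomp D0 hD0 K A (mb k) hA.
  - move=> i; rewrite AC mem_sub // ltnS leq_eqVlt => /orP[/eqP/(mb1 kn)/ltW//|/(mb0 kn) -> //].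
  - by exists j0; [rewrite AC mem_sub // hj0|exact: mb1].
  exists f, (fun=> 0); split=> //; split=> //; last by rewrite AC eqxx.
  exact: zero.
have [[l [lk sl hl]]|EA] := flag_meets hfan hflag hA (ltnW kn).
  have [b hb] := chart_monomial hfan hcomp hD0 K hA.
  have ln : (l < n.+1)%N by rewrite ltnS ltnW // (ltn_trans lk kn).
  have lE : @inord n l = l :> nat by rewrite inordK.
  exists 'X_[b], (evec (@inord n l)); split=> //; split=> [e||/=|_ _].
  - by move: AC; rewrite e eqxx.
  - by move=> i; exact: chart_evec hb.
  - by rewrite /evec -val_eqE /= lE gtn_eqF // (ltn_trans lk kn).
  split; last by rewrite /evec -val_eqE /= cE lE gtn_eqF ?eqxx.
    move=> j jA; rewrite /evec -val_eqE /= lE.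
    have [jk|jk] := ltnP (lab j) k.+1; first by rewrite tcoord_lt // (negPf (hl j jA)).
    by rewrite tcoord_T //= gtn_eqF // (ltn_trans lk kn).
  by rewrite evec_sum /scal lE lk.
have [AB|AB] := eqVneq A B.
  have [|||f [r [[hc _] rr rT rk rs]]] // := @fraction_vector k A mu (ltnW kn) hA.
  - by rewrite AB.
  - have [j jB jE] : exists2 j, j \in B & j \notin sigma k.
      by apply/subsetPn; apply: contra BE => BE; rewrite eqEsubset BE.
    by exists j; rewrite ?AB //; move: jE; rewrite mem_sub ?(ltnW kn) // -leqNgt => /(Bk _ jB)[].
  exists f, r; split=> //; split=> // [e|_ _]; first by move: AC; rewrite e eqxx.
  split=> //; last exact: rs.
  move=> j jA; have [jk|jk] := ltnP (lab j) k; first by rewrite rk // tcoord_lt // ltnW.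
  by rewrite AB in jA; have [jk' _] := Bk j jA jk; rewrite tcoord_T.
have [m [m0 mA mpos]] := other A hA EA AE AC AB.
have [|||f [r [[hc _] rr rT rk rs]]] // := @fraction_vector k.+1 A m kn hA.
  by move=> j hj; apply: m0; rewrite mem_sub.
exists f, r; split=> //; split=> // [e|_ _]; first by move: AC; rewrite e eqxx.
split=> //.
- move=> j jA; have [jk|jk] := ltnP (lab j) k.+1; first by rewrite rk // tcoord_lt.
  by rewrite tcoord_T.
- exact: rs.
by rewrite rk ?eqxx // cE.
Qed.

Section StepProof.
Variables (mu : 'cV[int]_n) (B : {set 'I_s}) (f : 'I_#|Sigma| -> S).
Variable r : 'I_#|Sigma| -> 'I_n.+1 -> L.
Hypothesis hs : step_data mu B f r.

Let eT : 'I_n.+1 -> L := evec T.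
Let eh : 'I_n.+1 -> L := fun l => evec c l / gap k.
Let sk : 'I_n.+1 -> L := fun l => if l == c then gap k else 1.
(** The cones [sigma k] and [sigma k.+1] receive x and y. The choice (eT, eh) yields a system of
    stage k; (eh, eT), with coordinate k multiplied by [gap k], one of stage k + 1, called [Vp]; and
    (eT, eT) a mixed system, with the coordinates of stage k + 1 and the coefficients of stage k. *)
Let W (x y : 'I_n.+1 -> L) (v : 'I_#|Sigma|) : 'I_n.+1 -> L :=
  if enum_val v == sigma k then x else if enum_val v == sigma k.+1 then y else r v.
Let Vp v l := sk l * W eh eT v l.

Lemma tcoord_neqT i (j : 'I_s) : (i <= n)%N -> (lab j < i)%N -> tcoord i j != T.
Proof. by move=> hi h; rewrite -val_eqE /= tcoord_lt // ltn_eqF // (leq_trans h hi). Qed.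

Lemma tcoord_neqc (j : 'I_s) : tcoord k j != c.
Proof.
have [h|h] := ltnP (lab j) k; last by rewrite tcoord_T // eq_sym.
by rewrite -val_eqE /= tcoord_lt ?(ltnW kn) // cE ltn_eqF.
Qed.

Lemma tcoord_succ (j : 'I_s) : (lab j < k)%N -> tcoord k.+1 j = tcoord k j.
Proof. by move=> h; rewrite /tcoord h ltnS ltnW. Qed.

Lemma scal_c : scal k c = gap k.
Proof. by rewrite /scal cE ltnn (negPf cT). Qed.

Lemma scal_T i : scal i T = 1.
Proof. by rewrite /scal eqxx orbT. Qed.

Lemma scal_succ l : scal k.+1 l * sk l = scal k l.
Proof.
rewrite /sk; have [->|lc] := eqVneq l c; first by rewrite scal_c /scal cE ltnSn mul1r.
rewrite mulr1 /scal ltnS leq_eqVlt.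
by have := lc; rewrite -val_eqE /= cE => /negPf ->.
Qed.

Lemma eh_sum : \sum_l scal k l * eh l = 1.
Proof.
have -> : \sum_l scal k l * eh l = (\sum_l scal k l * evec c l) / gap k.
  by rewrite mulr_suml; apply: eq_bigr => l _; rewrite /eh mulrA.
by rewrite evec_sum scal_c divff ?gap_neq0.
Qed.

Lemma eT_sum : \sum_l scal k l * eT l = 1.
Proof. by rewrite evec_sum scal_T. Qed.

Lemma W_sum x y v : \sum_l scal k l * x l = 1 -> \sum_l scal k l * y l = 1 ->
  \sum_l scal k l * W x y v l = 1.
Proof.
move=> hx hy; rewrite /W; case: eqVneq => // h1; case: eqVneq => // h2.
exact: step_sum hs _ h1 h2.
Qed.

Lemma eT_regular v l : regular eta (f v * X) (eT l).
Proof. exact: chart_evec (step_chart hs v). Qed.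

Lemma gap_regular v : regular eta (f v * X) (gap k).
Proof.
apply: (chart_regularX (step_chart hs v)); apply: (laurent_regular (c := 1 - 1)).
by apply: laurentD; [exact: laurent1|apply/laurentN/laurent_chim].
Qed.

Lemma fX_neq0 v : f v * X != 0.
Proof. by have [_ f0 _ _] := step_chart hs v; rewrite mulf_neq0 ?allX_neq0. Qed.

Lemma eh_regular v l : enum_val v = sigma k.+1 -> regular eta (f v * X) (eh l).
Proof.
move=> h; apply: (regularM (fX_neq0 v)); first exact: chart_evec (step_chart hs v).
exact: chart_regular (step_chart hs v) (step_gap hs h).
Qed.

Lemma sk_regular v l : regular eta (f v * X) (sk l).
Proof.
rewrite /sk; case: ifP => _; first exact: gap_regular.
by have := chart_evec l l (step_chart hs v); rewrite /evec eqxx.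
Qed.

Lemma sk_eh l : sk l * eh l = evec c l.
Proof.
rewrite /sk /eh /evec; case: ifP => _; last by rewrite mul0r mulr0.
by rewrite mul1r divff ?gap_neq0.
Qed.

Lemma evec_neq (i i' : 'I_n.+1) : i' != i -> evec i i' = 0.
Proof. by rewrite /evec => /negPf ->. Qed.

Lemma system_pi : system (tcoord k) (scal k) enum_val f (W eT eh).
Proof.
split; [exact: step_cover hs|move=> v|by move=> v; exact: (W_sum v eT_sum eh_sum)].
apply: (chart_vertex (step_chart hs v)) => [l|j jA]; rewrite /W.
  case: eqVneq => h1; first exact: eT_regular.
  by case: eqVneq => h2; [exact: eh_regular|exact: step_regular hs v l].
case: eqVneq => h1.
  by apply: evec_neq; apply: tcoord_neqT; rewrite ?(ltnW kn) // -mem_sub ?(ltnW kn) // -h1.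
case: eqVneq => h2; first by rewrite /eh evec_neq ?mul0r // tcoord_neqc.
have [h|h] := ltnP (lab j) k; last by rewrite tcoord_T // (step_T hs).
by rewrite -tcoord_succ // (step_vanish hs h1 h2).
Qed.

Lemma system_tot : system (tcoord k.+1) (scal k) enum_val f (W eT eT).
Proof.
split; [exact: step_cover hs|move=> v|by move=> v; exact: (W_sum v eT_sum eT_sum)].
apply: (chart_vertex (step_chart hs v)) => [l|j jA]; rewrite /W.
  case: eqVneq => h1; first exact: eT_regular.
  by case: eqVneq => h2; [exact: eT_regular|exact: step_regular hs v l].
case: eqVneq => h1.
  apply: evec_neq; apply: tcoord_neqT => //; apply: (ltn_trans _ (ltnSn k)).
  by rewrite -mem_sub ?(ltnW kn) // -h1.
case: eqVneq => h2; first by apply: evec_neq; apply: tcoord_neqT => //; rewrite -mem_sub // -h2.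
exact: (step_vanish hs h1 h2 jA).
Qed.

Lemma system_pi' : system (tcoord k.+1) (scal k.+1) enum_val f Vp.
Proof.
split; [exact: step_cover hs|move=> v|move=> v]; last first.
  rewrite -[RHS](W_sum v eh_sum eT_sum); apply: eq_bigr => l _.
  by rewrite mulrA scal_succ.
apply: (chart_vertex (step_chart hs v)) => [l|j jA]; rewrite /Vp /W.
  case: eqVneq => h1; first by rewrite sk_eh; exact: chart_evec (step_chart hs v).
  apply: (regularM (fX_neq0 v)); first exact: sk_regular.
  by case: eqVneq => h2; [exact: eT_regular|exact: step_regular hs v l].
case: eqVneq => h1.
  have jk : (lab j < k)%N by rewrite -mem_sub ?(ltnW kn) // -h1.
  by rewrite sk_eh tcoord_succ // evec_neq // tcoord_neqc.
case: eqVneq => h2.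
  by rewrite [eT _]evec_neq ?mulr0 //; apply: tcoord_neqT => //; rewrite -mem_sub // -h2.
by rewrite (step_vanish hs h1 h2 jA) mulr0.
Qed.

(** [det_exchange] for the two cones of the flag; the factor (gap k)^-1 undoes the scaling of
    coordinate k in [Vp]. *)
Lemma det_tot (t : {ffun 'I_n.+1 -> 'I_#|Sigma|}) :
  \det (\matrix_(i, l) W eT eT (t i) l) =
  \det (\matrix_(i, l) W eT eh (t i) l) + (gap k)^-1 * \det (\matrix_(i, l) Vp (t i) l).
Proof.
have -> : \matrix_(i, l) Vp (t i) l =
    \matrix_(i, l) ((if l == c then gap k else 1) * (\matrix_(i, l) W eh eT (t i) l) i l).
  by apply/matrixP => i l; rewrite !mxE.
rewrite det_scale_col mulrA mulVf ?gap_neq0 // mul1r.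
apply: (@det_exchange _ _ _ T (fun v => enum_val v == sigma k) (fun v => enum_val v == sigma k.+1)).
- by move=> v v' /eqP e /eqP e'; apply: enum_val_inj; rewrite e e'.
- by move=> v v' /eqP e /eqP e'; apply: enum_val_inj; rewrite e e'.
- by rewrite /eh evec_neq ?mul0r // eq_sym.
by move=> v _ _; exact: step_T hs v.
Qed.

(* Only the members of the cover given by sigma k and sigma (k + 1) contribute to
   the coordinate T. *)
Lemma det_T0 (y : 'I_n.+1 -> L) q (u : 'I_q -> 'I_n.+1) (l0 : 'I_q) (g : 'I_n.+1 -> L)
    (t : 'I_q -> 'I_#|Sigma|) x : u l0 = T -> x T = 0 ->
  (forall i, enum_val (t i) != sigma k.+1) ->
  \det (\matrix_(i, l) (g (u l) * W x y (t i) (u l))) = 0.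
Proof.
move=> ul xT ht; rewrite (expand_det_col _ l0) big1 // => i _; rewrite mxE ul /W (negPf (ht i)).
by case: ifP; rewrite ?xT ?(step_T hs) mulr0 mul0r.
Qed.

Let n0 : (0 < n)%N. Proof. exact: leq_ltn_trans kn. Qed.
Let hv := let: And3 _ hv _ := system_pi in hv.

Lemma step_one q (t : 'I_q -> 'I_#|Sigma|) : regular eta ((\prod_i f (t i)) * X) 1.
Proof. by have [D hD] := prod_hom hv t; exact: regular1 (homM hD (@hom_allX _ _ eta K)). Qed.

Lemma notin_codom_lift q (i i' : 'I_q.+1) : i' \notin codom (lift i) -> i' = i.
Proof.
by move=> h; apply/eqP; apply: contraR h; rewrite eq_sym => /unlift_some[j -> _]; exact: codom_f.
Qed.

(* No variable has coordinate l, so the form extends over every divisor. *)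
Lemma tr_pi_shift l nu : (k <= l < n)%N ->
  tr f (dcoch (chim (nu + mb l)) (W eT eh)) = tr f (dcoch (chim nu) (W eT eh)).
Proof.
move=> /andP[kl ln]; have sys := system_pi; have hf := step_cover hs.
pose lc : 'I_n.+1 := inord l; have lcE : lc = l :> nat by rewrite inordK // ltnS ltnW.
have lcT : lc != T by rewrite -val_eqE /= lcE ltn_eqF.
have sc : scal k lc = gap l by rewrite /scal lcE ltnNge kl (negPf lcT).
have [N hN] := minor_cochain hv (u := lift lc) (fun t _ => step_one t).
have cb : cochain eta f (dcoch (chim nu * 1) (fun v i => W eT eh v (lift lc i))).
  apply: hN => t _ j _ /notin_codom_lift e.
  have [h|h] := ltnP (lab j) k; last by move: lcT; rewrite -e tcoord_T ?eqxx.
  have := congr1 (@nat_of_ord _) e; rewrite tcoord_lt ?(ltnW kn) // lcE => e'.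
  by move: h; rewrite e' ltnNge kl.
have gl : laurent eta (gap l) (1 - 1) by apply: laurentD; [exact: laurent1|apply/laurentN/laurent_chim].
have hc : cocycle eta f (dcoch (chim nu * 1 * scal k lc) (W eT eh)).
  rewrite sc mulr1; apply: (system_cocycle_mul sys) => t _.
  have [D hD] := prod_hom hv t.
  rewrite mulrC; apply: (regular_mulr (allX_neq0 s K) (@hom_allX _ _ eta K) hD (prod_neq0 hv t)).
  exact: laurent_regular gl.
have h := tr_coboundary hTr sys n0 hc cb.
apply: (tr_dcochB hTr hf (system_cocycle sys nu) (system_cocycle sys (nu + mb l))).
by rewrite -[RHS]h sc /gap mulr1 mulrBr mulr1 -chimD.
Qed.

(** mu vanishes on the labels below k, hence is a combination of the m_l with l >= k, and each of
    these may be added by [tr_pi_shift]. *)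
Lemma tr_pi_mu i nu :
  tr f (dcoch (chim (nu + mu *+ i)) (W eT eh)) = tr f (dcoch (chim nu) (W eT eh)).
Proof.
have [a a0 muE] := mbE (ltnW kn) (step_mu0 hs).
have h l : (l < n)%N -> a l != 0 ->
    shift_invariant (fun nu => tr f (dcoch (chim nu) (W eT eh))) (mb l).
  move=> ln al nu'; apply: tr_pi_shift; rewrite ln andbT leqNgt.
  by apply: contra al => /a0 ->.
have := shift_invariantMn i (shift_invariant_comb h); rewrite -muE; exact.
Qed.

Lemma evDMn (nu m : 'cV[int]_n) i j : ev (nu + m *+ i) j = ev nu j + i%:Z * ev m j.
Proof. by rewrite evD evMn -mulr_natl natz. Qed.

Definition bound (nu : 'cV[int]_n) : nat := \sum_j absz (ev nu j).
Lemma boundP nu j : `|ev nu j| <= (bound nu)%:Z.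
Proof. by rewrite /bound (bigD1 j) //= PoszD -abszE lerDl. Qed.

(** The minor omitting T can have poles only along variables of label greater than k. Its column k
    is zero unless the tuple contains B, and mu is positive on the rays of B with such labels. *)
Lemma tr_tot0 nu : exists M0 : nat, forall M : nat, (M0 <= M)%N ->
  tr f (dcoch (chim (nu + mu *+ M)) (W eT eT)) = 0.
Proof.
have sys := system_tot; have [_ hvt _] := sys.
have [N hN] := minor_cochain hvt (u := lift T) (fun t _ => step_one t).
exists (N + bound nu)%N => M hM.
have cb : cochain eta f (dcoch (chim (nu + mu *+ M) * 1) (fun v i => W eT eT v (lift T i))).
  apply: hN => t d0 j jA /notin_codom_lift e.
  have jk : (k < lab j)%N.
    by rewrite ltnNge; apply/negP => h; have := tcoord_neqT kn (h : (lab j < k.+1)%N); rewrite e eqxx.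
  have [i hi] : exists i, enum_val (t i) = B.
    have [c' cc' _] : {c' | c = lift T c' & unlift T c = Some c'}.
      by apply: unlift_some; rewrite eq_sym.
    apply: NNPP => hn; move/negP: d0; apply; rewrite (expand_det_col _ c') big1 // => i _.
    rewrite mxE -cc' (_ : W _ _ _ _ = 0) ?mul0r // /W.
    case: eqVneq => h1; first by apply: evec_neq.
    case: eqVneq => h2; first by apply: evec_neq.
    by apply/eqP/negPn/negP => h3; apply: hn; exists i; exact: (step_c hs h1 h2 h3).
  have jB : j \in B by rewrite -hi.
  have [_ mj] := step_B hs jB (ltnW jk); rewrite evDMn.
  exact: shift_bound (boundP nu j) mj hM.
have := tr_coboundary hTr sys n0 (k := T) _ cb; rewrite scal_T !mulr1; apply.
exact: system_cocycle sys _.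
Qed.

(** Only the chart of [sigma k.+1] has a nonzero coordinate T, and [gap k] is invertible on it. *)
Lemma det_pi'_gap q (u : 'I_q -> 'I_n.+1) (l0 : 'I_q) (t : {ffun 'I_q -> 'I_#|Sigma|}) : u l0 = T ->
  \det (\matrix_(i, l) Vp (t i) (u l)) != 0 -> regular eta ((\prod_i f (t i)) * X) (gap k)^-1.
Proof.
move=> ul d0; have [_ hv' _] := system_pi'.
have [i hi] : exists i, enum_val (t i) = sigma k.+1.
  apply: NNPP => hn; move/negP: d0; apply; apply/eqP.
  apply: (@det_T0 eT q u l0 sk t eh ul); first by rewrite /eh evec_neq ?mul0r // eq_sym.
  by move=> i; apply/eqP => h; apply: hn; exists i.
apply: (prod_regular hv' (i := i)); exact: chart_regular (step_chart hs _) (step_gap hs hi).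
Qed.

Lemma cocycle_pi'_gap nu : cocycle eta f (dcoch (chim nu * (gap k)^-1) Vp).
Proof. by apply: (system_cocycle_mul system_pi') => t; exact: (@det_pi'_gap _ id T). Qed.

(** The minor omitting coordinate k still contains T, so (gap k)^-1 is regular where it is nonzero.
    Its poles are along variables labelled k, on which m_k is positive. *)
Lemma tr_pi'0 nu : exists M0 : nat, forall M : nat, (M0 <= M)%N ->
  tr f (dcoch (chim (nu + mb k *+ M) * (gap k)^-1) Vp) = 0.
Proof.
have sys := system_pi'; have [_ hv' _] := sys.
have [l0 ll0 _] : {l0 | T = lift c l0 & unlift c T = Some l0} by exact: unlift_some.
have [N hN] := minor_cochain hv' (u := lift c)
  (fun t => @det_pi'_gap _ (lift c) l0 t (esym ll0)).
exists (N + bound nu)%N => M hM.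
have cb : cochain eta f (dcoch (chim (nu + mb k *+ M) * (gap k)^-1) (fun v i => Vp v (lift c i))).
  apply: hN => t d0 j jA /notin_codom_lift e.
  have jk : lab j = k.
    have [h|h] := ltnP (lab j) k.+1; last by move: cT; rewrite -e tcoord_T ?eqxx.
    by rewrite -cE -e tcoord_lt.
  rewrite evDMn; exact: shift_bound (boundP nu j) (mb1 kn jk) hM.
have sc1 : scal k.+1 c = 1 by rewrite /scal cE ltnSn.
have := tr_coboundary hTr sys n0 (k := c) _ cb; rewrite sc1 mulr1; apply.
exact: cocycle_pi'_gap.
Qed.

Lemma tr_pi_split nu : tr f (dcoch (chim nu) (W eT eT)) =
  tr f (dcoch (chim nu) (W eT eh)) + tr f (dcoch (chim nu * (gap k)^-1) Vp).
Proof.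
have hf := step_cover hs; rewrite -(trD hTr hf (system_cocycle system_pi nu) (cocycle_pi'_gap nu)).
congr (tr f _); apply/ffunP => t; rewrite !ffunE det_tot.
move: (\det _) (\det _) => d d'; rewrite mulrDr mulrA mulrDl; exact: scalerDl.
Qed.

Lemma perp_shift i nu m M : (forall j, (lab j < i)%N -> ev m j = 0) ->
  perp i (nu + m *+ M) = perp i nu.
Proof.
move=> hm; apply: eq_forallb => j; have [ji|//] := ltnP (lab j) i.
by rewrite evDMn hm // mulr0 addr0.
Qed.

(** On the rays labelled k, nu agrees with a_k m_k for a coefficient a_k <= 0, so i0 = -a_k. *)
Lemma perp_succ nu : perp k nu -> (forall j, lab j = k -> ev nu j <= 0) ->
  exists i0 : nat, (i0 <= bound nu)%N /\
    forall i : nat, perp k.+1 (nu + mb k *+ i) = (i == i0).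
Proof.
move=> /perpP hp hle; have [a a0 nuE] := mbE (ltnW kn) hp.
have evk j : lab j = k -> ev nu j = a k * ev (mb k) j.
  move=> jk; rewrite nuE /ev mulmx_sumr summxE (bigD1 (Ordinal kn)) //= -scalemxAr mxE.
  rewrite big1 ?addr0 // => l lk; rewrite -scalemxAr mxE.
  have [h|h] := ltnP l k; first by rewrite a0 // mul0r.
  rewrite [X in _ * X]mb0 ?mulr0 ?jk // ltn_neqAle h andbT.
  by move: lk; rewrite -val_eqE /= eq_sym.
have [j0 hj0] := exists_lab hfan hflag kn.
have p0 := mb1 kn hj0; have ak : a k <= 0.
  by have := hle j0 hj0; rewrite evk // pmulr_lle0.
exists (absz (a k)); split.
  have := boundP nu j0; rewrite evk // normrM (gtr0_norm p0) -lez_nat => h.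
  apply: le_trans h; rewrite -abszE ler_peMr //.
move=> i; have -> : (i == absz (a k)) = (a k + i%:Z == 0).
  by apply/eqP/eqP; lia.
apply/perpP/eqP => [h|h j].
  have := h j0; rewrite hj0 ltnSn evDMn evk // -mulrDl => /(_ isT) /eqP.
  by rewrite mulf_eq0 (gt_eqF p0) orbF => /eqP.
rewrite ltnS leq_eqVlt => /orP[/eqP jk|jk]; rewrite evDMn.
  by rewrite evk // -mulrDl h mul0r.
by rewrite hp // mb0 // mulr0 addr0.
Qed.

(** A twist by a large multiple of mu kills the mixed class and leaves the trace at stage k
    unchanged, so that the latter is minus the trace of the class of stage k + 1 divided by [gap k].
    The quotient is a finite geometric sum of twists by i m_k, up to a remainder of trace 0. By the
    claim for k + 1, at most one of these twists contributes. *)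
Lemma tr_pi nu x : claim k.+1 x ->
  tr f (dcoch (chim nu) (W eT eh)) = if perp k nu then (-1) ^+ (n - k) * x else 0.
Proof.
(* The summand [bound nu] makes nu + M mu nonpositive on the rays labelled k, where mu is
   negative. *)
move=> hx; have [M1 hM1] := tr_tot0 nu; pose M := (M1 + bound nu)%N.
have hM : (M1 <= M)%N by exact: leq_addr.
have {hM1} tot0 := hM1 M hM; pose nu' := nu + mu *+ M.
(* Large enough for the contributing index, at most [bound nu'], to occur in the sum. *)
have [M2 hM2] := tr_pi'0 nu'; pose M' := (M2 + bound nu').+1.
have hM' : (M2 <= M')%N by rewrite /M' -addnS leq_addr.
have {hM2} pi0 := hM2 M' hM'.
have perp' : perp k nu' = perp k nu by apply: perp_shift; exact: step_mu0 hs.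
have gE : chim nu' * (gap k)^-1 =
    \sum_(i < M') chim (nu' + mb k *+ i) + chim (nu' + mb k *+ M') * (gap k)^-1.
  have := geometric eta K (mb k) M' => /(canRL (mulfK gap_neq0)) h.
  have -> : \sum_(i < M') chim (nu' + mb k *+ i) = chim nu' * \sum_(i < M') chim (mb k *+ i).
    by rewrite mulr_sumr; apply: eq_bigr => i _; rewrite chimD.
  by rewrite h chimD -mulrA -mulrDr mulrBl mul1r subrK.
have trs : tr f (dcoch (chim nu' * (gap k)^-1) Vp) =
    \sum_(i < M') if perp k.+1 (nu' + mb k *+ i) then (-1) ^+ (n - k.+1) * x else 0.
  rewrite gE (tr_dcochD hTr (step_cover hs)); last 2 first.
  - exact: system_cocycle_geometric system_pi' _ _ _.
  - exact: cocycle_pi'_gap.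
  rewrite pi0 addr0; have -> := tr_geometric hTr system_pi' nu' (mb k) M'; apply: eq_bigr => i _.
  exact: hx system_pi'.
rewrite (addr_opp (tr_pi_split nu') tot0 (tr_pi_mu M nu)) trs.
case: ifP => pk; rewrite pk in perp'; last first.
  rewrite big1 ?oppr0 // => i _; case: ifP => // /perpP h.
  have : perp k (nu' + mb k *+ i) by apply/perpP => j jk; apply: h; rewrite ltnW.
  by rewrite perp_shift ?perp' //; exact: mb0.
have hle j : lab j = k -> ev nu' j <= 0.
  move=> jk; have mj := step_mu hs jk; rewrite /nu' evDMn.
  have h := @shift_bound (- ev nu j) (- ev mu j) 0 (bound nu) M.
  rewrite normrN oppr_gt0 add0n leq_addl mulrN in h.
  by have := h (boundP nu j) mj isT; rewrite -opprD oppr_ge0.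
have [i0 [hi0 pE]] := perp_succ perp' hle.
have i0M : (i0 < M')%N by rewrite /M' ltnS (leq_trans hi0) // leq_addl.
rewrite (bigD1 (Ordinal i0M)) //= pE eqxx big1 ?addr0; last first.
  by move=> i; rewrite -val_eqE /= pE => /negPf ->.
by rewrite -(subnSK kn) exprS mulN1r mulNr.
Qed.
End StepProof.

Lemma claim_step x : claim k.+1 x -> claim k x.
Proof.
move=> hx nu m A f' V' sys'; have [mu [B [f [r hs]]]] := step_data_exists.
by rewrite (tr_indep hTr nu sys' (system_pi hs)) (tr_pi hs nu hx).
Qed.
End OneStep.
End Step.

(** * The invariant form in homogeneous coordinates *)

Section WedgeDchi.
Variables (n s : nat) (eta : 'M[int]_(s, n)) (K : fieldType).
Local Notation S := {mpoly K[s]}.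
Local Notation L := {fraction S}.
Local Notation X := (allX s K).

Lemma allX_prod : X%:F = \prod_j (var K j).
Proof. by rewrite /allX tofracXE; apply: eq_bigr => j _; rewrite mnmE expr1. Qed.

Lemma det_scale_rows_cols (F : fieldType) q (M : 'M[F]_q) (a b : 'I_q -> F) :
  \det (\matrix_(i, k) (a i * M i k * b k)) = (\prod_i a i) * \det M * \prod_k b k.
Proof.
have -> : \matrix_(i, k) (a i * M i k * b k) = diag_mx (\row_i a i) *m M *m diag_mx (\row_k b k).
  by apply/matrixP => i k; rewrite mul_mx_diag mul_diag_mx !mxE.
rewrite !det_mulmx !det_diag; congr (_ * _ * _); by apply: eq_bigr => i _; rewrite mxE.
Qed.

Lemma frac_cancel (F : fieldType) (a d b y z : F) : y != 0 -> z != 0 -> b = y^-1 ->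
  a * d * b = a / (y * z) * (d * z).
Proof. by move=> y0 z0 ->; field; rewrite y0 z0. Qed.

(** Row l carries a factor chi_l and column j a factor 1 / x_j. The variables outside I, which occur
    in Omega, complete the denominator to X. *)
Lemma wedge_dchi : wedge (dchi eta K) = ((\prod_l chi eta K l) / X%:F) *: Omega eta K.
Proof.
apply/ffunP => I; rewrite !ffunE; case: eqP => [cI|_]; last first.
  by rewrite mul0r; exact/esym/scaler0.
have XE : X%:F = (\prod_(j in I) var K j) * \prod_(j in ~: I) var K j.
  rewrite allX_prod (bigID (mem I)) /=; congr (_ * _); apply: eq_bigl => j.
  by rewrite inE.
(* Without rays there is no default index for [nth]; then n = 0 too, and the determinants are
   empty. *)
case: (posnP s) => [s0|s1].
  have [n0 I0] : n = 0%N /\ I = set0.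
    have I0 : I = set0 by apply/setP => j; have := ltn_ord j; rewrite {2}s0.
    by split=> //; rewrite -cI I0 cards0.
  have d1 (M : 'M[L]_n) : \det M = 1 by move: M; rewrite n0 => M; exact: det_mx00.
  rewrite !d1 mul1r XE !big1 ?mulr1 ?divr1 ?mul1r //.
  - by symmetry; exact: mulr1.
  - by move=> j; have := ltn_ord j; rewrite {2}s0.
  - by move=> j; have := ltn_ord j; rewrite {2}s0.
  by move=> l; have := ltn_ord l; rewrite {2}n0.
pose j0 : 'I_s := Ordinal s1.
have sz : size (enum I) = n by rewrite -cardE.
have nthE (theta : 'I_s -> L) (k : 'I_n) :
    [seq theta j | j <- enum I]`_k = theta (nth j0 (enum I) k).
  by rewrite (nth_map j0) // sz.
have -> : \matrix_(l < n, k < n) [seq dchi eta K l j | j <- enum I]`_k =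
    \matrix_(l < n, k < n) (chi eta K l *
      (\matrix_(l < n, k < n) [seq ((eta j l)%:~R : L) | j <- enum I]`_k) l k *
      (var K (nth j0 (enum I) k))^-1).
  by apply/matrixP => l k; rewrite !mxE !nthE.
rewrite det_scale_rows_cols XE; apply: frac_cancel.
- by apply/prodf_neq0 => j _; exact: var_neq0.
- by apply/prodf_neq0 => j _; exact: var_neq0.
rewrite -prodfV; symmetry; rewrite -[LHS]big_enum /= (big_nth j0) sz big_mkord.
by [].
Qed.
End WedgeDchi.

(** * Normalization at the identity of the torus *)

Section Normalization.
Variables (R : realFieldType) (n s : nat) (eta : 'M[int]_(s, n)) (Sigma : {set {set 'I_s}}).
Hypothesis hfan : is_fan eta Sigma R.
Hypothesis hcomp : complete_fan eta Sigma R.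
Variable D0 : 'cV[int]_s.
Hypothesis hD0 : ample eta Sigma D0.
Variable K : fieldType.
Local Notation S := {mpoly K[s]}.
Local Notation L := {fraction S}.
Local Notation ev := (ev eta).
Local Notation hom := (homogeneous eta).
Local Notation X := (allX s K).
Local Notation chim := (chim eta K).
Local Notation chi := (chi eta K).
Local Notation dcoch := (dcoch eta).
Local Notation chart := (chart eta Sigma).
Local Notation system := (@system n s eta Sigma K).
Local Notation laurent := (@laurent n s eta K).
Local Notation evec := (@evec s K _).
Variable Tr : forall m, ('I_m -> S) -> precochain s K n.+1 m -> K.
Hypothesis hTr : is_trace eta Sigma Tr.
Local Notation tr := (@Tr _).
Variable sigma : nat -> {set 'I_s}.
Hypothesis hflag : complete_flag eta Sigma sigma.
Local Notation lab := (@lab n s sigma).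
Local Notation T := (@ord_max n).
Variable U : 'M[int]_n.
Hypothesis Uunit : U \in unitmx.
Hypothesis hU : forall k : 'I_n,
  (forall j, (lab j < k)%N -> ev (col k U) j = 0) /\
  (forall j, lab j = k -> 0 < ev (col k U) j).

Definition nat_col (M : 'M[int]_n) (l : nat) : 'cV[int]_n :=
  if insub l is Some i then col i M else 0.
Local Notation mb := (nat_col U).
Local Notation gap := (gap eta K mb).
Local Notation tcoord := (@tcoord n s sigma).
Local Notation coord := (@coord n s sigma).
Local Notation scal := (@scal n s eta K mb).

Lemma nat_colE M (i : 'I_n) : nat_col M i = col i M.
Proof. by rewrite /nat_col valK. Qed.

Lemma mb0 k : (k < n)%N -> forall j, (lab j < k)%N -> ev (mb k) j = 0.
Proof. by move=> kn; rewrite (nat_colE U (Ordinal kn)); case: (hU (Ordinal kn)). Qed.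

Lemma mb1 k : (k < n)%N -> forall j, lab j = k -> 0 < ev (mb k) j.
Proof. by move=> kn; rewrite (nat_colE U (Ordinal kn)); case: (hU (Ordinal kn)). Qed.

Lemma mbE k mu : (k <= n)%N -> (forall j, (lab j < k)%N -> ev mu j = 0) ->
  exists2 a : nat -> int, forall l, (l < k)%N -> a l = 0 & mu = \sum_(l < n) a l *: mb l.
Proof.
move=> kn hmu; have [a a0 muE] := basis_expand hfan hflag Uunit hU kn hmu.
exists (fun l => if insub l is Some i then a i else 0).
  by move=> l lk; case: insubP => // i _ il; apply: a0; rewrite il.
by rewrite {1}muE; apply: eq_bigr => l _; rewrite valK nat_colE.
Qed.

Lemma system_ext q (iota iota' : 'I_s -> 'I_q) (sL sL' : 'I_q -> L) m (A : 'I_m -> {set 'I_s}) f V :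
  iota =1 iota' -> sL =1 sL' -> system iota sL A f V -> system iota' sL' A f V.
Proof.
move=> hi hs [hf hv hsum]; split=> [//|v|v]; last first.
  by rewrite -[RHS](hsum v); apply: eq_bigr => i _; rewrite hs.
by have [h1 h2 h3 h4 h5] := hv v; split=> // j jA; rewrite -hi h5.
Qed.

Lemma claim_top x : flag_value eta Sigma Tr sigma 0 x ->
  claim eta Sigma Tr sigma mb n x.
Proof.
move=> hx nu m A f V sys.
have {}sys : system coord (fun=> 1) A f V.
  apply: (system_ext _ _ sys) => [j|l].
    rewrite /tcoord; case: ifP => // h; apply/val_inj; rewrite /= coordE.
    by apply/eqP; rewrite eqn_leq lab_le andbT leqNgt h.
  rewrite /scal; case: ifP => // /negbT; rewrite negb_or -val_eqE /= -leqNgt => /andP[h1 h2].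
  by move: h2; rewrite eqn_leq h1 -ltnS ltn_ord.
rewrite subnn expr0 mul1r; case: ifP => [/perpP h|h].
  have -> : nu = 0 by apply: (flag_functional0 hfan hflag).
  exact: hx sys.
have nu0 : nu != 0.
  by apply: contraFneq h => ->; apply/perpP => j _; rewrite /ev mulmx0 mxE.
exact: (flag_value0 hfan hcomp hD0 hTr hflag nu0 sys).
Qed.

Lemma claim_all x : flag_value eta Sigma Tr sigma 0 x ->
  claim eta Sigma Tr sigma mb 0 x.
Proof.
move=> hx; suff h d : (d <= n)%N -> claim eta Sigma Tr sigma mb (n - d) x.
  by rewrite -(subnn n); exact: h.
elim: d => [_|d IH dn]; first by rewrite subn0; exact: claim_top.
have kn : (n - d.+1 < n)%N by rewrite ltn_subrL (leq_trans _ dn).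
apply: (claim_step hfan hcomp hD0 hTr hflag mb0 mb1 mbE kn).
by rewrite subnSK //; apply: IH; exact: ltnW.
Qed.

Lemma tr_laurent iota sL m (A : 'I_m -> {set 'I_s}) (f : 'I_m -> S) V g c y :
  system iota sL A f V -> (forall nu, tr f (dcoch (chim nu) V) = y) -> laurent g c ->
  tr f (dcoch g V) = c%:~R * y.
Proof.
move=> sys hy [r [-> ->]]; have [hf _ _] := sys.
elim: r => [|x r IH]; first by rewrite !big_nil dcoch0 (tr0 hTr hf) mul0r.
have hr : cocycle eta f (dcoch (\sum_(x <- r) x.1%:~R * chim x.2) V).
  by apply: (system_cocycle_laurent sys (c := \sum_(x <- r) x.1)); exists r.
rewrite !big_cons dcochD rmorphD mulrDl -IH -(hy x.2).
have -> : x.1%:~R = ((x.1%:~R : K)%:MP : S)%:F :> L by rewrite !rmorph_int.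
by rewrite dcochZ; exact: (trace_linear hTr _ hf (system_cocycle sys x.2) hr).
Qed.

Lemma empty_cone : set0 \in Sigma.
Proof. by rewrite -(flag0 hfan hflag); exact: (flag_cone hflag). Qed.

Lemma claim0_system : exists (f : 'I_#|Sigma| -> S) V,
  [/\ system (tcoord 0) (scal 0) enum_val f V,
   forall v, enum_val v = set0 ->
     V v T = 1 /\ exists2 a : 'X_{1..s}, (forall j, 0 < a j)%N & f v = 'X_[a] &
   forall v, enum_val v != set0 -> V v T = 0 /\ (f v).@[fun=> 1] = 0].
Proof.
pose Q (A : {set 'I_s}) (f : S) (V : 'I_n.+1 -> L) :=
  [/\ forall l, regular eta (f * X) (V l), A != set0 -> V T = 0, \sum_l scal 0 l * V l = 1,
   A = set0 -> V T = 1 /\ exists2 a : 'X_{1..s}, (forall j, 0 < a j)%N & f = 'X_[a] &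
   A != set0 -> f.@[fun=> 1] = 0].
have [|f [V [hf hV]]] := @chart_family R n s eta Sigma hfan K n.+1 Q; last first.
  exists f, V; split.
  - split=> [//|v|v]; last by have [_ _ []] := hV v.
    have [hA hc [h1 h2 _ _ _]] := hV v; apply: (chart_vertex hc) => // j jA.
    by rewrite tcoord_T // h2 //; apply/set0Pn; exists j.
  - by move=> v; have [_ _ [_ _ _ h _]] := hV v.
  by move=> v hv; have [_ _ [_ h1 _ _ h2]] := hV v; split; [exact: h1|exact: h2].
move=> A hA; have [A0|A0] := eqVneq A set0.
  have [b hb] := chart_monomial hfan hcomp hD0 K hA.
  exists 'X_[b], (evec T); split=> //; split.
  - by move=> l; exact: chart_evec hb.
  - by rewrite A0 eqxx.
  - by rewrite evec_sum scal_T.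
  - move=> _; split; first by rewrite /evec eqxx.
    exists b => // j; apply: (chart_div hb); first by rewrite msuppX mem_head.
    by rewrite A0 setC0 inE.
  - by rewrite A0 eqxx.
have [mu muA muE] := face_functional hfan hA empty_cone.
have [|||f [r [[hc f1] rr rT _ rs]]] // := fraction_vector (mu := mu) hfan hcomp hD0 K mbE (leq0n n) hA.
  have [j jA] := set0Pn _ A0; exists j => //.
  by rewrite lt0r muA // muE // inE.
exists f, r; split=> //; split=> // [|e]; first exact: rs.
by rewrite e eqxx in A0.
Qed.

(* The equations 1 - chi l of the identity in the standard basis of the character
   lattice; the constant 1 is moved from the last coordinate to ord0. *)
Definition std_scal (i : 'I_n.+1) : L := if unlift ord0 i is Some l then 1 - chi l else 1.

(** P expresses the equations [gap k] through the standard ones. At the identity its determinant is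
    det U up to sign, hence 1 or -1 since U is unimodular. *)
Lemma transition : exists (P : 'M[L]_n.+1) (c : int),
  [/\ laurent (\det P) c, c = 1 \/ c = -1,
      forall i j, exists c, laurent (P i j) c,
      forall i, \sum_j P i j * std_scal j = scal 0 i & forall i, P i ord0 = (i == T)%:R].
Proof.
have h (k : 'I_n) : exists Q : 'I_n -> L, (forall l, laurent (Q l) (U l k)) /\
    1 - chim (col k U) = \sum_l Q l * (1 - chi l).
  pose a l := if insub l is Some i then U i k else 0.
  have [Q [hQ _ E]] := laurent_expand eta K (nat_col 1%:M) a n.
  exists (fun l => Q l); split=> [l|]; first by have := hQ l; rewrite /a valK.
  have <- : \sum_(l < n) a l *: nat_col 1%:M l = col k U.
    apply/colP => i; rewrite summxE !mxE (bigD1 i) //= /a valK nat_colE !mxE eqxx mulr1 big1 ?addr0 //.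
    by move=> l li; rewrite valK nat_colE !mxE eq_sym (negPf li) mulr0.
  rewrite E; apply: eq_bigr => l _; congr (_ * (1 - _)); rewrite chi_chim nat_colE; congr chim.
  by apply/colP => i; rewrite !mxE eqxx andbT.
have [Q hQ] := fin_choice h.
pose P : 'M[L]_n.+1 := \matrix_(i, j) if unlift T i is Some k then
  (if unlift ord0 j is Some l then Q k l else 0) else (j == ord0)%:R.
pose C : 'M[int]_n.+1 := \matrix_(i, j) if unlift T i is Some k then
  (if unlift ord0 j is Some l then U l k else 0) else (j == ord0)%:R.
have PC i j : laurent (P i j) (C i j).
  rewrite !mxE; case: unliftP => [k _|_].
    by case: unliftP => [l _|_]; [case: (hQ k)|exact: laurent0].
  by case: eqP => _; [exact: laurent1|exact: laurent0].
exists P, (\det C); split.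
- exact: laurent_det.
- have -> : \det C = (-1) ^+ (n + 0) * \det U.
    rewrite (expand_det_row _ T) (bigD1 ord0) //= big1 ?addr0.
      rewrite mxE unlift_none eqxx mul1r /cofactor; congr (_ * _).
      by rewrite -[RHS]det_tr; congr (\det _); apply/matrixP => k l; rewrite !mxE !liftK.
    by move=> j j0; rewrite mxE unlift_none (negPf j0) mul0r.
  have u : \det U \is a GRing.unit by rewrite -unitmxE.
  have hd : (\det U == 1) || (\det U == -1) := u.
  rewrite addn0 -signr_odd; case: (odd n) => /=; rewrite ?expr0 ?expr1 ?mulN1r ?mul1r;
    case/orP: hd => /eqP ->; rewrite ?opprK; by [left|right].
- by move=> i j; exists (C i j).
- move=> i; rewrite big_ord_recl /std_scal unlift_none mulr1 mxE unlift_none.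
  case: unliftP => [k ->|->].
    rewrite add0r /scal eq_sym (negPf (neq_lift _ _)) orbF ltn0 /gap.
    have -> : mb (lift T k) = col k U by rewrite -nat_colE lift_max.
    have [_ ->] := hQ k; apply: eq_bigr => l _.
    by rewrite mxE !liftK.
  rewrite eqxx big1 ?addr0 ?scal_T // => l _.
  by rewrite mxE unlift_none eq_sym (negPf (neq_lift _ _)) mul0r.
move=> i; rewrite mxE unlift_none; case: unliftP => [k ->|->]; last by rewrite !eqxx.
by rewrite eq_sym (negPf (neq_lift _ _)).
Qed.

(** The open set chi_l <> 1 of the torus. The binomial is taken for the functional -e_l so that it
    equals a monomial times chi_l - 1, with the sign found in [unit_point_class]. *)
Lemma torus_vertex (l : 'I_n) : exists fb : S,
  [/\ vertex eta Sigma (fun=> ord0) set0 fb (fun j => evec (lift ord0 l) j / (1 - chi l)),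
    exists2 a : 'X_{1..s}, (forall j, 0 < a j)%N & fb%:F = ('X_[a] : S)%:F * (chi l - 1),
    1 - chi l != 0 & fb.@[fun=> 1] = 0].
Proof.
pose d : 'cV[int]_n := delta_mx l 0.
have cd : chi l = chim d by rewrite chi_chim.
have [||b [c [_ cE hdiv [[D hD hhD] [fE f0]] [g0 rg]]]] := @binomial R n s eta Sigma hfan hcomp D0 hD0 K set0 (- d) empty_cone.
- by move=> j; rewrite inE.
- have dn0 : d != 0.
    by apply/eqP => /colP/(_ l); rewrite !mxE !eqxx => /eqP; rewrite oner_eq0.
  apply: NNPP => hn; move/negP: dn0; apply; apply/eqP.
  apply: (flag_functional0 hfan hflag) => j _; apply: NNPP => hj; apply: hn.
  by exists j; rewrite evN oppr_eq0; apply/eqP.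
have bc : b != c by apply: contraNneq f0 => ->; rewrite subrr.
have cs : c \in msupp ('X_[b] - 'X_[c] : S).
  by rewrite mcoeff_msupp mcoeffB !mcoeffX eqxx (negPf bc) sub0r oppr_eq0 oner_eq0.
have cp j : (0 < c j)%N by apply: (hdiv c cs); rewrite inE inE.
have E : 1 - chi l = - chim d * (1 - chim (- d)).
  by rewrite cd mulrBr mulr1 mulNr -chimD subrr chim0 opprK addrC.
have d0 : 1 - chi l != 0 by rewrite E mulf_neq0 // oppr_eq0 chim_neq0.
have fX : ('X_[b] - 'X_[c]) * X != 0 :> S by rewrite mulf_neq0 ?allX_neq0.
exists ('X_[b] - 'X_[c]); split; [split| |exact: d0|exact: binomial_at1].
- by exists D.
- exact: f0.
- exact: hdiv.
- move=> k; apply: (regularM fX).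
    by apply: regular_bool; apply: homM hhD (@hom_allX _ _ eta K).
  rewrite E invfM invrN -chimN; apply: (regularM fX).
    rewrite mulrC; apply: (regular_mulr (allX_neq0 s K) (@hom_allX _ _ eta K) hhD f0).
    by apply: (laurent_regular (c := - 1)); apply/laurentN/laurent_chim.
  exact: (regular_mulr f0 hhD (@hom_allX _ _ eta K) (allX_neq0 s K) rg).
- by move=> j; rewrite inE.
exists c => //; rewrite rmorphB /= -(@chim_mulX _ _ eta K d c b); last first.
  by move=> j; rewrite cE evN subrK.
by rewrite mulrBr mulr1 mulrC cd.
Qed.

Lemma laurent_sign k : laurent ((-1) ^+ k) ((-1) ^+ k).
Proof.
elim: k => [|k IH]; first by rewrite !expr0; exact: laurent1.
by rewrite !exprS; apply: laurentM IH; exact/laurentN/laurent1.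
Qed.

Lemma prod_minus (F : fieldType) k (x : 'I_k -> F) (p z : F) :
  (-1) ^+ k * p * (\prod_l (1 - x l)^-1) / z = (\prod_l (x l - 1))^-1 * (p / z).
Proof.
have -> : \prod_l (1 - x l)^-1 = (-1) ^+ k * (\prod_l (x l - 1))^-1.
  elim: k x => [|k IH] x; first by rewrite !big_ord0 expr0 mul1r invr1.
  rewrite !big_ord_recl IH exprS -[1 - _]opprB invrN invfM; ring.
have : (-1) ^+ k * (-1) ^+ k = 1 :> F by rewrite -exprMn mulrNN mulr1 expr1n.
move: ((-1) ^+ k) (\prod_l _)^-1 => e q ee.
have -> : e * p * (e * q) / z = e * e * (q * (p / z)) by ring.
by rewrite ee mul1r.
Qed.

(** The cover of stage 0 is enlarged by the sets chi_l <> 1. On the tuple kappa the matrix is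
    triangular, with diagonal 1 and (1 - chi_l)^-1, and the class is the one of trace 1. Restricted
    to the cover of stage 0 it is the class of the Laurent polynomial g det P. All twists having the
    same trace there, only the value of g det P at the identity matters, and it is 1 or -1. *)
Lemma unit_value x : claim eta Sigma Tr sigma mb 0 x -> x = 1 \/ x = -1.
Proof.
move=> hx; have [f [V [sys hset0 hne]]] := claim0_system; have [hf hv hsum] := sys.
have [P [c [hP hc Plau Psum P0]]] := transition.
pose V' v j := \sum_i V v i * P i j.
have V'0 v : V' v ord0 = V v T.
  rewrite /V' (bigD1 T) //= P0 eqxx mulr1 big1 ?addr0 // => i /negPf iT.
  by rewrite P0 iT mulr0.
have hv' v : vertex eta Sigma (fun=> ord0) (enum_val v) (f v) (V' v).
  have [hD f0 hdiv hreg hvan] := hv v; split=> // [k|j jA].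
    have [D _ hhD] := hD; have fX : f v * X != 0 by rewrite mulf_neq0 ?allX_neq0.
    have hX := @hom_allX _ _ eta K.
    apply: (big_ind (regular eta (f v * X))) => [|a b|i _].
    - exact: regular0 (homM hhD hX).
    - exact: regularD.
    apply: (regularM fX); first exact: hreg.
    rewrite mulrC; apply: (regular_mulr (allX_neq0 s K) hX hhD f0).
    by have [ci] := Plau i k; exact: laurent_regular.
  rewrite V'0; have h : enum_val v != set0 by apply/set0Pn; exists j.
  by case: (hne v h).
have hs' v : \sum_i std_scal i * V' v i = 1.
  rewrite -[RHS](hsum v) /V'; under eq_bigr do rewrite mulr_sumr.
  rewrite exchange_big; apply: eq_bigr => i _; rewrite -Psum mulr_suml.
  by apply: eq_bigr => j _; rewrite mulrCA [LHS]mulrC [std_scal j * _]mulrC.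
have [fb hfb] := fin_choice torus_vertex.
pose Vb l := fun j : 'I_n.+1 => evec (lift ord0 l) j / (1 - chi l).
pose fe := merge f fb; pose Ve := merge V' Vb.
have syse : system (fun=> ord0) std_scal (merge enum_val (fun=> set0)) fe Ve.
  have hve v : vertex eta Sigma (fun=> ord0) (merge enum_val (fun=> set0) v) (fe v) (Ve v).
    by rewrite /fe /Ve /merge; case: (split v) => l; [exact: hv'|case: (hfb l)].
  split; [split|exact: hve|].
  - by move=> v; have [hD f0 _ _ _] := hve v.
  - move=> L' phi y hy; have [i hi] := hf.2 L' phi y hy.
    by exists (lshift n i); rewrite /fe mergel.
  move=> v; rewrite /Ve /merge; case: (split v) => l; first exact: hs'.
  rewrite /Vb; under eq_bigr do rewrite mulrA.
  rewrite -mulr_suml evec_sum /std_scal liftK; apply: divff; by case: (hfb l).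
have [hfe hve hse] := syse.
(* The product of the characters comes from [wedge_dchi], and the sign turns the n factors 1 - chi_l
   into chi_l - 1. *)
pose g : L := (-1) ^+ n * \prod_l chi l.
have hg : laurent g ((-1) ^+ n * \prod_(l < n) 1).
  apply: laurentM.
    exact: laurent_sign.
  by apply: laurent_prod => l _; rewrite chi_chim; exact: laurent_chim.
pose v0 := enum_rank_in empty_cone set0.
have v0E : enum_val v0 = set0 by rewrite enum_rankK_in // empty_cone.
have [VT [a0 a0p fv0]] := hset0 v0 v0E.
pose kappa : {ffun 'I_n.+1 -> 'I_(#|Sigma| + n)} :=
  [ffun i => if unlift ord0 i is Some l then rshift #|Sigma| l else lshift n v0].
have k0 : kappa ord0 = lshift n v0 by rewrite ffunE unlift_none.
have kS l : kappa (lift ord0 l) = rshift #|Sigma| l by rewrite ffunE liftK.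
have Ve0 v : v != kappa ord0 -> Ve v ord0 = 0 /\ (fe v).@[fun=> 1] = 0.
  rewrite k0; case: (split_ordP v) => l -> hl.
    rewrite /Ve /fe !mergel V'0; apply: hne; apply: contra hl => /eqP h.
    by rewrite (enum_val_inj (etrans h (esym v0E))).
  rewrite /Ve /fe !merger /Vb (_ : evec _ _ = 0) ?mul0r; first by case: (hfb l).
  by rewrite /evec (negPf (neq_lift _ _)).
have unit : unit_point_class eta fe (dcoch g Ve).
  split; first exact: (system_cocycle_laurent syse hg).
  exists kappa; split.
  - by exists a0 => //; rewrite k0 /fe mergel.
  - by move=> l; have [_ h _ _] := hfb l; rewrite kS /fe merger.
  - by move=> v /Ve0[].
  - move=> t ht; rewrite ffunE (_ : \det _ = 0) ?mulr0 ?mul0r; first exact: scale0r.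
    rewrite (expand_det_col _ ord0) big1 // => i _; rewrite mxE.
    have [|-> _] := Ve0 (t i); last exact: mul0r.
    by apply: contra ht => /eqP <-; exact: codom_f.
  rewrite ffunE wedge_dchi scalerA; congr (_ *: _).
  have -> : \det (\matrix_(i, k) Ve (kappa i) k) = \prod_l (1 - chi l)^-1.
    rewrite (expand_det_col _ ord0) big_ord_recl big1 ?addr0; last first.
      move=> l _; rewrite mxE (Ve0 _ _).1 ?mul0r // kS k0.
      by rewrite eq_rlshift.
    rewrite mxE k0 /Ve mergel V'0 VT mul1r /cofactor addn0 expr0 mul1r.
    have -> : row' ord0 (col' ord0 (\matrix_(i, k) merge V' Vb (kappa i) k)) =
        diag_mx (\row_l (1 - chi l)^-1).
      apply/matrixP => l l'; rewrite !mxE kS merger /Vb /evec (inj_eq lift_inj) eq_sym.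
      by case: eqP => _; rewrite ?mul1r ?mul0r ?mulr1n ?mulr0n.
    by rewrite det_diag; apply: eq_bigr => l _; rewrite mxE.
  exact: prod_minus.
have h1 := trace_residue hTr hfe unit.
have rl : refinement (lshift n) fe f.
  by move=> j; exists 1%N, 1; rewrite /fe mergel mul1r.
have h2 := trace_refinement hTr hfe hf rl (system_cocycle_laurent syse hg).
rewrite h1 pullback_dcoch in h2.
have E : dcoch g (fun v => Ve (lshift n v)) = dcoch (g * \det P) V.
  apply: eq_dcoch => t; rewrite -[RHS]mulrA [\det P * _]mulrC -det_mulmx; congr (_ * \det _).
  by apply/matrixP => i k; rewrite !mxE /Ve mergel; apply: eq_bigr => j _; rewrite mxE.
rewrite E (tr_laurent (y := (-1) ^+ n * x) sys _ (laurentM hg hP)) in h2; last first.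
  move=> nu; rewrite (hx nu _ _ _ _ sys) subn0 (_ : perp _ _ _ _ = true) //.
  by apply/perpP.
move: h2; rewrite big1 // mulr1 rmorphM rmorphXn rmorphN rmorph1 mulrACA -exprMn mulrNN mulr1 expr1n mul1r.
case: hc => ->; rewrite ?rmorphN rmorph1 ?mulN1r ?mul1r; first by left.
by move=> <-; right; rewrite opprK.
Qed.
End Normalization.

(** * The residue of Delta *)

Section FlagDeterminant.
Variables (R : realFieldType) (n s : nat) (eta : 'M[int]_(s, n)) (Sigma : {set {set 'I_s}}).
Hypothesis hfan : is_fan eta Sigma R.
Hypothesis hcomp : complete_fan eta Sigma R.
Variable D0 : 'cV[int]_s.
Hypothesis hD0 : ample eta Sigma D0.
Variable K : fieldType.
Local Notation S := {mpoly K[s]}.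
Local Notation L := {fraction S}.
Local Notation hom := (homogeneous eta).
Local Notation X := (allX s K).
Local Notation chim := (chim eta K).
Local Notation dcoch := (dcoch eta).
Local Notation cover := (open_cover eta Sigma).
Local Notation evec := (@evec s K _).
Variable Tr : forall m, ('I_m -> S) -> precochain s K n.+1 m -> K.
Hypothesis hTr : is_trace eta Sigma Tr.
Local Notation tr := (@Tr _).
Variable sigma : nat -> {set 'I_s}.
Hypothesis hflag : complete_flag eta Sigma sigma.
Local Notation coord := (@coord n s sigma).
Local Notation z := (@zexp n s sigma).

Lemma flag_value_unit : exists x : K, (x = 1 \/ x = -1) /\ flag_value eta Sigma Tr sigma 0 x.
Proof.
have [x hx] := flag_valueP hfan hcomp hD0 hTr 0 hflag.
have [U [Uunit hU]] := flag_basis hfan hflag.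
exists x; split=> //.
apply: (unit_value hfan hcomp hD0 hTr hflag Uunit hU).
exact: (claim_all hfan hcomp hD0 hTr hflag Uunit hU hx).
Qed.

Lemma zexpE k j : z k j = (coord j == k).
Proof.
rewrite mnmE inE; congr (nat_of_bool _).
have kn : (k <= n)%N by rewrite -ltnS.
have := coord_eq hfan j hflag kn; rewrite -val_eqE /= => ->; congr (_ && _).
by case: (k < n)%N; rewrite ?inE.
Qed.

Lemma prod_zexp : \prod_k ('X_[z k] : S) = X.
Proof.
have -> : \prod_k ('X_[z k] : S) = 'X_[(\sum_k z k)%MM].
  by elim/big_rec2: _ => [|k a b _ ->]; rewrite ?mpolyX0 // mpolyXD.
congr 'X_[_]; apply/mnmP => j; rewrite mnm_sumE mnmE.
by rewrite (bigD1 (coord j)) //= zexpE eqxx big1 // => k hk; rewrite zexpE eq_sym (negPf hk).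
Qed.

Lemma sum_zexp : \sum_k mdiv (z k) = beta0 s.
Proof.
apply/colP => j; rewrite summxE (bigD1 (coord j)) //= !mxE zexpE eqxx big1 ?addr0 //.
by move=> k hk; rewrite mxE zexpE eq_sym (negPf hk).
Qed.

Lemma monomial_factor (f : S) D (e : 'X_{1..s}) : hom D f ->
  (forall a, a \in msupp f -> forall j, (e j <= a j)%N) ->
  exists2 q : S, hom (D - mdiv e) q & f = 'X_[e] * q.
Proof.
move=> hD he; exists (\sum_(a <- msupp f) f@_a *: 'X_[(a - e)%MM]).
  rewrite big_seq; apply: hom_sum => a af; apply: homZ.
  apply: (@hom_lin _ _ _ _ (mdiv (a - e)%MM)); last exact: homX.
  have -> : mdiv (a - e)%MM = mdiv a - mdiv e.
    by apply/colP => j; rewrite !mxE mnmBE -subzn // he.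
  by apply: linD; [exact: hD|exact: lin_refl].
rewrite [LHS]mpolyE mulr_sumr !big_seq; apply: eq_bigr => a af.
rewrite -scalerAr -mpolyXD; congr (_ *: 'X_[_]).
by apply/mnmP => j; rewrite mnmDE mnmBE subnKC // he.
Qed.

(* Both the cover {F_j <> 0}, with C = A, and the toric cover of the flag, with a
   single nonzero C_k for each chart, are of this form. *)
Record csystem m (f : 'I_m -> S) (C : 'I_m -> 'I_n.+1 -> S) : Prop := CSystem {
  csystem_cover : cover f;
  csystem_hom : forall v, exists2 D, hom D (f v) & forall k, hom (D - mdiv (z k)) (C v k);
  csystem_sum : forall v, \sum_k 'X_[z k] * C v k = f v
}.

Definition cvec m (f : 'I_m -> S) (C : 'I_m -> 'I_n.+1 -> S) v k : L :=
  ('X_[z k] * C v k)%:F / (f v)%:F.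

(** The factors z_k come out of the columns; their product is X, because each variable divides
    exactly one z_k, and it cancels the denominator of the invariant form. *)
Lemma det_cvec m (f : 'I_m -> S) C (t : 'I_n.+1 -> 'I_m) :
  \det (\matrix_(i, k) cvec f C (t i) k) / X%:F =
  (\det (\matrix_(k, i) C (t i) k))%:F / (\prod_i f (t i))%:F.
Proof.
have -> : \matrix_(i, k) cvec f C (t i) k = \matrix_(i, k) (((f (t i))%:F)^-1 *
    (\matrix_(i, k) (C (t i) k)%:F) i k * ('X_[z k] : S)%:F).
  by apply/matrixP => i k; rewrite !mxE /cvec rmorphM /= mulrC [X in _ * X = _]mulrC mulrA.
rewrite det_scale_rows_cols -rmorph_prod prod_zexp mulfK ?tofrac_eq0 ?allX_neq0 //.
rewrite prodfV -rmorph_prod mulrC; congr (_ / _).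
rewrite -[LHS]det_tr -det_map_mx; congr (\det _).
by apply/matrixP => i k; rewrite !mxE.
Qed.

Lemma csystem_cocycle m (f : 'I_m -> S) C : csystem f C -> cocycle eta f (dcoch 1 (cvec f C)).
Proof.
case=> hf hC hs; split; last first.
  apply: (@coboundary_dcoch0 _ _ _ _ _ _ _ _ (fun=> 1)) => v.
  under eq_bigr do rewrite mul1r; rewrite -mulr_suml -rmorph_sum hs divff //.
  by rewrite tofrac_eq0; case: (hf.1 v).
split=> [t p|t|t]; [exact: dcoch_perm|exact: dcoch_ninj|].
have h i : exists D, hom D (f (t i)) /\ forall k, hom (D - mdiv (z k)) (C (t i) k).
  by have [D h1 h2] := hC (t i); exists D.
have [D hD] := fin_choice h.
exists (\sum_i D i), 1%N, (\det (\matrix_(k, i) C (t i) k)); split.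
- by apply: hom_prod => i _; case: (hD i).
- rewrite mulr1n -sum_zexp; apply: hom_det => k i; rewrite mxE.
  by case: (hD i).
by rewrite ffunE mul1r det_cvec expr1.
Qed.

Lemma csystem_merge m m' (f : 'I_m -> S) C (f' : 'I_m' -> S) C' :
  csystem f C -> csystem f' C' -> csystem (merge f f') (merge C C').
Proof.
move=> [h1 h2 h3] [h1' h2' h3']; split; first exact: cover_merge.
  by move=> v; rewrite /merge; case: (split v).
by move=> v; rewrite /merge; case: (split v).
Qed.

Lemma csystem_indep m m' (f : 'I_m -> S) C (f' : 'I_m' -> S) C' :
  csystem f C -> csystem f' C' -> tr f (dcoch 1 (cvec f C)) = tr f' (dcoch 1 (cvec f' C')).
Proof.
move=> sys sys'; apply: (tr_merge hTr (csystem_cover sys) (csystem_cover sys')).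
rewrite (@eq_dcochV _ _ _ _ _ _ _ _ (cvec (merge f f') (merge C C'))).
  exact: csystem_cocycle (csystem_merge sys sys').
by move=> v i; rewrite /cvec /merge; case: (split v).
Qed.

(** The matrix of a tuple t is the 0-1 matrix of t times that of the identity tuple, and [det_cvec]
    evaluates the latter. *)
Lemma omega_det (F : 'I_n.+1 -> S) (A : 'M[S]_n.+1) :
  omega eta F (\det A) = dcoch 1 (cvec F (fun v k => A k v)).
Proof.
apply/ffunP => t; rewrite !ffunE; congr (_ *: _).
have -> : \matrix_(i, k) cvec F (fun v k => A k v) (t i) k =
    (\matrix_(i, j) (t i == j)%:R) *m \matrix_(i, k) cvec F (fun v k => A k v) (id i) k.
  apply/matrixP => i k; rewrite !mxE (bigD1 (t i)) //= !mxE eqxx mul1r big1 ?addr0 //.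
  by move=> j jt; rewrite !mxE eq_sym (negPf jt) mul0r.
rewrite det_mulmx mul1r -mulrA det_cvec; congr (_ * (_%:F / _)).
by congr (\det _); apply/matrixP => i k; rewrite !mxE.
Qed.

Lemma trace_det (F : 'I_n.+1 -> S) (alpha : 'I_n.+1 -> 'cV[int]_s) (A : 'M[S]_n.+1) :
  cover F -> (forall j, hom (alpha j) (F j)) ->
  (forall i j, hom (alpha j - mdiv (z i)) (A i j)) ->
  (forall j, F j = \sum_i A i j * 'X_[z i]) ->
  exists x : K, (x = 1 \/ x = -1) /\ toric_residue eta Tr F (\det A) = x.
Proof.
move=> hF hhF hA hs; have [x [x1 hx]] := flag_value_unit; exists x; split=> //.
have sysF : csystem F (fun v k => A k v).
  split=> [//|v|v]; first by exists (alpha v).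
  by rewrite hs; apply: eq_bigr => k _; rewrite mulrC.
have [f [tau [sys hf]]] := flag_system hfan hcomp hD0 K hflag.
(* For k = tau v the variables of z_k are outside the cone of the chart, hence divide the function
   that defines the chart. *)
have h v : exists q, (exists2 D, hom D (f v) & hom (D - mdiv (z (tau v))) q) /\ f v = 'X_[z (tau v)] * q.
  have [hA' [[D _ hD] _ hdiv _] _ ht] := hf v.
  have [|q hq E] := monomial_factor (e := z (tau v)) hD.
    move=> a af j; rewrite zexpE; case: eqP => // e; apply: (hdiv a af).
    by rewrite inE; apply/negP => /ht; rewrite e eqxx.
  by exists q; split=> //; exists D.
have [q hq] := fin_choice h.
pose C v k := if k == tau v then q v else 0.
have [hcov _ _] := sys.
have sysZ : csystem f C.
  split=> [//|v|v].
    have [[D hD hqv] _] := hq v; exists D => // k; rewrite /C; case: eqP => [->//|_].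
    exact: hom0.
  have [_ ->] := hq v; rewrite (bigD1 (tau v)) //= /C eqxx big1 ?addr0 //.
  by move=> k /negPf ->; rewrite mulr0.
rewrite /toric_residue omega_det (csystem_indep sysF sysZ) -(hx _ _ _ _ sys) chim0.
congr (tr f _); apply: eq_dcochV => v k; rewrite /cvec /C /evec; case: eqP => [->|_].
  have [_ <-] := hq v; rewrite divff // tofrac_eq0; by case: (hcov.1 v).
by rewrite mulr0 rmorph0 mul0r.
Qed.
End FlagDeterminant.

(** * The residue vanishes on the ideal *)

Lemma linear_shuffle (E : fieldType) (d a g g' p : E) :
  d * ((a * g + g') / p) = a * (d * (g / p)) + d * (g' / p).
Proof. by ring. Qed.

Lemma scale_shuffle (E : nzRingType) (V : lmodType E) (a x y : E) (w : V) :
  (a * x + y) *: w = a *: (x *: w) + y *: w.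
Proof. by rewrite scalerDl scalerA. Qed.

Lemma frac_mulr (E : fieldType) (g f x p : E) : f != 0 -> g * f * x / (f * p) = g * x / p.
Proof. by move=> f0; rewrite [g * f * x]mulrAC [f * p]mulrC -mulf_div divff // mulr1. Qed.

Section ResidueFunctional.
Variables (n s : nat) (eta : 'M[int]_(s, n)) (Sigma : {set {set 'I_s}}).
Variable K : fieldType.
Local Notation S := {mpoly K[s]}.
Local Notation L := {fraction S}.
Local Notation hom := (homogeneous eta).
Local Notation X := (allX s K).
Local Notation dcoch := (dcoch eta).
Local Notation evec := (@evec s K _).
Variable Tr : forall m, ('I_m -> S) -> precochain s K n.+1 m -> K.
Hypothesis hTr : is_trace eta Sigma Tr.
Variables (F : 'I_n.+1 -> S) (alpha : 'I_n.+1 -> 'cV[int]_s).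
Hypothesis hcov : open_cover eta Sigma F.
Hypothesis hF : forall i, hom (alpha i) (F i).
Local Notation rho := (critical_degree alpha).
Local Notation res := (toric_residue eta Tr F).

Let coef (g : S) : L := g%:F * X%:F / (\prod_i F i)%:F.

Lemma frac_swap (E : fieldType) (d g p x : E) : x != 0 -> d * (g / p) = g * x / p * d / x.
Proof.
move=> x0; rewrite -[g * x / p]mulrA [x / p]mulrC !mulrA [_ * x * d]mulrAC mulfK //.
by rewrite [in RHS]mulrC !mulrA.
Qed.

Lemma omega_dcoch g : omega eta F g = dcoch (coef g) (fun v : 'I_n.+1 => evec v).
Proof.
apply/ffunP => t; rewrite !ffunE; congr (_ *: _).
have -> : \matrix_(i, k) evec (t i) k = \matrix_(i, j) ((t i == j)%:R : L).
  by apply/matrixP => i k; rewrite !mxE /evec eq_sym.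
by apply: frac_swap; rewrite tofrac_eq0 allX_neq0.
Qed.

Lemma evec_sum1 (v : 'I_n.+1) : \sum_i 1 * evec v i = 1.
Proof. exact: (evec_sum v (fun=> 1)). Qed.

Lemma prod_codom k (t : 'I_k -> 'I_n.+1) (P : pred 'I_n.+1) (H : 'I_n.+1 -> S) :
  injective t -> (forall i, P (t i)) -> #|P| = k -> \prod_i H (t i) = \prod_(l | P l) H l.
Proof.
move=> ti tP cP; have -> : \prod_i H (t i) = \prod_(l <- codom t) H l.
  by rewrite big_image /=; apply: eq_bigl.
rewrite -[RHS]big_enum; apply: perm_big; apply: uniq_perm.
- by rewrite (map_inj_uniq ti) enum_uniq.
- exact: enum_uniq.
have [_ e] : (size (codom t) = size (enum P)) * (codom t =i enum P).
  apply: uniq_min_size; first by rewrite (map_inj_uniq ti) enum_uniq.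
    by move=> _ /codomP[i ->]; rewrite mem_enum; exact: tP.
  by rewrite size_codom card_ord -cardE cP.
exact: e.
Qed.

Lemma det_evec k (t : 'I_k -> 'I_n.+1) (u : 'I_k -> 'I_n.+1) :
  \det (\matrix_(i, l) evec (t i) (u l)) =
  ((\det (\matrix_(i, l) ((u l == t i)%:R : int)))%:~R : S)%:F.
Proof.
rewrite rmorph_int -det_map_mx; congr (\det _); apply/matrixP => i l.
by rewrite !mxE /evec; case: eqP.
Qed.

(** For the identity matrix in place of V, a minor is nonzero only if t enumerates P; the product of
    the F over t is then the denominator of g. *)
Lemma evec_cochain k (u : 'I_k -> 'I_n.+1) (i0 : 'I_n.+1) (P : pred 'I_n.+1) (q : S) (g : L) :
  injective u -> (forall l, P (u l)) -> #|P| = k ->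
  g = q%:F * X%:F / (\prod_(l | P l) F l)%:F ->
  hom (\sum_(l | P l) alpha l - beta0 s) q ->
  cochain eta F (dcoch g (fun v l => evec v (u l))).
Proof.
move=> ui uP cP gE hq; have F0 l : F l != 0 by case: (hcov.1 l).
have Dt (t : 'I_k -> 'I_n.+1) : hom (\sum_i alpha (t i)) (\prod_i F (t i)).
  by apply: hom_prod => i _.
split=> [t p|t|t]; [exact: dcoch_perm|exact: dcoch_ninj|].
have [d0|d0] := eqVneq (\det (\matrix_(i, l) evec (t i) (u l))) 0.
  rewrite ffunE d0 mulr0 mul0r (_ : 0 *: _ = 0); first exact: canonical_section0 (Dt t).
  exact: scale0r.
have ti : injective t.
  apply/injectiveP; apply: contraNT d0 => /injectivePn[i [i' ii' tt]].
  by apply/eqP/(determinant_alternate ii') => l; rewrite !mxE tt.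
have im i : t i \in codom u.
  apply: contraNT d0 => h; rewrite (expand_det_row _ i) big1 // => l _.
  rewrite mxE /evec (_ : _ == _ = false) ?mul0r //; apply: contraNF h => /eqP <-.
  exact: codom_f.
have tP i : P (t i) by have /codomP[l ->] := im i; exact: uP.
have pE := prod_codom F ti tP cP.
exists (\sum_(l | P l) alpha l), 1%N,
  ((\det (\matrix_(i, l) ((u l == t i)%:R : int)))%:~R * q); split.
- by rewrite pE; apply: hom_prod => l _.
- rewrite mulr1n -[_ - _]add0r; apply: homM; last exact: hq.
  by rewrite -(rmorph_int (@mpolyC s K)); exact: homC.
rewrite ffunE pE gE expr1 rmorphM (det_evec t u); congr (_ *: _).
symmetry; rewrite -mulrA; apply: frac_swap; by rewrite tofrac_eq0 allX_neq0.
Qed.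

Lemma omega_cocycle g : hom rho g -> cocycle eta F (omega eta F g).
Proof.
move=> hg; rewrite omega_dcoch; split; last exact: (coboundary_dcoch0 _ _ evec_sum1).
apply: (@evec_cochain n.+1 id ord0 xpredT g) => //.
  by rewrite -[RHS]card_ord; apply: eq_card.
Qed.

Lemma omegaE g t : omega eta F g t =
  (\det (\matrix_(i, j) (t i == j)%:R) * (g%:F / (\prod_i F i)%:F)) *: Omega eta K.
Proof. by rewrite ffunE. Qed.

Lemma omega_linear a g g' :
  omega eta F (a *: g + g') = [ffun t => (a%:MP : S)%:F *: omega eta F g t] + omega eta F g'.
Proof.
have e : (a *: g + g')%:F = (a%:MP : S)%:F * g%:F + g'%:F.
  by rewrite rmorphD -mul_mpolyC rmorphM.
apply/ffunP => t; rewrite omegaE e linear_shuffle.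
rewrite [RHS]ffunE.
rewrite [X in _ = X + _]ffunE.
by rewrite !omegaE; exact: scale_shuffle.
Qed.

Lemma residue_linear a g g' : hom rho g -> hom rho g' -> res (a *: g + g') = a * res g + res g'.
Proof.
move=> hg hg'; rewrite /toric_residue omega_linear.
exact: (trace_linear hTr a hcov (omega_cocycle hg) (omega_cocycle hg')).
Qed.

Lemma residue0 : res 0 = 0.
Proof.
have h0 : hom rho (0 : S) by exact: hom0.
have := residue_linear 1 h0 h0.
rewrite scale1r addr0 mul1r => /eqP; rewrite -subr_eq0 opprD addNKr oppr_eq0 => /eqP.
by [].
Qed.

Lemma residue_sum (I : eqType) (r : seq I) (c : I -> K) (G : I -> S) :
  (forall i, i \in r -> hom rho (G i)) ->
  res (\sum_(i <- r) c i *: G i) = \sum_(i <- r) c i * res (G i).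
Proof.
elim: r => [|i r IH] h; first by rewrite !big_nil residue0.
rewrite !big_cons residue_linear ?IH //; first by move=> j jr; apply: h; rewrite inE jr orbT.
  by apply: h; rewrite mem_head.
by rewrite big_seq; apply: hom_sum => j jr; apply/homZ/h; rewrite inE jr orbT.
Qed.

(** F_i cancels in the denominator, so the minor omitting coordinate i is already a cochain. *)
Lemma residue_ideal i G : (0 < n)%N -> hom (rho - alpha i) G -> res (G * F i) = 0.
Proof.
move=> n0 hG; have hg : hom rho (G * F i).
  by have := homM hG (@hF i); rewrite subrK.
rewrite /toric_residue; have hc := omega_cocycle hg; rewrite omega_dcoch in hc *.
set g := coef _ in hc *.
have cb : cochain eta F (dcoch g (fun v l => evec v (lift i l))).
  apply: (@evec_cochain n (lift i) i (fun l => l != i) G).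
  - exact: lift_inj.
  - by move=> l; rewrite eq_sym neq_lift.
  - have e := cardC1 i; rewrite card_ord /= in e; apply: etrans e.
    by apply: eq_card => l; rewrite !inE.
  - rewrite /g /coef (bigD1 i) //= !rmorphM /=; apply: frac_mulr.
    by rewrite tofrac_eq0; case: (hcov.1 i).
  rewrite /critical_degree in hG; move: hG; rewrite (bigD1 i) //=.
  by rewrite -[_ + _ - beta0 s]addrA [alpha i + _]addrC addrK.
have := trace_coboundary hTr n0 hcov cb.
rewrite (coboundary_dcoch eta g i evec_sum1) mulr1; exact: (tr_sign hTr hcov hc).
Qed.
End ResidueFunctional.

(** * The generic polynomials have no common zero *)

Section AlgebraicDependence.
Variables (E : fieldType) (N M : nat) (psi : {rmorphism {mpoly rat[N]} -> E}) (w : 'I_M -> E).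

Definition evalw (p : {mpoly rat[M]}) : E := mmap (psi \o @mpolyC N rat) w p.
Arguments evalw : simpl never.

Definition polynomial_value (y : E) : Prop := exists p, y = evalw p.
Definition rational_value (y : E) : Prop :=
  exists2 v, v != 0 & polynomial_value v /\ polynomial_value (v * y).

Lemma evalwD p q : evalw (p + q) = evalw p + evalw q. Proof. exact: mmapD. Qed.
Lemma evalwM p q : evalw (p * q) = evalw p * evalw q. Proof. exact: rmorphM. Qed.
Lemma evalw1 : evalw 1 = 1. Proof. exact: rmorph1. Qed.
Definition bounded n (e : nat) (p : {mpoly rat[n]}) : Prop :=
  forall a, a \in msupp p -> forall j, (a j <= e)%N.

Lemma boundedW n e e' (p : {mpoly rat[n]}) : (e <= e')%N -> bounded e p -> bounded e' p.
Proof. by move=> ee' h a /h ha j; apply: leq_trans (ha j) ee'. Qed.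

Lemma bounded_msize n (p : {mpoly rat[n]}) : bounded (msize p) p.
Proof.
move=> a ap j; apply: leq_trans (ltnW (msize_mdeg_lt ap)).
by rewrite mdegE (bigD1 j) //= leq_addr.
Qed.

Lemma boundedM n e e' (p q : {mpoly rat[n]}) : bounded e p -> bounded e' q -> bounded (e + e') (p * q).
Proof.
move=> hp hq a /msuppM_le /allpairsP[[b c] /= [/hp hb /hq hc ->]] j.
by rewrite mnmDE leq_add.
Qed.

Lemma bounded1 n : bounded 0 (1 : {mpoly rat[n]}).
Proof. by move=> a; rewrite msupp1 inE => /eqP -> j; rewrite mnm0E. Qed.

Lemma boundedX n e k (p : {mpoly rat[n]}) : bounded e p -> bounded (e * k) (p ^+ k).
Proof.
move=> h; elim: k => [|k IH]; first by rewrite expr0 muln0; exact: bounded1.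
by rewrite exprS mulnS; exact: boundedM.
Qed.

Lemma bounded_prod n (I : Type) (r : seq I) (e : I -> nat) (p : I -> {mpoly rat[n]}) :
  (forall i, bounded (e i) (p i)) -> bounded (\sum_(i <- r) e i) (\prod_(i <- r) p i).
Proof.
by move=> h; elim/big_rec2: _ => [|i q k _ IH]; [exact: bounded1|exact: boundedM].
Qed.

Lemma polynomial_valueD x y : polynomial_value x -> polynomial_value y -> polynomial_value (x + y).
Proof. by move=> [p ->] [q ->]; exists (p + q); rewrite evalwD. Qed.
Lemma polynomial_valueM x y : polynomial_value x -> polynomial_value y -> polynomial_value (x * y).
Proof. by move=> [p ->] [q ->]; exists (p * q); rewrite evalwM. Qed.
Lemma polynomial_value1 : polynomial_value 1.
Proof. by exists 1; rewrite evalw1. Qed.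
Lemma polynomial_value_var i : polynomial_value (w i).
Proof. by exists 'X_i; rewrite /evalw mmapX mmap1U. Qed.

Lemma rational_polynomial y : polynomial_value y -> rational_value y.
Proof. by move=> h; exists 1; rewrite ?oner_neq0 // mul1r; split=> //; exact: polynomial_value1. Qed.
Lemma rational_valueD x y : rational_value x -> rational_value y -> rational_value (x + y).
Proof.
move=> [u u0 [hu hx]] [v v0 [hv hy]]; exists (u * v); first exact: mulf_neq0.
split; first exact: polynomial_valueM.
have -> : u * v * (x + y) = v * (u * x) + u * (v * y) by ring.
by apply: polynomial_valueD; apply: polynomial_valueM.
Qed.
Lemma rational_valueM x y : rational_value x -> rational_value y -> rational_value (x * y).
Proof.
move=> [u u0 [hu hx]] [v v0 [hv hy]]; exists (u * v); first exact: mulf_neq0.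
split; first exact: polynomial_valueM.
have -> : u * v * (x * y) = (u * x) * (v * y) by ring.
exact: polynomial_valueM.
Qed.
Lemma rational_valueN x : rational_value x -> rational_value (- x).
Proof.
move=> [u u0 [hu [p hp]]]; exists u => //; split=> //; exists (- p).
by rewrite mulrN hp /evalw mmapN.
Qed.
Lemma rational_value1 : rational_value 1.
Proof. exact/rational_polynomial/polynomial_value1. Qed.
Lemma rational_value0 : rational_value 0.
Proof. by apply: rational_polynomial; exists 0; rewrite /evalw mmap0. Qed.
Lemma rational_value_inv i : w i != 0 -> rational_value (w i)^-1.
Proof.
move=> wi; exists (w i) => //; split; first exact: polynomial_value_var.
by rewrite divff //; exact: polynomial_value1.
Qed.
Lemma rational_valueX x k : rational_value x -> rational_value (x ^+ k).
Proof.
move=> h; elim: k => [|k IH]; first by rewrite expr0; exact: rational_value1.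
by rewrite exprS; exact: rational_valueM.
Qed.

(* The d^N monomials of degree less than d in each variable would be linearly
   independent in a space of dimension O(d^M). *)
Lemma algebraic_dependence : (M < N)%N -> (forall k, rational_value (psi 'X_k)) ->
  exists2 q, q != 0 & psi q = 0.
Proof.
move=> MN hr.
have h k : exists pq : {mpoly rat[M]} * {mpoly rat[M]},
    evalw pq.1 != 0 /\ evalw pq.2 = evalw pq.1 * psi 'X_k.
  by have [v v0 [[p pE] [q qE]]] := hr k; exists (p, q); rewrite /= -pE -qE.
have [pq hpq] := fin_choice h.
(* A common denominator: in E, each psi X_k is the value of [P k] divided by that of [v]. *)
pose v := \prod_k (pq k).1.
pose P k := (pq k).2 * \prod_(l | l != k) (pq l).1.
have v0 : evalw v != 0.
  rewrite /v (_ : evalw _ = \prod_k evalw (pq k).1); last exact: rmorph_prod.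
  by apply/prodf_neq0 => k _; case: (hpq k).
have PE k : evalw (P k) = evalw v * psi 'X_k.
  have -> : v = (pq k).1 * \prod_(l | l != k) (pq l).1 by rewrite /v (bigD1 k).
  by rewrite /P !evalwM; have [_ ->] := hpq k; rewrite mulrAC.
have [e [e0 ev eP]] : exists e, [/\ (0 < e)%N, bounded e v & forall k, bounded e (P k)].
  exists (msize v + \sum_k msize (P k)).+1; split=> //.
    by apply: boundedW (@bounded_msize _ v); rewrite leqW // leq_addr.
  move=> k; apply: boundedW (@bounded_msize _ (P k)); rewrite leqW // (bigD1 k) //= addnCA.
  exact: leq_addr.
(* The choice d = c^M gives (c d + 1)^M <= (c (d + 1))^M = d (d + 1)^M < (d + 1)^(M + 1) <= (d +
   1)^N: there are fewer monomials in M variables with exponents at most B than in N variables with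
   exponents at most d. *)
pose c := (e * N)%N; pose d := (c ^ M)%N; pose B := (c * d)%N.
have c0 : (0 < c)%N by rewrite muln_gt0 e0 (leq_ltn_trans _ MN).
pose rT : finType := {ffun 'I_N -> 'I_d.+1}; pose cT : finType := {ffun 'I_M -> 'I_B.+1}.
have cards : (#|cT| < #|rT|)%N.
  rewrite !card_ffun !card_ord; apply: (@leq_ltn_trans ((c * d.+1) ^ M)%N).
    have mono_exp k (x y : nat) : (x <= y)%N -> (x ^ k <= y ^ k)%N.
      by move=> xy; elim: k => // k IH; rewrite !expnS leq_mul.
    by apply: mono_exp; rewrite ltn_pmul2l.
  rewrite expnMn; apply: (@leq_trans (d.+1 ^ M.+1)%N); last by rewrite leq_pexp2l.
  by rewrite expnS ltn_pmul2r ?expn_gt0.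
pose sb (b : rT) := \sum_k (b k : nat).
have sbd b : (sb b <= N * d)%N.
  by rewrite -[N in (N * d)%N]card_ord -sum_nat_const; apply: leq_sum => k _; rewrite -ltnS.
pose mono (b : rT) : 'X_{1..N} := [multinom (b k : nat) | k < N].
(* The power of v makes the value of [Q b] equal to psi of the monomial b times v^(N d), a nonzero
   factor common to all b; so a linear relation among the [Q b] gives one among the monomials. *)
pose Q (b : rT) : {mpoly rat[M]} := (\prod_k P k ^+ b k) * v ^+ (N * d - sb b).
have QE b : evalw (Q b) = evalw v ^+ (N * d) * psi 'X_[mono b].
  rewrite /Q evalwM (_ : evalw (\prod_k _) = \prod_k (evalw v ^+ b k * psi 'X_k ^+ b k)); last first.
    rewrite (_ : evalw _ = \prod_k evalw (P k ^+ b k)); last exact: rmorph_prod.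
    by apply: eq_bigr => k _; rewrite -exprMn -PE; exact: rmorphXn.
  rewrite (_ : evalw (v ^+ _) = evalw v ^+ (N * d - sb b)); last exact: rmorphXn.
  rewrite big_split /= prodrXr -/(sb b) mulrAC -exprD subnKC //; congr (_ * _).
  rewrite mpolyXE_id rmorph_prod; apply: eq_bigr => k _; rewrite rmorphXn /=.
  by rewrite mnmE.
have Qb b : bounded B (Q b).
  have -> : B = (\sum_k e * b k + e * (N * d - sb b))%N.
    by rewrite -big_distrr -mulnDr subnKC ?sbd // mulnA.
  by apply: boundedM; [apply: bounded_prod => k|]; exact: boundedX.
pose mc (a : cT) : 'X_{1..M} := [multinom (a k : nat) | k < M].
pose Mx := \matrix_(i < #|rT|, j < #|cT|) (Q (enum_val i))@_(mc (enum_val j)).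
have /rowV0Pn[r /sub_kermxP rM r0] : kermx Mx != 0.
  rewrite kermx_eq0; apply/negP => /eqP e1.
  by have := rank_leq_col Mx; rewrite e1 leqNgt cards.
have sQ : \sum_i r 0 i *: Q (enum_val i) = 0.
  apply/mpolyP => a; rewrite raddf_sum mcoeff0 /=.
  case: (boolP [forall j, (a j <= B)%N]) => [/forallP ha|/forallPn[j hj]]; last first.
    rewrite big1 // => i _; rewrite mcoeffZ memN_msupp_eq0 ?mulr0 //.
    by apply: contra hj => /Qb/(_ j).
  pose a' : cT := [ffun j => inord (a j)].
  have aE : a = mc a' by apply/mnmP => j; rewrite mnmE ffunE inordK // ltnS.
  have := congr1 (fun x : 'rV_#|cT| => x 0 (enum_rank a')) rM; rewrite !mxE => h1.
  rewrite -[RHS]h1; apply: eq_bigr => i _; rewrite mcoeffZ mxE enum_rankK.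
  by rewrite aE.
exists (\sum_i r 0 i *: 'X_[mono (enum_val i)]).
  have [i ri] : exists i, r 0 i != 0.
    apply: NNPP => hn; move/negP: r0; apply; apply/eqP/rowP => i; rewrite mxE.
    by apply/eqP/negPn/negP => hi; apply: hn; exists i.
  apply: contraNneq ri => /(congr1 (fun p : {mpoly rat[N]} => p@_(mono (enum_val i)))).
  rewrite mcoeff0 raddf_sum /= (bigD1 i) //= mcoeffZ mcoeffX eqxx mulr1 big1 ?addr0 => [->//|l li].
  rewrite mcoeffZ mcoeffX (_ : _ == _ = false) ?mulr0 //; apply: contraNF li => /eqP ml.
  apply/eqP/enum_val_inj/ffunP => k; apply/val_inj.
  by have := congr1 (fun a : 'X_{1..N} => a k) ml; rewrite /mono !mnmE.
have := congr1 evalw sQ; rewrite /evalw mmap0 raddf_sum /= => h0.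
apply: (mulfI (expf_neq0 (N * d) v0)); rewrite mulr0 -[RHS]h0 raddf_sum mulr_sumr.
apply: eq_bigr => i _; rewrite mmapZ -/(evalw _) QE mulrCA; congr (_ * _).
exact: (etrans (congr1 psi (esym (mul_mpolyC _ _))) (rmorphM psi _ _)).
Qed.
End AlgebraicDependence.

Lemma prod_exprz (E : fieldType) (x : E) n (e : 'I_n -> int) : x != 0 ->
  \prod_l x ^ e l = x ^ (\sum_l e l).
Proof.
move=> x0; elim/big_rec2: _ => [|l y z _ ->]; first by rewrite expr0z.
by rewrite expfzDr.
Qed.

Lemma prod_exprzl (E : fieldType) (I : finType) (P : pred I) (x : I -> E) (z : int) :
  (\prod_(j | P j) x j) ^ z = \prod_(j | P j) x j ^ z.
Proof.
by elim/big_rec2: _ => [|j y1 y2 _ <-]; [rewrite exp1rz|rewrite expfzMl].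
Qed.

Section GenericCover.
Variables (R : realFieldType) (n s : nat) (eta : 'M[int]_(s, n)) (Sigma : {set {set 'I_s}}).
Hypothesis hfan : is_fan eta Sigma R.
Hypothesis hcomp : complete_fan eta Sigma R.
Variable alpha : 'I_n.+1 -> 'cV[int]_s.
Hypothesis halpha : forall i, ample eta Sigma (alpha i).
Variables (N : nat) (u : 'I_N -> 'I_n.+1 * 'X_{1..s}).
Hypothesis hu : enumerates u (fun ia => lin_equiv eta (mdiv ia.2) (alpha ia.1)).
Local Notation A := {mpoly rat[N]}.
Local Notation K := {fraction A}.
Local Notation ev := (ev eta).
Local Notation lift_poly := (map_mpoly (@FracField.tofrac A)).
Definition genericF (i : 'I_n.+1) : {mpoly K[s]} := lift_poly (generic u i).

Lemma hom_lift D (p : {mpoly A[s]}) : homogeneous eta D p -> homogeneous eta D (lift_poly p).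
Proof.
move=> h a; rewrite mcoeff_msupp mcoeff_map_mpoly /= => ha; apply: h.
by rewrite mcoeff_msupp; apply: contraNneq ha => ->; rewrite rmorph0.
Qed.

Lemma generic_hom i : homogeneous eta (alpha i) (generic u i).
Proof.
apply: hom_sum => k /eqP ki; apply: homZ.
apply: (@hom_lin _ _ _ _ (mdiv (u k).2)); last exact: homX.
by rewrite -ki; apply/(hu.2 (u k)); exists k.
Qed.

Lemma genericF_hom i : homogeneous eta (alpha i) (genericF i).
Proof. exact/hom_lift/generic_hom. Qed.

Lemma ample_monomial i B : B \in Sigma -> cone_dim eta B = n ->
  exists2 a : 'X_{1..s}, lin_equiv eta (mdiv a) (alpha i) & forall j, (a j == 0%N) = (j \in B).
Proof.
move=> hB dB; have [m hm] := halpha i hB dB.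
have pos j : 0 <= alpha i j 0 + ev m j.
  by have := hm j; case: ifP => _; rewrite -/(ev m j); [move=> ->; rewrite addrN|move/ltW; rewrite -subr_ge0 opprK addrC].
exists [multinom absz (alpha i j 0 + ev m j)%R | j < s].
  by exists m; apply/colP => j; rewrite [LHS]mxE mnmE gez0_abs // [RHS]mxE.
move=> j; rewrite mnmE absz_eq0; have := hm j; rewrite -/(ev m j).
case: ifP => _ h; first by rewrite h addrN eqxx.
by apply/gt_eqF; rewrite -subr_gt0 opprK addrC in h.
Qed.

Lemma genericFE i : genericF i =
  \sum_(k < N | (u k).1 == i) (('X_k : A)%:F : K) *: 'X_[(u k).2].
Proof.
rewrite /genericF /generic raddf_sum; apply: eq_bigr => k _.
by rewrite [LHS]map_mpolyZ map_mpolyX.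
Qed.

Section CommonZero.
Variables (E : fieldType) (phi : {rmorphism K -> E}) (x : 'I_s -> E) (B : {set 'I_s}).
Hypothesis hB : B \in Sigma.
Hypothesis dB : cone_dim eta B = n.
Hypothesis xB : forall j, j \notin B -> x j != 0.

Let psi : {rmorphism A -> E} := phi \o (@FracField.tofrac A).
Let xpow (a : 'X_{1..s}) : E := \prod_j x j ^+ a j.
(** The l-th character, evaluated on the nonvanishing coordinates of x only. *)
Let tor (l : 'I_n) : E := \prod_(j | x j != 0) x j ^ eta j l.

Lemma tor_neq0 l : tor l != 0.
Proof. by apply/prodf_neq0 => j xj; rewrite expfz_neq0. Qed.

Lemma eval_genericF i : mmap phi x (genericF i) =
  \sum_(k < N | (u k).1 == i) psi 'X_k * xpow (u k).2.
Proof.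
rewrite genericFE raddf_sum; apply: eq_bigr => k _.
by rewrite [LHS]mmapZ mmapX.
Qed.

(** The exponents differ by a character m. If b contains a vanishing coordinate, its monomial is 0
    at x; otherwise neither monomial involves one, and their ratio is the character on the remaining
    coordinates. *)
Lemma xpow_ratio (a b : 'X_{1..s}) : (forall j, (a j == 0%N) = (j \in B)) ->
  lin_equiv eta (mdiv b) (mdiv a) ->
  xpow b = 0 \/ exists m : 'cV[int]_n, xpow b = xpow a * \prod_l tor l ^ m l 0.
Proof.
move=> aB [m bE]; case: (boolP [exists j, (x j == 0) && (0 < b j)%N]) => [/existsP[j /andP[/eqP xj bj]]|h].
  by left; rewrite /xpow (bigD1 j) //= xj expr0n gtn_eqF // mul0r.
right; exists m.
have b0 j : x j = 0 -> b j = 0%N.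
  move=> xj; apply/eqP; apply: contraR h; rewrite -lt0n => bj.
  by apply/existsP; exists j; rewrite xj eqxx.
have a0 j : x j = 0 -> a j = 0%N.
  by move=> xj; apply/eqP; rewrite aB; apply: contraT => /xB; rewrite xj eqxx.
have restr (c : 'X_{1..s}) : (forall j, x j = 0 -> c j = 0%N) ->
    xpow c = \prod_(j | x j != 0) x j ^+ c j.
  move=> c0; rewrite /xpow (bigID (fun j => x j != 0)) /= [X in _ * X]big1 ?mulr1 // => j.
  by rewrite negbK => /eqP xj; rewrite c0 // expr0.
have xE j : x j != 0 -> x j ^+ b j = x j ^+ a j * \prod_l (x j ^ eta j l) ^ m l 0.
  move=> xj; have := congr1 (fun v : 'cV[int]_s => v j 0) bE.
  rewrite [mdiv b j 0]mxE [RHS]mxE [mdiv a j 0]mxE [(eta *m m) j 0]mxE => e.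
  by rewrite exprnP e expfzDr // -exprnP -prod_exprz //; under [in RHS]eq_bigr do rewrite exprz_exp.
have -> : \prod_l tor l ^ m l 0 = \prod_(j | x j != 0) \prod_l (x j ^ eta j l) ^ m l 0.
  by rewrite exchange_big; apply: eq_bigr => l _; rewrite prod_exprzl.
rewrite (restr _ b0) (restr _ a0) -big_split; exact: eq_bigr.
Qed.

Hypothesis hx : forall i, mmap phi x (genericF i) = 0.

(** For each i a pivot monomial a_i of degree alpha_i, nonzero at x, is chosen. The equation F_i(x)
    = 0 gives the pivot variable in terms of the other u_ia and of ratios of monomials, which are
    rational in the n values [tor l]. Since n + 1 pivots are eliminated and n values added, N - 1
    quantities remain. *)
Lemma no_common_zero_contra : False.
Proof.
have hmono i : exists a : 'X_{1..s}, lin_equiv eta (mdiv a) (alpha i) /\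
    forall j, (a j == 0%N) = (j \in B).
  by have [a h1 h2] := ample_monomial i hB dB; exists a.
have [a ha] := fin_choice hmono.
have hkap i : exists k, u k = (i, a i) by apply/(hu.2 (i, a i)); case: (ha i).
have [kap hk] := fin_choice hkap.
have kinj : injective kap.
  by move=> i i' e; have := hk i; rewrite e hk => -[].
pose O := [set k | k \notin codom kap].
have cO : (n + #|O| < N)%N.
  have eN := cardC (mem (codom kap)); rewrite card_ord card_codom // card_ord in eN.
  have eO : #|O| = #|[predC mem (codom kap)]| by apply: eq_card => k; rewrite !inE.
  by apply: leq_trans (eq_leq eN); rewrite eO.
pose w (i : 'I_(n + #|O|)) : E :=
  match split i with inl l => tor l | inr o => psi 'X_(enum_val o) end.
have wl l : w (lshift _ l) = tor l by rewrite /w (unsplitK (inl _ l)).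
have wr o : w (rshift _ o) = psi 'X_(enum_val o) by rewrite /w (unsplitK (inr _ o)).
have rat_tor l (z : int) : rational_value psi w (tor l ^ z).
  have h1 : rational_value psi w (tor l).
    by rewrite -wl; apply: rational_polynomial; exact: polynomial_value_var.
  have h2 : rational_value psi w (tor l)^-1.
    by rewrite -wl; apply: rational_value_inv; rewrite wl tor_neq0.
  case: z => z; first by rewrite -exprnP; exact: rational_valueX.
  by rewrite NegzE -exprnN -exprVn; exact: rational_valueX.
have rat_O k : k \in O -> rational_value psi w (psi 'X_k).
  move=> kO; rewrite -(enum_rankK_in kO kO) -wr.
  by apply: rational_polynomial; exact: polynomial_value_var.
have xa i : xpow (a i) != 0.
  apply/prodf_neq0 => j _; have [_ h] := ha i; have [jB|/xB jB] := boolP (j \in B).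
    by have := h j; rewrite jB => /eqP ->; rewrite expr0 oner_neq0.
  by rewrite expf_neq0.
have rat_ratio k : rational_value psi w (xpow (u k).2 / xpow (a (u k).1)).
  have [h1 h2] := ha (u k).1.
  have h3 : lin_equiv eta (mdiv (u k).2) (mdiv (a (u k).1)).
    by apply: lin_trans (lin_sym h1); apply/(hu.2 (u k)); exists k.
  have [->|[m ->]] := xpow_ratio h2 h3; first by rewrite mul0r; exact: rational_value0.
  rewrite mulrC mulKf //; elim/big_rec: _ => [|l y _ IH]; first exact: rational_value1.
  exact: rational_valueM.
have rat_all k : rational_value psi w (psi 'X_k).
  have [kO|] := boolP (k \in O); first exact: rat_O.
  rewrite inE negbK => /codomP[i ->].
  have e0 := hx i; rewrite eval_genericF (bigD1 (kap i)) ?hk //= in e0.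
  have -> : psi 'X_(kap i) = - \sum_(k | ((u k).1 == i) && (k != kap i))
      psi 'X_k * (xpow (u k).2 / xpow (a (u k).1)).
    apply: (mulIf (xa i)); move/eqP: e0; rewrite addr_eq0 => /eqP ->.
    rewrite mulNr mulr_suml; congr (- _); apply: eq_bigr => l /andP[/eqP -> _].
    by rewrite -mulrA divfK.
  apply: rational_valueN; elim/big_rec: _ => [|l y /andP[/eqP li lk] IH]; first exact: rational_value0.
  apply: rational_valueD IH; apply: rational_valueM; last exact: rat_ratio.
  apply: rat_O; rewrite inE; apply/negP => /codomP[i' e].
  by move: li lk; rewrite e hk /= => ->; rewrite eqxx.
have [q q0 /eqP] := algebraic_dependence cO rat_all.
by rewrite /psi /= fmorph_eq0 tofrac_eq0 (negPf q0).
Qed.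
End CommonZero.

Lemma genericF_cover : open_cover eta Sigma genericF.
Proof.
have [B0 hB0 dB0] : exists2 B, B \in Sigma & cone_dim eta B = n.
  have [A0 hA0 _] := hcomp 0; have [B [hB _ dB]] := exists_full_cone hfan hcomp hA0; by exists B.
split=> [i|E phi x [A0 hA0 xA]].
  split; last by exists (alpha i); [exact: halpha|exact: genericF_hom].
  have [a ha _] := ample_monomial i hB0 dB0.
  have [k hk] : exists k, u k = (i, a) by apply/(hu.2 (i, a)).
  rewrite genericFE; apply/eqP => /(congr1 (fun p : {mpoly K[s]} => p@_a)).
  rewrite mcoeff0 raddf_sum /= (bigD1 k) /= ?hk // mcoeffZ mcoeffX eqxx mulr1 big1 ?addr0.
    by move=> /eqP; rewrite tofrac_eq0 (negPf (mpolyX_neq0 _ _)).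
  move=> l /andP[/eqP li lk]; rewrite mcoeffZ mcoeffX (_ : _ == _ = false) ?mulr0 //.
  apply: contraNF lk => /eqP la; apply/eqP/hu.1; rewrite hk -li -la.
  by case: (u l).
have [B [hB AB dB]] := exists_full_cone hfan hcomp hA0.
apply: NNPP => hn; apply: (@no_common_zero_contra E phi x B hB dB) => [j jB|i].
  by apply: xA; apply: contra jB; exact: subsetP AB j.
by apply/eqP/negPn/negP => hi; apply: hn; exists i.
Qed.
End GenericCover.

(** * Cramer's rule *)

Section ResidueSystem.
Variables (R : realFieldType) (n s : nat) (eta : 'M[int]_(s, n)) (Sigma : {set {set 'I_s}}).
Hypothesis hX : projective_fan eta Sigma R.
Variable alpha : 'I_n.+1 -> 'cV[int]_s.
Hypothesis halpha : forall i, ample eta Sigma (alpha i).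
Variables (N : nat) (u : 'I_N -> 'I_n.+1 * 'X_{1..s}).
Hypothesis hu : enumerates u (fun ia => lin_equiv eta (mdiv ia.2) (alpha ia.1)).
Variable sigma : nat -> {set 'I_s}.
Hypothesis hsigma : complete_flag eta Sigma sigma.
Variable A : 'M[{mpoly {mpoly rat[N]}[s]}]_n.+1.
Hypothesis hA : forall i j, homogeneous eta (alpha j - mdiv (zexp sigma i)) (A i j).
Hypothesis hF : forall j, generic u j = \sum_i A i j * 'X_[zexp sigma i].
Variables (q : nat) (cols : 'I_q -> 'X_{1..s}).
Hypothesis hcols : enumerates cols (fun a => lin_equiv eta (mdiv a) (critical_degree alpha)).
Local Notation K := {fraction {mpoly rat[N]}}.
Variable Tr : forall m : nat, ('I_m -> {mpoly K[s]}) -> precochain s K n.+1 m -> K.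
Hypothesis hTr : is_trace eta Sigma Tr.
Local Notation lift_poly := (map_mpoly (@FracField.tofrac {mpoly rat[N]})).
Local Notation F := (genericF u).
Local Notation rho := (critical_degree alpha).
Local Notation res := (toric_residue eta Tr F).

Let hfan : is_fan eta Sigma R. Proof. by case: hX. Qed.
Let hcomp : complete_fan eta Sigma R. Proof. by case: hX. Qed.
Let hcov : open_cover eta Sigma F. Proof. exact: (genericF_cover hfan hcomp halpha hu). Qed.
Let homF i : homogeneous eta (alpha i) (F i). Proof. exact: genericF_hom. Qed.

Lemma residue_expand (P : {mpoly {mpoly rat[N]}[s]}) : homogeneous eta rho P ->
  res (lift_poly P) = \sum_l (P@_(cols l))%:F * res 'X_[cols l].
Proof.
move=> hP; have -> : lift_poly P = \sum_l ((P@_(cols l))%:F : K) *: 'X_[cols l].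
  apply/mpolyP => a; rewrite mcoeff_map_mpoly raddf_sum /=.
  case: (boolP (a \in codom cols)) => [/codomP[l ->]|ha].
    rewrite (bigD1 l) //= mcoeffZ mcoeffX eqxx mulr1 big1 ?addr0 // => l' ll'.
    by rewrite mcoeffZ mcoeffX (inj_eq hcols.1) (negPf ll') mulr0.
  rewrite big1 ?memN_msupp_eq0 ?rmorph0 //.
    by apply: contra ha => /hP/(hcols.2 a)[l <-]; exact: codom_f.
  move=> l _; rewrite mcoeffZ mcoeffX (_ : _ == _ = false) ?mulr0 //.
  by apply: contraNF ha => /eqP <-; exact: codom_f.
apply: (residue_sum hTr hcov homF) => l _.
apply: (@hom_lin _ _ _ _ (mdiv (cols l))); last exact: homX.
by apply/(hcols.2 (cols l)); exists l.
Qed.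

Lemma hom_detA : homogeneous eta rho (\det A).
Proof.
rewrite /critical_degree -(sum_zexp hfan hsigma); exact: hom_det.
Qed.

Lemma residue_detA : exists x : K, (x = 1 \/ x = -1) /\ res (lift_poly (\det A)) = x.
Proof.
have [_ _ [D0 hD0]] := hX; rewrite -det_map_mx.
apply: (trace_det hfan hcomp hD0 hTr hsigma hcov homF) => [i j|j].
  by rewrite mxE; exact/hom_lift.
rewrite /genericF hF raddf_sum; apply: eq_bigr => i _.
by rewrite [LHS]rmorphM mxE /= map_mpolyX.
Qed.

Lemma residue_row i b : (0 < n)%N -> lin_equiv eta (mdiv b) (rho - alpha i) ->
  res (lift_poly ('X_[b] * generic u i)) = 0.
Proof.
move=> n0 hb; rewrite [lift_poly _]rmorphM /= map_mpolyX.
apply: (residue_ideal hTr hcov homF n0).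
by apply: hom_lin hb _; exact: homX.
Qed.

Lemma rays_of_dim0 : n = 0%N -> s = 0%N.
Proof.
move=> n0; apply/eqP; rewrite -leqn0 leqNgt; apply/negP => s0.
have := fan_primitive hfan (Ordinal s0); rewrite big1 // => l.
by have := ltn_ord l; rewrite {2}n0.
Qed.

Lemma phi_some (F' : 'I_n.+1 -> {mpoly {mpoly rat[N]}[s]}) Delta i b :
  phi F' Delta (domain_basis _ (Some (i, b))) = 'X_[b] * F' i.
Proof.
rewrite /phi /= scale0r addr0 (bigD1 i) //= eqxx big1 ?addr0 // => i' /negPf ->.
by rewrite mul0r.
Qed.

Lemma phi_none (F' : 'I_n.+1 -> {mpoly {mpoly rat[N]}[s]}) Delta :
  phi F' Delta (domain_basis _ None) = Delta.
Proof. by rewrite /phi /= scale1r big1 ?add0r // => i _; rewrite mul0r. Qed.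

Variables (p : nat) (rows : 'I_p -> option ('I_n.+1 * 'X_{1..s})).
Hypothesis hrows : enumerates rows (domain_label eta alpha).
Variable r : 'I_q -> 'I_p.
Hypothesis hr : injective r.
Let M := rowsub r (phi_matrix (generic u) (\det A) rows cols).
Hypothesis hdet : \det M != 0.
Let MK : 'M[K]_q := map_mx (@FracField.tofrac _) M.
Let y : 'cV[K]_q := \col_l res 'X_[cols l].

Lemma label_hom k i b : rows k = Some (i, b) -> lin_equiv eta (mdiv b) (rho - alpha i).
Proof. by move=> h; have := proj2 (hrows.2 (rows k)) (ex_intro _ k erefl); rewrite h. Qed.

Lemma row_residue k (P : {mpoly {mpoly rat[N]}[s]}) : homogeneous eta rho P ->
  phi (generic u) (\det A) (domain_basis _ (rows (r k))) = P -> (MK *m y) k 0 = res (lift_poly P).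
Proof.
move=> hP E; rewrite residue_expand // mxE; apply: eq_bigr => l _.
by rewrite mxE [in RHS]mulrC mulrC !mxE E.
Qed.

Lemma row_some k i b : (0 < n)%N -> rows (r k) = Some (i, b) -> (MK *m y) k 0 = 0.
Proof.
move=> n0 h; have hb := label_hom h.
rewrite (@row_residue k ('X_[b] * generic u i)) ?residue_row ?h ?phi_some //.
rewrite -[rho](subrK (alpha i)); apply: homM; last exact: generic_hom.
by apply: hom_lin hb _; exact: homX.
Qed.

Lemma det_MK : \det MK = (\det M)%:F.
Proof. by rewrite det_map_mx. Qed.

Lemma det_MK0 : \det MK != 0.
Proof. by rewrite det_MK tofrac_eq0. Qed.

(** Without that row, the matrix would annihilate the vector of the residues of the monomials, which
    would be 0, whereas the residue of Delta is 1 or -1. *)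
Lemma residue_none : (0 < n)%N -> exists i0, rows (r i0) = None.
Proof.
move=> n0; apply: NNPP => hn.
have z : MK *m y = 0.
  apply/colP => k; rewrite [RHS]mxE; case E : (rows (r k)) => [[i b]|].
    exact: row_some n0 E.
  by case: hn; exists k.
have y0 : y = 0.
  have : \adj MK *m (MK *m y) = 0 by rewrite z mulmx0.
  rewrite mulmxA mul_adj_mx mul_scalar_mx => h; apply/colP => l; rewrite [RHS]mxE.
  have /eqP := congr1 (fun v : 'cV[K]_q => v l 0) h.
  by rewrite !mxE mulf_eq0 (negPf det_MK0) => /eqP.
have [x [x1 hx]] := residue_detA; rewrite (residue_expand hom_detA) in hx.
have : x = 0.
  rewrite -hx big1 // => l _; have := congr1 (fun v : 'cV[K]_q => v l 0) y0.
  by rewrite !mxE => ->; rewrite mulr0.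
by case: x1 => -> /eqP; rewrite ?oppr_eq0 oner_eq0.
Qed.

Lemma residue_cramer i0 j0 : rows (r i0) = None ->
  res 'X_[cols j0] = (\det (row' i0 (col' j0 M)))%:F / (\det M)%:F \/
  res 'X_[cols j0] = - ((\det (row' i0 (col' j0 M)))%:F / (\det M)%:F).
Proof.
move=> hi0; have [x [x1 hx]] := residue_detA.
have z : MK *m y = x *: delta_mx i0 0.
  apply/colP => k; rewrite [RHS]mxE [delta_mx _ _ _ _]mxE eqxx andbT.
  case: eqP => [->|ki]; rewrite ?mulr1 ?mulr0.
    rewrite (@row_residue i0 (\det A)) ?hi0 ?phi_none //; exact: hom_detA.
  case E : (rows (r k)) => [[i b]|]; last first.
    by case: ki; apply/hr/hrows.1; rewrite E hi0.
  (* For n = 0 there are no rays, hence a single monomial, and the square matrix has only one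
     row. *)
  case: (posnP n) => [n0|n0]; last exact: row_some n0 E.
  case: ki; apply: hcols.1; apply/mnmP => j.
  by have := ltn_ord j; rewrite {2}(rays_of_dim0 n0).
have h : res 'X_[cols j0] * \det MK = x * cofactor MK i0 j0.
  have := congr1 (fun v : 'cV[K]_q => (\adj MK *m v) j0 0) z.
  rewrite /= mulmxA mul_adj_mx mul_scalar_mx -scalemxAr mxE [y _ _]mxE [RHS]mxE -colE.
  by rewrite [(col _ _) _ _]mxE [(\adj _) _ _]mxE mulrC.
have -> : res 'X_[cols j0] = x * cofactor MK i0 j0 / \det MK by rewrite -h mulfK ?det_MK0.
have cE : cofactor MK i0 j0 = (-1) ^+ (i0 + j0) * (\det (row' i0 (col' j0 M)))%:F.
  rewrite /cofactor -det_map_mx; congr (_ * \det _); by apply/matrixP => a b; rewrite !mxE.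
rewrite cE det_MK mulrA -mulrA -signr_odd.
by case: x1 => ->; case: (odd _); rewrite ?expr0 ?expr1 ?mulrN1 ?mulN1r ?opprK ?mulr1 ?mul1r ?mulN1r;
  [right|left|left|right].
Qed.
End ResidueSystem.

Theorem theorem3p2 (R : realFieldType) (n s : nat) (eta : 'M[int]_(s, n))
    (Sigma : {set {set 'I_s}}) (hX : projective_fan eta Sigma R)
    (alpha : 'I_n.+1 -> 'cV[int]_s) (halpha : forall i, ample eta Sigma (alpha i))
    (N : nat) (u : 'I_N -> 'I_n.+1 * 'X_{1..s})
    (hu : enumerates u (fun ia => lin_equiv eta (mdiv ia.2) (alpha ia.1)))
    (sigma : nat -> {set 'I_s}) (hsigma : complete_flag eta Sigma sigma)
    (A : 'M[{mpoly {mpoly rat[N]}[s]}]_n.+1)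
    (hA : forall i j, homogeneous eta (alpha j - mdiv (zexp sigma i)) (A i j))
    (hF : forall j, generic u j = \sum_i A i j * 'X_[zexp sigma i])
    (p q : nat)
    (rows : 'I_p -> option ('I_n.+1 * 'X_{1..s}))
    (hrows : enumerates rows (domain_label eta alpha))
    (cols : 'I_q -> 'X_{1..s})
    (hcols : enumerates cols
      (fun a => lin_equiv eta (mdiv a) (critical_degree alpha)))
    (r : 'I_q -> 'I_p) (hr : injective r)
    (hdet : \det (rowsub r (phi_matrix (generic u) (\det A) rows cols)) != 0)
    (h : 'X_{1..s}) (j0 : 'I_q) (hj0 : cols j0 = h)
    (Tr : forall m : nat, ('I_m -> {mpoly {fraction {mpoly rat[N]}}[s]}) ->
      precochain s {fraction {mpoly rat[N]}} n.+1 m -> {fraction {mpoly rat[N]}})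
    (hTr : is_trace eta Sigma Tr) :
  let M := rowsub r (phi_matrix (generic u) (\det A) rows cols) in
  let F := fun i => map_mpoly (@FracField.tofrac {mpoly rat[N]}) (generic u i) in
  ((0 < n)%N -> exists i0, rows (r i0) = None) /\
  forall i0, rows (r i0) = None ->
    let quotient := (\det (row' i0 (col' j0 M)))%:F / (\det M)%:F in
    toric_residue eta Tr F 'X_[h] = quotient \/
    toric_residue eta Tr F 'X_[h] = - quotient.
Proof.
move=> M F; split=> [n0|i0 hi0 quotient]; last rewrite -hj0.
  exact: (residue_none hX halpha hu hsigma hA hF hcols hTr hrows hdet n0).
exact: (residue_cramer hX halpha hu hsigma hA hF hcols hTr hrows hr hdet j0 hi0).
Qed.
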